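(* Let $M^8$ be an eight-manifold with a $\mathrm{Spin}(7)$-structure with fundamental form $\Phi$, metric $\langle\cdot,\cdot\rangle$, Levi-Civita connection $\nabla$ and Lee form $\theta^8$. The minimal $\mathrm{Spin}(7)$-connection is given by $\nabla^{\mathrm{Spin}(7)}=\nabla+\xi^{\mathrm{Spin}(7)}$, where the intrinsic torsion $\xi^{\mathrm{Spin}(7)}$ is determined by $$\langle \xi^{\mathrm{Spin}(7)}_XY,Z\rangle=\tfrac14\,\overline r(\nabla\Phi)(X,Y,Z)$$ for all vectors $X,Y,Z$. Equivalently, $$\xi^{\mathrm{Spin}(7)}_XY=-\frac{\sigma}{24}\sum_{i,j\in\mathbb Z_8}\overline r(\nabla\Phi)(X,e_i,e_j)\,P(e_i,e_j,Y),$$ where $\{e=e_7,e_0,\dots,e_6\}$ is a Cayley frame. The tensor $\overline r(\nabla\Phi)$ is expressed in terms of $d\Phi$ by $$4\,\overline r(\nabla\Phi)(X,Y,Z)=2\,\langle X\lrcorner d\Phi,\;Y\wedge(Z\lrcorner\Phi)-Z\wedge(Y\lrcorner\Phi)\rangle-7\,(X\wedge\theta^8)(Y,Z).$$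
   Context: Fix $\sigma\in\{1,-1\}$. A $\mathrm{Spin}(7)$-structure on an eight-manifold is given by a global 4-form $\Phi$ (the fundamental form) which can locally be written $$\Phi=\sum_{i\in\mathbb Z_7}e\wedge e_i\wedge e_{i+1}\wedge e_{i+3}-\sigma\sum_{i\in\mathbb Z_7}e_{i+2}\wedge e_{i+4}\wedge e_{i+5}\wedge e_{i+6}$$ (indices mod 7) in some local frame $\{e,e_0,\dots,e_6\}$, called a Cayley frame; when summing over $\mathbb Z_8$ one writes $e_7=e$. $\Phi$ determines a Riemannian metric $\langle\cdot,\cdot\rangle$ for which Cayley frames are orthonormal, and the orientation is $e\wedge e_0\wedge\dots\wedge e_6=\frac{\sigma}{14}\Phi\wedge\Phi$; $*$ is the Hodge star. Vectors and 1-forms are identified via the metric. The inner product of $p$-forms is $\langle\alpha,\beta\rangle=\frac1{p!}\sum\alpha(e_{i_1},\dots,e_{i_p})\beta(e_{i_1},\dots,e_{i_p})$ over an orthonormal basis; $\lrcorner$ is interior product; $(X\wedge Y)(U,V)=\langle X,U\rangle\langle Y,V\rangle-\langle X,V\rangle\langle Y,U\rangle$. The three-fold vector cross product $P$ is defined by $\langle P(X_1,X_2,X_3),X_4\rangle=\Phi(X_1,X_2,X_3,X_4)$. The tensor $\overline r(\nabla\Phi)$ is defined by $\overline r(\nabla\Phi)(X,Y,Z)=\frac18\langle\nabla_X\Phi,\;Y\wedge(Z\lrcorner\Phi)-Z\wedge(Y\lrcorner\Phi)\rangle$. The Lee form is $\theta^8=-\frac17*( *d\Phi\wedge\Phi)$.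 The minimal $\mathrm{Spin}(7)$-connection is the unique metric connection $\nabla^{\mathrm{Spin}(7)}$ with $\nabla^{\mathrm{Spin}(7)}\Phi=0$ such that, for every $X$, $\xi^{\mathrm{Spin}(7)}_X=\nabla^{\mathrm{Spin}(7)}_X-\nabla_X$ lies in $\mathfrak{spin}(7)^\perp$, the orthogonal complement of $\mathfrak{spin}(7)$ in $\mathfrak{so}(8)\cong\Lambda^2T^*M$; $\xi^{\mathrm{Spin}(7)}$ is the intrinsic torsion.
   Formalization: The last formula is false as printed whenever the Lee form is nonzero (e.g. Φ = e^{4h}Φ_0 on R^8); the formal version adds the term +7σΦ(X,θ^8,Y,Z) to its right-hand side, which vanishes where θ^8 = 0. *)

(* Defs.v *)
From HB Require Import structures.
From mathcomp Require Import all_boot all_order all_algebra all_fingroup.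
From mathcomp Require Import all_classical all_reals all_analysis.

Set Implicit Arguments.
Unset Strict Implicit.
Unset Printing Implicit Defensive.

Import Order.TTheory GRing.Theory Num.Theory.
Import numFieldNormedType.Exports.

Local Open Scope classical_set_scope.
Local Open Scope ring_scope.

(** * Multilinear algebra on a real vector space *)

Section Vectors.
Variables (R : realType) (V : lmodType R).

(* A k-form is a function of a family of k vectors; being multilinear and
   alternating is the predicate [is_form]. *)
Definition form (k : nat) := ('I_k -> V) -> R.

Definition is_form k (a : form k) : Prop :=
  (forall v i (c : R) x y, a [eta v with i |-> c *: x + y] =
     c * a [eta v with i |-> x] + a [eta v with i |-> y]) /\
  (forall v i j, i != j -> v i = v j -> a v = 0).

Definition fcons k (x : V) (v : 'I_k -> V) : 'I_k.+1 -> V :=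
  fun i => if unlift ord0 i is Some j then v j else x.

Definition fcat k m (u : 'I_k -> V) (v : 'I_m -> V) : 'I_(k + m) -> V :=
  fun i => match fintype.split i with inl a => u a | inr b => v b end.

Definition vec3 (x y z : V) : 'I_3 -> V :=
  fcons x (fcons y (fun=> z)).
Definition vec4 (x y z w : V) : 'I_4 -> V :=
  fcons x (vec3 y z w).

Definition form1 (a : V -> R) : form 1 := fun v => a (v ord0).

(* Normalised so that a wedge product of 1-forms is a determinant:
   (a /\ b)(X, Y) = a X * b Y - a Y * b X. *)
Definition wedge k m (a : form k) (b : form m) : form (k + m) := fun v =>
  (k`!%:R * m`!%:R)^-1 *
  \sum_(s : 'S_(k + m)) (-1) ^+ (s : bool) *
     (a (fun i => v (s (lshift m i))) * b (fun j => v (s (rshift k j)))).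

Definition wedge4 (a b c d : V -> R) : form 4 :=
  wedge (form1 a) (wedge (form1 b) (wedge (form1 c) (form1 d))).

Definition int_prod k (x : V) (a : form k.+1) : form k :=
  fun v => a (fcons x v).

Section Metric.
Variable g : V -> V -> R.

Definition is_inner_product : Prop :=
  [/\ forall (c : R) x y z, g (c *: x + y) z = c * g x z + g y z,
      forall x y, g x y = g y x &
      forall x, x != 0 -> 0 < g x x].

Definition orthonormal n (b : 'I_n -> V) : Prop :=
  forall i j, g (b i) (b j) = (i == j)%:R.

Definition spanning n (b : 'I_n -> V) : Prop :=
  forall x, exists c : 'I_n -> R, x = \sum_i c i *: b i.

(* An orthonormal basis of the 8-dimensional space V; the constructions below
   do not depend on which one is chosen. *)
Definition onb : 'I_8 -> V :=
  xget (fun=> 0) [set b : 'I_8 -> V | orthonormal b /\ spanning b].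

Definition inner_form k (a b : form k) : R :=
  (k`!%:R)^-1 *
  \sum_(s : {ffun 'I_k -> 'I_8}) a (fun i => onb (s i)) * b (fun i => onb (s i)).

(* The Hodge star for the volume form vol: the (8-k)-form *a such that
   b /\ *a = <b, a> vol for every k-form b. *)
Definition star k m (vol : form (k + m)) (a : form k) : form m := fun v =>
  (k`!%:R)^-1 *
  \sum_(s : {ffun 'I_k -> 'I_8})
     a (fun i => onb (s i)) * vol (fcat (fun i => onb (s i)) v).

Definition sharp (a : V -> R) : V :=
  xget 0 [set w | forall x, g w x = a x].

Definition is_skew (A : V -> V) : Prop :=
  linear A /\ forall x y, g (A x) y = - g x (A y).

Definition form_of_skew (A : V -> V) : form 2 :=
  fun v => g (A (v ord0)) (v ord_max).

End Metric.

Definition dual_basis n (e : 'I_n -> V) (eps : 'I_n -> {scalar V}) : Prop :=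
  (forall i j, eps i (e j) = (i == j)%:R) /\
  (forall x, x = \sum_i eps i x *: e i).

(* Residues mod 7 seen as the indices 0, ..., 6 of 'I_8; the remaining index
   ord_max = 7 is that of the vector e = e_7. *)
Definition z7 (i : nat) : 'I_8 := inord (i %% 7).

Definition cayley_form (sigma : R) (eps : 'I_8 -> {scalar V}) : form 4 :=
  fun v =>
  \sum_(i < 7)
     wedge4 (eps ord_max) (eps (z7 i)) (eps (z7 (i + 1))) (eps (z7 (i + 3))) v
  - sigma * \sum_(i < 7)
     wedge4 (eps (z7 (i + 2))) (eps (z7 (i + 4))) (eps (z7 (i + 5)))
            (eps (z7 (i + 6))) v.

Definition cayley_frame (sigma : R) (Phi : form 4) (e : 'I_8 -> V) : Prop :=
  exists2 eps, dual_basis e eps & forall v, Phi v = cayley_form sigma eps v.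

Section Spin7Algebra.
Variables (sigma : R) (g : V -> V -> R) (Phi : form 4).

(* Lie algebra of the stabiliser of Phi. *)
Definition spin7 (A : V -> V) : Prop :=
  is_skew g A /\
  forall v, \sum_(i < 4) Phi [eta v with i |-> A (v i)] = 0.

Definition spin7_perp (A : V -> V) : Prop :=
  is_skew g A /\
  forall B, spin7 B -> inner_form g (form_of_skew g A) (form_of_skew g B) = 0.

Definition cross3 (x y z : V) : V :=
  sharp g (fun w => Phi (vec4 x y z w)).

Definition spin7_vol : form 8 :=
  fun v => sigma / 14%:R * @wedge 4 4 Phi Phi v.

Definition wedge_interior (y z : V) : form 4 :=
  @wedge 1 3 (form1 (g y)) (@int_prod 3 z Phi).

Definition test_form (y z : V) : form 4 :=
  fun v => wedge_interior y z v - wedge_interior z y v.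

Definition lee_of (dPhi : form 5) (x : V) : R :=
  let star_dPhi : form 3 := @star g 5 3 spin7_vol dPhi in
  - (7%:R)^-1 * @star g 7 1 spin7_vol (@wedge 3 4 star_dPhi Phi) (fun=> x).

End Spin7Algebra.

End Vectors.

(** * Smooth manifolds *)

Section SmoothEuclidean.
Variables (R : realType) (n : nat).

Fixpoint Ck (k : nat) (W : set 'rV[R]_n) (f : 'rV[R]_n -> R) : Prop :=
  if k is k'.+1 then
    (forall x, W x -> differentiable f x) /\
    (forall v : 'rV[R]_n, Ck k' W ('D_v f))
  else forall x, W x -> {for x, continuous f}.

Definition smooth_fun (W : set 'rV[R]_n) (f : 'rV[R]_n -> R) : Prop :=
  forall k, Ck k W f.

End SmoothEuclidean.

Record smooth_manifold (R : realType) (n : nat) := SmoothManifold {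
  sm_space :> topologicalType;
  sm_hausdorff : hausdorff_space sm_space;
  sm_second_countable : @second_countable sm_space;
  chart_index : Type;
  chart_dom : chart_index -> set sm_space;
  chart : chart_index -> sm_space -> 'rV[R]_n;
  chart_inv : chart_index -> 'rV[R]_n -> sm_space;
  chart_cover : forall p, exists i, chart_dom i p;
  chart_dom_open : forall i, open (chart_dom i);
  chart_image_open : forall i, open (chart i @` chart_dom i);
  chartK : forall i p, chart_dom i p -> chart_inv i (chart i p) = p;
  chart_continuous : forall i p, chart_dom i p -> {for p, continuous (chart i)};
  chart_inv_continuous : forall i x, (chart i @` chart_dom i) x ->
    {for x, continuous (chart_inv i)};
  transition_smooth : forall i j a,
    smooth_fun (chart i @` (chart_dom i `&` chart_dom j))
      (fun x => chart j (chart_inv i x) ord0 a) }.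

Section Manifold.
Variables (R : realType) (n : nat) (M : smooth_manifold R n).
Implicit Types (U : set M) (p q : M) (f h : M -> R).

Definition smooth_on U f : Prop :=
  forall i : chart_index M,
    smooth_fun (chart i @` (chart_dom i `&` U)) (fun x => f (chart_inv i x)).

Definition smooth_near p f : Prop :=
  exists U, [/\ open U, U p & smooth_on U f].

(* Derivations at p of the algebra of germs of smooth functions. A germ is
   represented by any function M -> R inducing it; the last clause makes the
   representation of a derivation unique. *)
Definition is_derivation p (v : (M -> R) -> R^o) : Prop :=
  [/\ forall (c : R) f h, smooth_near p f -> smooth_near p h ->
        v (fun q => c * f q + h q) = c * v f + v h,
      forall f h, smooth_near p f -> smooth_near p h ->
        v (fun q => f q * h q) = v f * h p + f p * v h,
      forall f h, smooth_near p f -> smooth_near p h ->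
        (\forall q \near p, f q = h q) -> v f = v h &
      forall f, ~ smooth_near p f -> v f = 0].

Definition derivations p : {pred (M -> R) -> R^o} :=
  fun v => `[< is_derivation p v >].

Lemma derivations_submod p : submod_closed (derivations p).
Proof.
split=> [|c v w]; rewrite !unfold_in.
  by apply/asboolP; split=> *; rewrite ?mulr0 ?mul0r ?addr0.
move=> /asboolP[v1 v2 v3 v4] /asboolP[w1 w2 w3 w4]; apply/asboolP.
have E f : (c *: v + w) f = c * v f + w f by [].
split=> [a f h sf sh|f h sf sh|f h sf sh fh|f sf]; rewrite !E.
- by rewrite v1// w1// !mulrDr !mulrA [c * a]mulrC addrACA.
- by rewrite v2// w2// !mulrDr !mulrDl !mulrA [f p * c]mulrC addrACA.
- by rewrite (v3 f h)// (w3 f h).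
- by rewrite v4// w4// mulr0 addr0.
Qed.

HB.instance Definition _ p :=
  GRing.isSubmodClosed.Build R ((M -> R) -> R^o) (derivations p)
    (derivations_submod p).

(* The tangent space at p. *)
Record tangent p := Tangent {
  tangent_val :> (M -> R) -> R^o;
  tangentP : tangent_val \in derivations p }.

HB.instance Definition _ p := [isSub for @tangent_val p].
HB.instance Definition _ p := [Choice of tangent p by <:].
HB.instance Definition _ p := [SubChoice_isSubLmodule of tangent p by <:].

Definition vfield := forall p : M, tangent p.
Implicit Types X Y : vfield.

Definition smooth_field_on U X : Prop :=
  forall W f, open W -> W `<=` U -> smooth_on W f ->
    smooth_on W (fun q => X q f).

Definition smooth_field_near p X : Prop :=
  exists U, [/\ open U, U p & smooth_field_on U X].

(* A vector field, smooth near p, with prescribed value at p. It is only used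
   to evaluate expressions that are tensorial, hence independent of it. *)
Definition extend p (v : tangent p) : vfield :=
  xget (fun=> 0) [set X : vfield | smooth_field_near p X /\ X p = v].

Definition lie_bracket X Y p : tangent p :=
  xget 0 [set w : tangent p | forall f, smooth_near p f ->
    w f = X p (fun q => Y q f) - Y p (fun q => X q f)].

Definition form_field (k : nat) := forall p : M, form (tangent p) k.

Definition differential_form k (a : form_field k) : Prop :=
  (forall p, is_form (a p)) /\
  (forall U (X : 'I_k -> vfield), open U ->
     (forall i, smooth_field_on U (X i)) ->
     smooth_on U (fun q => a q (fun i => X i q))).

(* The invariant formula
     d a (X_0, ..., X_{k+1}) =
       sum_i (-1)^i X_i (a (X_0, .., omit X_i, .., X_{k+1}))
     + sum_{i<j} (-1)^{i+j} a ([X_i, X_j], .., omit X_i, X_j, ..);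
   the pairs i < j are parametrised by i and j', where j = lift i j' = j'.+1. *)
Definition ext_d k (a : form_field k.+1) : form_field k.+2 := fun p v =>
  \sum_(i < k.+2) (-1) ^+ i *
     v i (fun q => a q (fun j => extend (v (lift i j)) q))
  + \sum_(i < k.+2) \sum_(j < k.+1 | (i <= j)%N) (-1) ^+ (i + j.+1) *
     a p (fcons (lie_bracket (extend (v i)) (extend (v (lift i j))) p)
                (fun l => v (lift i (lift j l)))).

Definition metric_field := forall p : M, tangent p -> tangent p -> R.

Definition riemannian_metric (g : metric_field) : Prop :=
  (forall p, is_inner_product (g p)) /\
  (forall U X Y, open U -> smooth_field_on U X -> smooth_field_on U Y ->
     smooth_on U (fun q => g q (X q) (Y q))).

Definition connection_data := forall p : M, tangent p -> vfield -> tangent p.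

(* An affine connection, as a covariant derivative acting on germs of smooth
   vector fields. *)
Record is_connection (D : connection_data) : Prop := IsConnection {
  conn_linear : forall p (c : R) (v w : tangent p) Y, smooth_field_near p Y ->
    D p (c *: v + w) Y = c *: D p v Y + D p w Y;
  conn_add : forall p (v : tangent p) Y Z,
    smooth_field_near p Y -> smooth_field_near p Z ->
    D p v (fun q => Y q + Z q) = D p v Y + D p v Z;
  conn_leibniz : forall p (v : tangent p) f Y,
    smooth_near p f -> smooth_field_near p Y ->
    D p v (fun q => f q *: Y q) = v f *: Y p + f p *: D p v Y;
  conn_local : forall p (v : tangent p) Y Z,
    smooth_field_near p Y -> smooth_field_near p Z ->
    (\forall q \near p, Y q = Z q) -> D p v Y = D p v Z;
  conn_smooth : forall U X Y, open U ->
    smooth_field_on U X -> smooth_field_on U Y ->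
    smooth_field_on U (fun q => D q (X q) Y) }.

Definition metric_connection (g : metric_field) (D : connection_data) : Prop :=
  is_connection D /\
  forall p (v : tangent p) X Y, smooth_field_near p X -> smooth_field_near p Y ->
    v (fun q => g q (X q) (Y q)) = g p (D p v X) (Y p) + g p (X p) (D p v Y).

Definition levi_civita (g : metric_field) (D : connection_data) : Prop :=
  metric_connection g D /\
  forall p X Y, smooth_field_near p X -> smooth_field_near p Y ->
    D p (X p) Y - D p (Y p) X = lie_bracket X Y p.

Definition cov_deriv (D : connection_data) k (a : form_field k)
    p (x : tangent p) : form (tangent p) k := fun v =>
  x (fun q => a q (fun i => extend (v i) q))
  - \sum_(i < k) a p [eta v with i |-> D p x (extend (v i))].

(* The tensor D' - D. *)
Definition conn_diff (D' D : connection_data) p (x y : tangent p) : tangent p :=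
  D' p x (extend y) - D p x (extend y).

End Manifold.

Arguments ext_d {R n M k} a p v.
Arguments lie_bracket {R n M} X Y p.

(** * Spin(7)-structures *)

Section Spin7.
Variables (R : realType) (M : smooth_manifold R 8) (sigma : R).
Unset Implicit Arguments.
Variables (Phi : form_field M 4) (g : metric_field M).
Set Implicit Arguments.

Record spin7_structure : Prop := Spin7Structure {
  spin7_form : differential_form Phi;
  spin7_local_frame : forall p : M, exists U (e : 'I_8 -> vfield M),
    [/\ open U, U p, forall a, smooth_field_on U (e a) &
        forall q, U q -> cayley_frame sigma (Phi q) (fun a => e a q)];
  spin7_metric : riemannian_metric g;
  spin7_orthonormal : forall (p : M) (e : 'I_8 -> tangent p),
    cayley_frame sigma (Phi p) e -> orthonormal (g p) e }.

Definition rbar (nabla : connection_data M) (p : M) (x y z : tangent p) : R :=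
  (8%:R)^-1 *
  inner_form (g p) (cov_deriv nabla Phi x) (test_form (g p) (Phi p) y z).

Definition lee_form (p : M) (x : tangent p) : R :=
  lee_of sigma (g p) (Phi p) (ext_d Phi p) x.

(* D is a minimal Spin(7)-connection, nabla being the Levi-Civita connection. *)
Definition minimal_spin7_connection (nabla D : connection_data M) : Prop :=
  [/\ metric_connection g D,
      forall (p : M) (x : tangent p) v, cov_deriv D Phi x v = 0 &
      forall (p : M) (x : tangent p),
        spin7_perp (g p) (Phi p) (conn_diff D nabla x)].

Definition lee_vector (p : M) : tangent p := sharp (g p) (lee_form (p := p)).

Definition wedge_lee (p : M) (x y z : tangent p) : R :=
  g p x y * lee_form z - g p x z * lee_form y.

End Spin7.

(* Main.v *)
Require Import Defs.
From mathcomp Require Import all_boot all_order all_algebra all_fingroup.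
From mathcomp Require Import all_classical all_reals all_analysis.
From mathcomp Require Import ring lra zify.
Require Import Defs.

Set Implicit Arguments.
Unset Strict Implicit.
Unset Printing Implicit Defensive.

Import Order.TTheory GRing.Theory Num.Theory.
Import numFieldNormedType.Exports.

Local Open Scope classical_set_scope.
Local Open Scope ring_scope.

(** Everything that is special to [Phi] is contained in the contraction identity
    [sum_(p, q) Phi(x, y, p, q) Phi(z, w, p, q)
     = 6 (<x, z> <y, w> - <x, w> <y, z>) - 4 sigma Phi(x, y, z, w)]
    over an orthonormal basis, which is verified on the components of [Phi] in a
    Cayley frame ([contraction2_check], [contract2]). It says that contraction
    with [Phi] satisfies a quadratic equation on two-forms
    ([phi_map_phi_map]), so it splits them into two eigenspaces; [proj7] is the
    projection to the one of dimension seven, for the eigenvalue [-6 sigma] of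
    [phi_map], and [is7] is membership in it. Let [act A] be the action of a
    skew endomorphism [A] on [Phi] as a derivation. The same identity gives
    [<act A, act B> = 384 <proj7 A, B>], up to the normalisation of the inner
    product of forms ([sum_act2]). So the Lie algebra spin(7), the kernel of
    [act], is the kernel of [proj7], its complement is the eigenspace [is7]
    ([spin7_perp_is7]), [act] does not change when [A] is replaced by its
    projection ([act_proj7]), and pairing [act A] with the forms in the
    definition of [rbar] returns [4 proj7 A] ([inner_derivation_test]).

    In a local Cayley frame the components of [Phi] are constant. Hence the
    covariant derivative of [Phi] is, up to sign, the action on [Phi] of the
    connection form of the frame ([cov_deriv_Phi]), which is skew because the
    frame is orthonormal. Projecting the connection form gives [torsion], with
    values in the complement of spin(7), equal to one fourth of [rbar], and
    with the same action on [Phi]. Therefore the sum of the Levi-Civita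
    connection and [torsion] is metric and preserves [Phi]
    ([torsion_minimal]); and if [D] is any minimal connection, its difference
    tensor lies in the complement and acts on [Phi] as the covariant derivative
    does, so it is [torsion] ([minimal_conn_diff]). The formula with the cross
    product is the eigenvalue equation of [is7] ([is7_cross3]).

    Since the Levi-Civita connection has no torsion, the exterior derivative of
    [Phi] is the alternation of its covariant derivative ([ext_d_cov_deriv]),
    that is, of [X |-> act (A_X)] with [A_X] the torsion. For [A] in the
    eigenspace, [act A] is an explicit expression in which [A] is applied to the
    last argument only ([act_is7]); this evaluates all contractions of the
    exterior derivative with [Phi] in terms of [A] and of its trace
    [tau(X) = sum_p <A_p X, p>] ([alt_act_projection]). The Lee form is such a
    contraction, once the two Hodge stars are removed ([lee_of_contraction]),
    and equals [-16/7 tau] ([lee_alt_derivation]). *)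
(** * Smooth functions on open subsets of a Euclidean space *)

Lemma near_eq_differentiable (R : numFieldType) (V W : normedModType R)
    (f h : V -> W) (x : V) :
  (\forall y \near x, f y = h y) -> differentiable f x -> differentiable h x.
Proof.
move=> fh /diff_locallyP[dc df].
have hx : f x = h x := nbhs_singleton fh.
have dh : h \o shift x = cst (h x) + 'd f x +o_ 0 id.
  have fh0 : \forall y \near 0, f (y + x) = h (y + x).
    by move: fh; rewrite (near_shift 0 x) /= subr0.
  apply/eqaddoP => e e0; move/eqaddoP: df => /(_ e e0) df.
  near=> y.
  suff -> : (h \o shift x - (cst (h x) + 'd f x)) y =
            (f \o shift x - (cst (f x) + 'd f x)) y by near: y.
  rewrite /= !fctE hx; congr (_ - _).
  suff : f (y + x) = h (y + x) by move=> <-.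
  by near: y.
by apply/diff_locallyP; rewrite (diff_unique dc dh).
Unshelve. all: by end_near.
Qed.

Section SmoothEuclideanTheory.
Variables (R : realType) (n : nat).
Implicit Types (W : set 'rV[R]_n) (f h : 'rV[R]_n -> R).

Lemma Ck_sub k W W' f : W' `<=` W -> Ck k W f -> Ck k W' f.
Proof.
move=> sW; elim: k f => [|k IH] f /=; first by move=> cf x /sW; exact: cf.
by move=> [df Df]; split=> [x /sW|v]; [exact: df|exact/IH/Df].
Qed.

(** Being of class [C^k] is a condition at each point. *)
Lemma Ck_local k W f :
  (forall x, W x -> exists2 W', W' x & Ck k W' f) -> Ck k W f.
Proof.
elim: k f => [|k IH] f /= loc; first by move=> x /loc[W' W'x]; exact.
split=> [x /loc[W' W'x [df _]]|v]; first exact: df.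
by apply: IH => x /loc[W' W'x [_ Df]]; exists W'.
Qed.

Lemma eq_Ck k W f h : open W -> (forall x, W x -> f x = h x) ->
  Ck k W f -> Ck k W h.
Proof.
move=> oW.
have near_eq f' h' x : (forall y, W y -> f' y = h' y) -> W x ->
    \forall y \near x, f' y = h' y.
  by move=> fh Wx; apply: filterS (open_nbhs_nbhs (conj oW Wx)).
elim: k f h => [|k IH] f h fh /=.
  move=> cf x Wx; rewrite /prop_for /continuous_at -fh//.
  move=> A /(cf x Wx); apply: filterS2 (near_eq _ _ _ fh Wx).
  by move=> y /= <-.
move=> [df Df]; split=> [x Wx|v].
  by apply: near_eq_differentiable (df x Wx); exact: near_eq.
apply: IH (Df v) => x Wx.
by apply: near_eq_derive; exact: near_eq.
Qed.

Lemma CkW k W f : Ck k.+1 W f -> Ck k W f.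
Proof.
elim: k f => [|k IH] f /= [df Df].
  by move=> x Wx; exact/differentiable_continuous/df.
by split=> // v; apply: IH; exact: Df.
Qed.

Lemma Ck_cst k W (c : R) : Ck k W (cst c).
Proof.
elim: k c => [|k IH] c /=; first by move=> x _; exact: cst_continuous.
split=> [x _|v]; first exact: differentiable_cst.
have -> : 'D_v (cst c : 'rV[R]_n -> R) = cst 0.
  by apply/funext => x; rewrite derive_cst.
exact: IH.
Qed.

Lemma CkD k W f h : open W -> Ck k W f -> Ck k W h ->
  Ck k W (fun x => f x + h x).
Proof.
move=> oW; elim: k f h => [|k IH] f h /=.
  by move=> cf ch x Wx; apply: continuousD; [exact: cf|exact: ch].
move=> [df Df] [dh Dh]; split=> [x Wx|v].
  by apply: differentiableD; [exact: df|exact: dh].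
apply: eq_Ck (IH _ _ (Df v) (Dh v)) => // x Wx.
by rewrite -[RHS]/('D_v (f + h) x) deriveD//; apply: diff_derivable;
  [exact: df|exact: dh].
Qed.

Lemma CkM k W f h : open W -> Ck k W f -> Ck k W h ->
  Ck k W (fun x => f x * h x).
Proof.
move=> oW; elim: k f h => [|k IH] f h.
  by move=> /= cf ch x Wx; apply: continuousM; [exact: cf|exact: ch].
move=> Cf Ch; have := CkW Cf; have := CkW Ch.
move: Cf Ch => /= [df Df] [dh Dh] Ch Cf; split=> [x Wx|v].
  by apply: differentiableM; [exact: df|exact: dh].
apply: eq_Ck (CkD oW (IH _ _ Cf (Dh v)) (IH _ _ Ch (Df v))) => // x Wx.
by rewrite -[RHS]/('D_v (f * h) x) deriveM//; apply: diff_derivable;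
  [exact: df|exact: dh].
Qed.

End SmoothEuclideanTheory.
(** * Smooth functions, tangent vectors and vector fields on a manifold *)

Section ManifoldTheory.
Variables (R : realType) (n : nat) (M : smooth_manifold R n).
Implicit Types (U W : set M) (p q : M) (f h : M -> R) (X Y : vfield M).

Lemma chart_image_sub_open (i : chart_index M) U :
  open U -> open (chart i @` (chart_dom i `&` U)).
Proof.
move=> oU; rewrite openE => _ [q [dq Uq] <-].
have iq : (chart i @` chart_dom i) (chart i q) by exists q.
have nU : nbhs (chart i q) (chart_inv i @^-1` U).
  apply: (chart_inv_continuous iq); rewrite chartK//.
  exact: open_nbhs_nbhs.
have nI : nbhs (chart i q) (chart i @` chart_dom i).
  by apply: open_nbhs_nbhs; split => //; exact: chart_image_open.
apply: filterS2 nU nI => x Ux [r dr rx].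
by exists r => //; split => //; move: Ux; rewrite /preimage/= -rx chartK.
Qed.

Lemma smooth_on_sub U W f : W `<=` U -> smooth_on U f -> smooth_on W f.
Proof.
move=> sWU sf i k; apply: Ck_sub (sf i k).
by apply: image_subset; exact: setIS.
Qed.

Lemma smooth_on_local W f :
  (forall p, W p -> exists2 W', W' p & smooth_on (W `&` W') f) ->
  smooth_on W f.
Proof.
move=> loc i k; apply: Ck_local => _ [q [dq /[dup] Wq /loc[W' W'q sf]] <-].
by exists (chart i @` (chart_dom i `&` (W `&` W'))); [exists q|exact: sf].
Qed.

Lemma eq_smooth_on W f h : open W -> (forall q, W q -> f q = h q) ->
  smooth_on W f -> smooth_on W h.
Proof.
move=> oW fh sf i k; apply: eq_Ck (sf i k); first exact: chart_image_sub_open.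
by move=> _ [q [dq Wq] <-]; rewrite chartK//; exact: fh.
Qed.

Lemma smooth_on_cst W (c : R) : smooth_on W (fun=> c).
Proof. by move=> i k; exact: Ck_cst. Qed.

Lemma smooth_onD W f h : open W -> smooth_on W f -> smooth_on W h ->
  smooth_on W (fun q => f q + h q).
Proof.
by move=> oW sf sh i k; apply: CkD; [exact: chart_image_sub_open|exact: sf|
  exact: sh].
Qed.

Lemma smooth_onM W f h : open W -> smooth_on W f -> smooth_on W h ->
  smooth_on W (fun q => f q * h q).
Proof.
by move=> oW sf sh i k; apply: CkM; [exact: chart_image_sub_open|exact: sf|
  exact: sh].
Qed.

Lemma smooth_on_sum W (I : Type) (r : seq I) (P : pred I) (f : I -> M -> R) :
  open W -> (forall i, smooth_on W (f i)) ->
  smooth_on W (fun q => \sum_(i <- r | P i) f i q).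
Proof.
move=> oW sf; elim: r => [|i r IH].
  rewrite (_ : (fun q => _) = fun=> 0); first exact: smooth_on_cst.
  by apply/funext => q; rewrite big_nil.
have -> : (fun q => \sum_(j <- i :: r | P j) f j q) =
    (fun q => (P i)%:R * f i q + \sum_(j <- r | P j) f j q).
  by apply/funext => q; rewrite big_cons; case: (P i); rewrite ?mul1r// mul0r add0r.
apply: smooth_onD => //; apply: smooth_onM => //; exact: smooth_on_cst.
Qed.

Lemma smooth_near_cst p (c : R) : smooth_near p (fun=> c).
Proof. by exists setT; split => //; [exact: openT|exact: smooth_on_cst]. Qed.

Lemma smooth_nearD p f h : smooth_near p f -> smooth_near p h ->
  smooth_near p (fun q => f q + h q).
Proof.
move=> [U [oU Up sf]] [W [oW Wp sh]]; exists (U `&` W).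
split=> //; first exact: openI.
by apply: smooth_onD; [exact: openI|apply: smooth_on_sub sf|
  apply: smooth_on_sub sh] => q [].
Qed.

Lemma smooth_nearM p f h : smooth_near p f -> smooth_near p h ->
  smooth_near p (fun q => f q * h q).
Proof.
move=> [U [oU Up sf]] [W [oW Wp sh]]; exists (U `&` W).
split=> //; first exact: openI.
by apply: smooth_onM; [exact: openI|apply: smooth_on_sub sf|
  apply: smooth_on_sub sh] => q [].
Qed.

Lemma smooth_near_sum p (I : Type) (r : seq I) (P : pred I) (f : I -> M -> R) :
  (forall i, smooth_near p (f i)) ->
  smooth_near p (fun q => \sum_(i <- r | P i) f i q).
Proof.
move=> sf; elim: r => [|i r IH].
  rewrite (_ : (fun q => _) = fun=> 0); first exact: smooth_near_cst.
  by apply/funext => q; rewrite big_nil.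
have -> : (fun q => \sum_(j <- i :: r | P j) f j q) =
    (fun q => (P i)%:R * f i q + \sum_(j <- r | P j) f j q).
  by apply/funext => q; rewrite big_cons; case: (P i); rewrite ?mul1r// mul0r add0r.
apply: smooth_nearD => //; apply: smooth_nearM => //; exact: smooth_near_cst.
Qed.

Section TangentVector.
Variables (p : M) (v : tangent p).

Let vP : is_derivation p v.
Proof. by have := tangentP v; rewrite unfold_in => /asboolP. Qed.

Lemma tangent_eq f h : smooth_near p f -> smooth_near p h ->
  (\forall q \near p, f q = h q) -> v f = v h.
Proof. by have [_ _ + _] := vP; exact. Qed.

Lemma tangentM f h : smooth_near p f -> smooth_near p h ->
  v (fun q => f q * h q) = v f * h p + f p * v h.
Proof. by have [_ + _ _] := vP; exact. Qed.

Lemma tangent_cst (c : R) : v (fun=> c) = 0.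
Proof.
have v1 : v (fun=> 1) = 0.
  have := tangentM (smooth_near_cst p 1) (smooth_near_cst p 1).
  rewrite !mulr1 !mul1r => /eqP.
  by rewrite -subr_eq0 opprD addrA subrr add0r oppr_eq0 => /eqP.
have [+ _ _ _] := vP => /(_ (c - 1) (fun=> 1) (fun=> 1)).
rewrite v1 mulr0 addr0 => <-; try exact: smooth_near_cst.
by congr (tangent_val v _); apply/funext => q; rewrite mulr1 subrK.
Qed.

Lemma tangentD f h : smooth_near p f -> smooth_near p h ->
  v (fun q => f q + h q) = v f + v h.
Proof.
have [+ _ _ _] := vP => /(_ 1 f h) lin sf sh.
by rewrite -[v f]mul1r -lin//; congr (tangent_val v _); apply/funext => q; rewrite mul1r.
Qed.

Lemma tangentZ (c : R) f : smooth_near p f -> v (fun q => c * f q) = c * v f.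
Proof.
by move=> sf; rewrite tangentM// ?tangent_cst ?mul0r ?add0r//; exact: smooth_near_cst.
Qed.

Lemma tangent_sum (I : Type) (r : seq I) (P : pred I) (f : I -> M -> R) :
  (forall i, smooth_near p (f i)) ->
  v (fun q => \sum_(i <- r | P i) f i q) = \sum_(i <- r | P i) v (f i).
Proof.
move=> sf; elim: r => [|i r IH].
  rewrite big_nil -[RHS](tangent_cst 0); congr (tangent_val v _).
  by apply/funext => q; rewrite big_nil.
rewrite big_cons -IH; case: ifPn => Pi; last first.
  by congr (tangent_val v _); apply/funext => q; rewrite big_cons (negPf Pi).
rewrite -tangentD//; last exact: smooth_near_sum.
by congr (tangent_val v _); apply/funext => q; rewrite big_cons Pi.
Qed.

End TangentVector.

Lemma smooth_field_on_sub U W X :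
  W `<=` U -> smooth_field_on U X -> smooth_field_on W X.
Proof. by move=> sWU sX W' f oW' sW'; apply: sX => //; exact: subset_trans sWU. Qed.

Lemma eq_smooth_field_on U X Y : (forall q, U q -> X q = Y q) ->
  smooth_field_on U X -> smooth_field_on U Y.
Proof.
move=> XY sX W f oW sWU sf; apply: eq_smooth_on (sX W f oW sWU sf) => // q /sWU.
by move=> /XY ->.
Qed.

Lemma smooth_field_on_local U X :
  (forall p, U p -> exists W, [/\ open W, W p & smooth_field_on (U `&` W) X]) ->
  smooth_field_on U X.
Proof.
move=> loc W f oW sWU sf; apply: smooth_on_local => p /[dup] Wp /sWU /loc.
move=> [W' [oW' W'p sX]]; exists W' => //; apply: sX; first exact: openI.
  by move=> q [/sWU Uq W'q].
by apply: smooth_on_sub sf => q [].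
Qed.

Lemma smooth_field_onD U X Y : smooth_field_on U X -> smooth_field_on U Y ->
  smooth_field_on U (fun q => X q + Y q).
Proof.
move=> sX sY W f oW sWU sf.
by apply: smooth_onD => //; [exact: sX|exact: sY].
Qed.

Lemma smooth_field_onZ U (c : M -> R) X : smooth_on U c ->
  smooth_field_on U X -> smooth_field_on U (fun q => c q *: X q).
Proof.
move=> sc sX W f oW sWU sf.
apply: smooth_onM => //; last exact: sX.
exact: smooth_on_sub sc.
Qed.

Lemma smooth_field_on0 U : smooth_field_on U (fun=> 0).
Proof. by move=> W f oW sWU sf; exact: smooth_on_cst. Qed.

Lemma smooth_field_on_sum U (I : Type) (r : seq I) (X : I -> vfield M) :
  (forall i, smooth_field_on U (X i)) ->
  smooth_field_on U (fun q => \sum_(i <- r) X i q).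
Proof.
move=> sX; elim: r => [|i r IH].
  by apply: eq_smooth_field_on (smooth_field_on0 (U:=U)) => q _; rewrite big_nil.
by apply: eq_smooth_field_on (smooth_field_onD (sX i) IH) => q _; rewrite big_cons.
Qed.

Lemma smooth_field_nearD p X Y : smooth_field_near p X ->
  smooth_field_near p Y -> smooth_field_near p (fun q => X q + Y q).
Proof.
move=> [U [oU Up sX]] [W [oW Wp sY]]; exists (U `&` W); split=> //.
  exact: openI.
by apply: smooth_field_onD; [apply: smooth_field_on_sub sX|
  apply: smooth_field_on_sub sY] => q [].
Qed.

Lemma smooth_field_nearZ p (c : M -> R) X : smooth_near p c ->
  smooth_field_near p X -> smooth_field_near p (fun q => c q *: X q).
Proof.
move=> [U [oU Up sc]] [W [oW Wp sX]]; exists (U `&` W); split=> //.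
  exact: openI.
apply: smooth_field_onZ; first by apply: smooth_on_sub sc => q [].
by apply: smooth_field_on_sub sX => q [].
Qed.

Lemma smooth_field_near0 p : smooth_field_near p (fun=> 0).
Proof. by exists setT; split=> //; [exact: openT|exact: smooth_field_on0]. Qed.

Lemma smooth_field_near_sum p (I : Type) (r : seq I) (X : I -> vfield M) :
  (forall i, smooth_field_near p (X i)) ->
  smooth_field_near p (fun q => \sum_(i <- r) X i q).
Proof.
move=> sX; elim: r => [|i r IH].
  have -> : (fun q => \sum_(j <- [::]) X j q) = (fun=> 0).
    by apply/functional_extensionality_dep => q; rewrite big_nil.
  exact: smooth_field_near0.
have -> : (fun q => \sum_(j <- i :: r) X j q) =
    (fun q => X i q + \sum_(j <- r) X j q).
  by apply/functional_extensionality_dep => q; rewrite big_cons.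
exact: smooth_field_nearD.
Qed.

End ManifoldTheory.
(** * Multilinear alternating forms *)

Section Forms.
Variables (R : realType) (V : lmodType R).
Implicit Types (x y z w : V) (c : R).

Definition multilinear k (a : form V k) : Prop :=
  forall v i c x y, a [eta v with i |-> c *: x + y] =
    c * a [eta v with i |-> x] + a [eta v with i |-> y].

Definition skew_form k (a : form V k) : Prop :=
  forall (v : 'I_k -> V) (s : 'S_k), a (v \o s) = (-1) ^+ (s : bool) * a v.

Lemma fcons0 k x (u : 'I_k -> V) : fcons x u ord0 = x.
Proof. by rewrite /fcons unlift_none. Qed.

Lemma fconsS k x (u : 'I_k -> V) i : fcons x u (lift ord0 i) = u i.
Proof. by rewrite /fcons liftK. Qed.

Lemma fcons_head_tail k (v : 'I_k.+1 -> V) :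
  fcons (v ord0) (v \o lift ord0) = v.
Proof.
apply/funext => i; case: (unliftP ord0 i) => [j ->|->]; first by rewrite fconsS.
by rewrite fcons0.
Qed.

Lemma fcatl k m (u : 'I_k -> V) (v : 'I_m -> V) i : fcat u v (lshift m i) = u i.
Proof. by rewrite /fcat (unsplitK (inl i)). Qed.

Lemma fcatr k m (u : 'I_k -> V) (v : 'I_m -> V) i : fcat u v (rshift k i) = v i.
Proof. by rewrite /fcat (unsplitK (inr i)). Qed.

Lemma fcat_parts k m (v : 'I_(k + m) -> V) :
  fcat (v \o @lshift k m) (v \o @rshift k m) = v.
Proof.
apply/funext => i; case: (split_ordP i) => j ->; by rewrite ?fcatl ?fcatr.
Qed.

Lemma updateC k (v : 'I_k -> V) i j x y : i != j ->
  [eta [eta v with i |-> x] with j |-> y] =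
  [eta [eta v with j |-> y] with i |-> x] :> ('I_k -> V).
Proof.
move=> ij; apply/funext => l /=.
by case: (eqVneq l j) => [->|//]; rewrite eq_sym (negPf ij).
Qed.

Lemma update_fcons0 k x y (u : 'I_k -> V) :
  [eta fcons x u with ord0 |-> y] = fcons y u :> ('I_k.+1 -> V).
Proof.
apply/funext => l /=; case: (unliftP ord0 l) => [j ->|->].
  by rewrite !fconsS eq_sym (negPf (neq_lift _ _)).
by rewrite eqxx fcons0.
Qed.

Lemma update_fconsS k x y (u : 'I_k -> V) i :
  [eta fcons x u with lift ord0 i |-> y] =
    fcons x [eta u with i |-> y] :> ('I_k.+1 -> V).
Proof.
apply/funext => l /=; case: (unliftP ord0 l) => [j ->|->].
  by rewrite !fconsS (inj_eq lift_inj).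
by rewrite !fcons0 (negPf (neq_lift _ _)).
Qed.

Lemma update_fcatl k m (u : 'I_k -> V) (v : 'I_m -> V) i x :
  [eta fcat u v with lshift m i |-> x] =
    fcat [eta u with i |-> x] v :> ('I_(k + m) -> V).
Proof.
apply/funext => l /=; case: (split_ordP l) => j ->; rewrite ?fcatl ?fcatr/=.
  by rewrite (inj_eq (@lshift_inj _ _)).
by rewrite eq_rlshift.
Qed.

Lemma update_fcatr k m (u : 'I_k -> V) (v : 'I_m -> V) i x :
  [eta fcat u v with rshift k i |-> x] =
    fcat u [eta v with i |-> x] :> ('I_(k + m) -> V).
Proof.
apply/funext => l /=; case: (split_ordP l) => j ->; rewrite ?fcatl ?fcatr/=.
  by rewrite eq_lrshift.
by rewrite (inj_eq (@rshift_inj _ _)).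
Qed.

Lemma update_comp k (v : 'I_k -> V) (s : 'S_k) i x :
  [eta v with s i |-> x] \o s = [eta v \o s with i |-> x] :> ('I_k -> V).
Proof. by apply/funext => l /=; rewrite (inj_eq perm_inj). Qed.

Lemma is_form_fcons k (a : form V k.+1) x :
  is_form a -> is_form (fun u => a (fcons x u)).
Proof.
move=> [ml alt]; split=> [v i c y z|v i j ij vij].
  by rewrite -!update_fconsS ml.
by apply: (alt _ (lift ord0 i) (lift ord0 j)); rewrite ?(inj_eq lift_inj)// !fconsS.
Qed.

Lemma is_form_fcatl k m (a : form V (k + m)) (w : 'I_m -> V) :
  is_form a -> is_form (fun u : 'I_k -> V => a (fcat u w)).
Proof.
move=> [ml alt]; split=> [v i c y z|v i j ij vij].
  by rewrite -!update_fcatl ml.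
by apply: (alt _ (lshift m i) (lshift m j)); rewrite ?(inj_eq (@lshift_inj _ _))// !fcatl.
Qed.

Lemma is_form_fcatr k m (a : form V (k + m)) (u : 'I_k -> V) :
  is_form a -> is_form (fun w : 'I_m -> V => a (fcat u w)).
Proof.
move=> [ml alt]; split=> [v i c y z|v i j ij vij].
  by rewrite -!update_fcatr ml.
by apply: (alt _ (rshift k i) (rshift k j)); rewrite ?(inj_eq (@rshift_inj _ _))// !fcatr.
Qed.

Lemma multilinearD k (a : form V k) v i x y : multilinear a ->
  a [eta v with i |-> x + y] = a [eta v with i |-> x] + a [eta v with i |-> y].
Proof. by move=> ml; have := ml v i 1 x y; rewrite scale1r mul1r. Qed.

Lemma multilinearN k (a : form V k) v i x : multilinear a ->
  a [eta v with i |-> - x] = - a [eta v with i |-> x].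
Proof.
move=> ml; have a0 : a [eta v with i |-> 0] = 0.
  have := multilinearD v i 0 0 ml; rewrite addr0 => /eqP.
  by rewrite -subr_eq0 opprD addrA subrr sub0r oppr_eq0 => /eqP.
by apply/eqP; rewrite -addr_eq0 -multilinearD// addNr a0.
Qed.

(** A form vanishing on repeated arguments changes sign under a transposition,
    by expanding its value on two equal arguments [v i + v j]. *)
Lemma is_form_tperm k (a : form V k) (v : 'I_k -> V) i j : is_form a ->
  i != j -> a (v \o tperm i j) = - a v.
Proof.
move=> [ml alt] ij.
pose b x y := a [eta [eta v with i |-> x] with j |-> y].
have bD2 x y z : b x (y + z) = b x y + b x z by exact: multilinearD.
have bD1 x y z : b (x + y) z = b x z + b y z.
  by rewrite /b !(updateC _ _ _ ij) multilinearD.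
have bxx x : b x x = 0 by apply: (alt _ _ _ ij) => /=; rewrite (negPf ij) !eqxx.
have -> : v \o tperm i j =
    [eta [eta v with i |-> v j] with j |-> v i] :> ('I_k -> V).
  apply/funext => l /=; case: tpermP => [->|->|]; rewrite ?eqxx ?(negPf ij)//.
  by move=> /eqP/negPf-> /eqP/negPf->.
have -> : a v = b (v i) (v j).
  by congr a; apply/funext => l /=; case: eqP => [->//|]; case: eqP => [->|].
apply/eqP; rewrite -addr_eq0 -[X in X + _]/(b (v j) (v i)) addrC.
by have := bxx (v i + v j); rewrite bD2 !bD1 !bxx add0r addr0 addrC => ->.
Qed.

Lemma is_form_skew k (a : form V k) : is_form a -> skew_form a.
Proof.
move=> fa v s; have [ts -> /allP dts] := prod_tpermP s.
elim: ts v dts => [|t ts IH] v dts.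
  rewrite big_nil odd_perm1 expr0 mul1r; congr a.
  by apply/funext => i /=; rewrite perm1.
have dt : t.1 != t.2 := dts t (mem_head _ _).
rewrite big_cons odd_mul_tperm dt signr_addb.
rewrite (_ : v \o _ = (v \o \prod_(t <- ts) tperm t.1 t.2)%g \o tperm t.1 t.2); last first.
  by apply/funext => i /=; rewrite permM.
rewrite is_form_tperm// IH; last first.
  by move=> u uts; apply: dts; rewrite inE uts orbT.
by rewrite expr1 mulN1r mulNr.
Qed.

Lemma skew_is_form k (a : form V k) : multilinear a -> skew_form a -> is_form a.
Proof.
move=> ml sk; split=> // v i j ij vij; have := sk v (tperm i j).
have -> : v \o tperm i j = v.
  by apply/funext => l /=; case: tpermP => // ->.
rewrite odd_tperm ij mulN1r => /eqP.
by rewrite -addr_eq0 -mulr2n mulrn_eq0 => /orP[|/eqP].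
Qed.

End Forms.
(** * Sums over tuples of basis vectors and over permutations *)

Section BasisSums.
Variables (R : realType) (V : lmodType R) (T : finType) (e : T -> V).

Lemma sum_ffun0 (F : form V 0) (v : 'I_0 -> V) :
  \sum_(t : {ffun 'I_0 -> T}) F (fun i => e (t i)) = F v.
Proof.
rewrite (eq_bigr (fun=> F v)) => [|t _]; last first.
  by congr F; apply/funext => -[].
by rewrite sumr_const card_ffun card_ord expn0.
Qed.

Lemma sum_ffunS k (F : form V k.+1) :
  \sum_(t : {ffun 'I_k.+1 -> T}) F (fun i => e (t i)) =
  \sum_i \sum_(t : {ffun 'I_k -> T}) F (fcons (e i) (fun j => e (t j))).
Proof.
rewrite pair_big/=.
pose h (p : T * {ffun 'I_k -> T}) : {ffun 'I_k.+1 -> T} :=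
  [ffun j => if unlift ord0 j is Some j' then p.2 j' else p.1].
pose h' (t : {ffun 'I_k.+1 -> T}) := (t ord0, [ffun j => t (lift ord0 j)]).
rewrite (reindex h); last first.
  exists h' => [[i t] _|t _]; rewrite /h /h'/=.
    by congr pair; [rewrite ffunE unlift_none|apply/ffunP => j; rewrite !ffunE liftK].
  apply/ffunP => j; rewrite ffunE.
  by case: (unliftP ord0 j) => [j' ->|->//]; rewrite ffunE.
apply: eq_bigr => -[i t] _; congr F; apply/funext => j.
case: (unliftP ord0 j) => [j' ->|->]; rewrite ?fconsS ?fcons0 ffunE/=.
  by rewrite liftK.
by rewrite unlift_none.
Qed.

Lemma sum_ffun_cat k m (F : form V (k + m)) :
  \sum_(t : {ffun 'I_(k + m) -> T}) F (fun i => e (t i)) =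
  \sum_(a : {ffun 'I_k -> T}) \sum_(b : {ffun 'I_m -> T})
    F (fcat (fun i => e (a i)) (fun i => e (b i))).
Proof.
rewrite pair_big/=.
pose h (p : {ffun 'I_k -> T} * {ffun 'I_m -> T}) : {ffun 'I_(k + m) -> T} :=
  [ffun j => match fintype.split j with inl a => p.1 a | inr b => p.2 b end].
pose h' (t : {ffun 'I_(k + m) -> T}) :=
  ([ffun j => t (lshift m j)], [ffun j => t (rshift k j)]).
rewrite (reindex h); last first.
  exists h' => [[a b] _|t _]; rewrite /h /h'/=.
    by congr pair; apply/ffunP => j; rewrite !ffunE ?(unsplitK (inl j)) ?(unsplitK (inr j)).
  by apply/ffunP => j; rewrite ffunE; case: (split_ordP j) => i ->; rewrite ffunE.
apply: eq_bigr => -[a b] _; congr F; apply/funext => j.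
by rewrite ffunE /fcat/=; case: fintype.split.
Qed.

Lemma sum_ffun_perm k (F : form V k) (s : 'S_k) :
  \sum_(t : {ffun 'I_k -> T}) F ((fun i => e (t i)) \o s) =
  \sum_(t : {ffun 'I_k -> T}) F (fun i => e (t i)).
Proof.
rewrite [RHS](reindex (fun t : {ffun 'I_k -> T} => [ffun i => t (s i)])) /=.
  by apply: eq_bigr => t _; congr F; apply/funext => i /=; rewrite ffunE.
by exists (fun t : {ffun 'I_k -> T} => [ffun i => t (s^-1 i)%g]) => t _;
  apply/ffunP => i; rewrite !ffunE ?permK ?permKV.
Qed.

(** Relabelling the summation indices by each permutation in the definition of
    the wedge product makes all terms of its signed sum equal. *)
Lemma sum_skew_wedge k m (a : form V (k + m)) (b : form V k) (c : form V m) :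
  skew_form a ->
  \sum_(t : {ffun 'I_(k + m) -> T})
     a (fun i => e (t i)) * wedge b c (fun i => e (t i)) =
  (k + m)`!%:R / (k`!%:R * m`!%:R) *
  \sum_(u : {ffun 'I_k -> T}) \sum_(v : {ffun 'I_m -> T})
     a (fcat (fun i => e (u i)) (fun i => e (v i))) *
     (b (fun i => e (u i)) * c (fun i => e (v i))).
Proof.
move=> sk.
pose G (v : 'I_(k + m) -> V) :=
  a v * (b (v \o @lshift k m) * c (v \o @rshift k m)).
transitivity ((k + m)`!%:R / (k`!%:R * m`!%:R) *
    \sum_(t : {ffun 'I_(k + m) -> T}) G (fun i => e (t i))); last first.
  congr (_ * _); rewrite sum_ffun_cat.
  apply: eq_bigr => u _; apply: eq_bigr => v _; rewrite /G.
  by congr (_ * (b _ * c _)); apply/funext => i /=; rewrite ?fcatl ?fcatr.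
under eq_bigr do rewrite /wedge mulrCA mulr_sumr.
rewrite -mulr_sumr exchange_big/=.
rewrite (eq_bigr (fun=> \sum_(t : {ffun 'I_(k + m) -> T}) G (fun i => e (t i)))).
  by rewrite sumr_const card_Sn -[X in _ * X]mulr_natl mulrA [_^-1 * _]mulrC.
move=> s _; rewrite -(sum_ffun_perm G s); apply: eq_bigr => t _.
by rewrite /G sk mulrCA mulrA.
Qed.

End BasisSums.

Section WedgeTheory.
Variables (R : realType) (V : lmodType R).

Lemma wedge_skew k m (a : form V k) (b : form V m) : skew_form (wedge a b).
Proof.
move=> v s; rewrite /wedge mulrCA; congr (_ * _); rewrite mulr_sumr.
rewrite (reindex_inj (mulIg s^-1%g)); apply: eq_bigr => t _ /=.
rewrite odd_permM odd_permV signr_addb [_ * (-1) ^+ s]mulrC -mulrA.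
by congr (_ * (_ * (a _ * b _))); apply/funext => i /=; rewrite permM permKV.
Qed.

Lemma wedge_multilinear k m (a : form V k) (b : form V m) :
  multilinear a -> multilinear b -> multilinear (wedge a b).
Proof.
move=> la lb v i c x y; rewrite /wedge mulrCA -mulrDr; congr (_ * _).
rewrite mulr_sumr -big_split/=; apply: eq_bigr => s _.
have E z : (fun j : 'I_(k + m) => [eta v with i |-> z] (s j)) =
    [eta v \o s with (s^-1)%g i |-> z] :> ('I_(k + m) -> V).
  by rewrite -update_comp permKV.
rewrite [c * _]mulrCA -mulrDr; congr (_ * _).
have L z : (fun j => [eta v with i |-> z] (s (lshift m j))) =
   [eta v \o s with (s^-1)%g i |-> z] \o @lshift k m by rewrite -E.
have Rr z : (fun j => [eta v with i |-> z] (s (rshift k j))) =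
   [eta v \o s with (s^-1)%g i |-> z] \o @rshift k m by rewrite -E.
rewrite !L !Rr; case: (split_ordP (s^-1 i)%g) => j ->.
  have L' z : [eta v \o s with lshift m j |-> z] \o @lshift k m =
      [eta v \o s \o @lshift k m with j |-> z] :> ('I_k -> V).
    by apply/funext => l /=; rewrite (inj_eq (@lshift_inj _ _)).
  have R' z : [eta v \o s with lshift m j |-> z] \o @rshift k m =
      v \o s \o @rshift k m.
    by apply/funext => l /=; rewrite eq_rlshift.
  by rewrite !L' !R' la mulrDl mulrA.
have L' z : [eta v \o s with rshift k j |-> z] \o @rshift k m =
    [eta v \o s \o @rshift k m with j |-> z] :> ('I_m -> V).
  by apply/funext => l /=; rewrite (inj_eq (@rshift_inj _ _)).
have R' z : [eta v \o s with rshift k j |-> z] \o @lshift k m =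
    v \o s \o @lshift k m.
  by apply/funext => l /=; rewrite eq_lrshift.
by rewrite !L' !R' lb mulrDr mulrCA.
Qed.

Lemma sum_perm_lift n (F : 'S_n.+1 -> R) :
  \sum_s F s = \sum_(j < n.+1) \sum_(s : 'S_n) F (lift_perm ord0 j s).
Proof.
rewrite pair_big/= (reindex (fun p : 'I_n.+1 * 'S_n => lift_perm ord0 p.1 p.2))//.
apply: onW_bij; apply: inj_card_bij => [[i s] [j t] /= E|]; last first.
  by rewrite card_prod !card_Sn card_ord factS.
have ij : i = j by have := congr1 (fun u : 'S_n.+1 => u ord0) E; rewrite !lift_perm_id.
rewrite -ij in E *; congr pair; apply/permP => l.
have := congr1 (fun u : 'S_n.+1 => u (lift ord0 l)) E.
by rewrite !lift_perm_lift => /lift_inj.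
Qed.

Definition alternate n (F : form V n) (v : 'I_n -> V) : R :=
  \sum_(s : 'S_n) (-1) ^+ (s : bool) * F (v \o s).

(** Laplace expansion: the choice of the first argument comes first. *)
Lemma alternateS n (F : form V n.+1) (v : 'I_n.+1 -> V) :
  alternate F v =
  \sum_(j < n.+1) (-1) ^+ j * alternate (fun u => F (fcons (v j) u)) (v \o lift j).
Proof.
rewrite /alternate sum_perm_lift; apply: eq_bigr => j _.
rewrite mulr_sumr; apply: eq_bigr => s _; rewrite mulrA; congr (_ * F _).
  by rewrite odd_lift_perm/= signr_addb signr_odd.
apply/funext => i /=; case: (unliftP ord0 i) => [l ->|->].
  by rewrite fconsS /= lift_perm_lift.
by rewrite fcons0 lift_perm_id.
Qed.

Lemma alternate_skew n (F : form V n) v : skew_form F ->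
  alternate F v = n`!%:R * F v.
Proof.
move=> sk; rewrite /alternate (eq_bigr (fun=> F v)) => [|s _]; last first.
  by rewrite sk mulrA -signr_addb addbb expr0 mul1r.
by rewrite sumr_const card_Sn mulr_natl.
Qed.

Lemma wedge1 k (f : V -> R) (b : form V k) (v : 'I_k.+1 -> V) : skew_form b ->
  @wedge R V 1 k (form1 f) b v =
  \sum_(j < k.+1) (-1) ^+ j * (f (v j) * b (v \o lift j)).
Proof.
move=> sk; rewrite /wedge mul1r.
pose F (u : 'I_k.+1 -> V) := f (u ord0) * b (u \o lift ord0).
transitivity (k`!%:R^-1 * alternate F v).
  congr (_ * _); apply: eq_bigr => s _; congr (_ * (f (v (s _)) * b _)).
    exact: val_inj.
  by apply/funext => i /=; congr (v (s _)); apply: val_inj.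
rewrite alternateS mulr_sumr; apply: eq_bigr => j _.
have sF : skew_form (fun u : 'I_k -> V => F (fcons (v j) u)).
  move=> u s; rewrite /F !fcons0 mulrCA; congr (_ * _).
  by rewrite -sk; congr b; apply/funext => i /=; rewrite !fconsS.
rewrite alternate_skew// mulrCA mulKf ?pnatr_eq0 -?lt0n ?fact_gt0//.
rewrite /F fcons0; congr (_ * (_ * b _)).
by apply/funext => i /=; rewrite fconsS.
Qed.

End WedgeTheory.
(** * Orthonormal bases *)

Section LinearFunctionals.
Variables (R : realType) (V : lmodType R).

Definition lin (f : V -> R) : Prop :=
  forall (c : R) x y, f (c *: x + y) = c * f x + f y.

Lemma lin0 (f : V -> R) : lin f -> f 0 = 0.
Proof.
by move=> lf; have /eqP := lf 1 0 0; rewrite scaler0 addr0 mul1r -subr_eq0 opprD addrA subrr sub0r oppr_eq0 => /eqP.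
Qed.

Lemma lin_sum (f : V -> R) (I : Type) (r : seq I) (c : I -> R) (x : I -> V) :
  lin f -> f (\sum_(i <- r) c i *: x i) = \sum_(i <- r) c i * f (x i).
Proof.
move=> lf; elim: r => [|i r IH]; first by rewrite !big_nil lin0.
by rewrite !big_cons lf IH.
Qed.

Lemma linZ (f : V -> R) c x : lin f -> f (c *: x) = c * f x.
Proof. by move=> lf; have := lf c x 0; rewrite !addr0 lin0// addr0. Qed.

Lemma linD (f : V -> R) x y : lin f -> f (x + y) = f x + f y.
Proof. by move=> lf; have := lf 1 x y; rewrite scale1r mul1r. Qed.

Lemma multilinear_lin0 k (a : form V k.+1) u :
  multilinear a -> lin (fun x => a (fcons x u)).
Proof.
by move=> ml c x y; have := ml (fcons 0 u) ord0 c x y; rewrite !update_fcons0.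
Qed.

Lemma multilinear_fcons k (a : form V k.+1) x :
  multilinear a -> multilinear (fun u => a (fcons x u)).
Proof. by move=> ml v i c y z; rewrite -!update_fconsS ml. Qed.

End LinearFunctionals.

Section OrthonormalBasis.
Variables (R : realType) (V : lmodType R) (g : V -> V -> R).
Hypothesis gP : is_inner_product g.

Lemma inner_linl y : lin (g^~ y).
Proof. by move=> c x z; case: gP => + _ _; apply. Qed.

Lemma inner_sym x y : g x y = g y x.
Proof. by case: gP. Qed.

Lemma inner_linr x : lin (g x).
Proof. by move=> c y z; rewrite ![g x _]inner_sym inner_linl. Qed.

Lemma inner_eq0 x : g x x = 0 -> x = 0.
Proof.
by move=> gx; apply/eqP/negP => /negP x0; case: gP => _ _ /(_ x x0); rewrite gx ltxx.
Qed.

Lemma inner_inj x y : (forall z, g x z = g y z) -> x = y.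
Proof.
move=> xy; apply/subr0_eq/inner_eq0.
by have := inner_linl (x - y) (-1) y x; rewrite xy scaleN1r addrC mulN1r addNr.
Qed.

Section OneBasis.
Variables (n : nat) (e : 'I_n -> V).
Hypotheses (oe : orthonormal g e) (se : spanning e).

Lemma orthonormal_expand x : x = \sum_i g x (e i) *: e i.
Proof.
have [c xE] := se x; rewrite {1}xE; apply: eq_bigr => i _; congr (_ *: _).
rewrite xE (lin_sum _ _ _ (inner_linl (e i))) (bigD1 i)//= oe eqxx mulr1.
by rewrite big1 ?addr0// => j ji; rewrite oe (negPf ji) mulr0.
Qed.

Lemma lin_expand f x : lin f -> f x = \sum_i g x (e i) * f (e i).
Proof. by move=> lf; rewrite {1}(orthonormal_expand x) lin_sum. Qed.

Lemma lin_expandC f x : lin f -> f x = \sum_i g (e i) x * f (e i).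
Proof.
by move=> lf; rewrite {1}(lin_expand x lf); apply: eq_bigr => i _; rewrite inner_sym.
Qed.

Lemma multilinear_expand k (a : form V k) (v : 'I_k -> V) : multilinear a ->
  a v = \sum_(t : {ffun 'I_k -> 'I_n})
    (\prod_i g (v i) (e (t i))) * a (fun i => e (t i)).
Proof.
move=> ml; pose F k (a : form V k) v (u : 'I_k -> V) := (\prod_i g (v i) (u i)) * a u.
rewrite -[RHS]/(\sum_(t : {ffun 'I_k -> 'I_n}) F k a v (fun i => e (t i))).
elim: k a v ml => [|k IH] a v ml.
  rewrite (sum_ffun0 e (F 0 a v) v) /F big_ord0 mul1r.
  by congr a; apply/funext => -[].
rewrite sum_ffunS -{1}(fcons_head_tail v).
rewrite (lin_expand (v ord0) (multilinear_lin0 (v \o lift ord0) ml)).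
apply: eq_bigr => i _.
rewrite (IH _ (v \o lift ord0) (multilinear_fcons (e i) ml)) mulr_sumr.
apply: eq_bigr => t _; rewrite /F big_ord_recl fcons0 -mulrA.
by congr (_ * (_ * _)); apply: eq_bigr => j _; rewrite fconsS.
Qed.

Lemma multilinear_eq k (a b : form V k) (v : 'I_k -> V) :
  multilinear a -> multilinear b ->
  (forall t : 'I_k -> 'I_n, a (e \o t) = b (e \o t)) -> a v = b v.
Proof.
move=> la lb ab; rewrite (multilinear_expand v la) (multilinear_expand v lb).
by apply: eq_bigr => t _; rewrite (ab t).
Qed.

Lemma sharp_lin f x : lin f -> g (sharp g f) x = f x.
Proof.
move=> lf; rewrite /sharp; case: xgetP => [y -> /(_ x)//|noy].
case: (noy (\sum_i f (e i) *: e i)) => y.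
rewrite (lin_sum _ _ _ (inner_linl y)) [RHS](lin_expand y lf).
by apply: eq_bigr => i _; rewrite mulrC inner_sym.
Qed.

End OneBasis.

Lemma onbP (e : 'I_8 -> V) : orthonormal g e -> spanning e ->
  orthonormal g (onb g) /\ spanning (onb g).
Proof.
move=> oe se; rewrite /onb; case: xgetP => [b ->//|nob].
by case: (nob e).
Qed.

Section TwoBases.
Variables (n : nat) (b e : 'I_n -> V).
Hypotheses (ob : orthonormal g b) (sb : spanning b).
Hypotheses (oe : orthonormal g e) (se : spanning e).

Lemma sum_basis_change (f h : V -> R) : lin f -> lin h ->
  \sum_i f (b i) * h (b i) = \sum_i f (e i) * h (e i).
Proof.
move=> lf lh; under eq_bigr do rewrite (lin_expand oe se (b _) lf) mulr_suml.
rewrite exchange_big/=; apply: eq_bigr => j _.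
rewrite (lin_expandC ob sb (e j) lh) mulr_sumr.
by apply: eq_bigr => i _; rewrite mulrCA mulrA.
Qed.

(** The contraction of two tensors does not depend on the orthonormal basis. *)
Lemma sum_ffun_basis_change k (a c : form V k) : multilinear a -> multilinear c ->
  \sum_(t : {ffun 'I_k -> 'I_n}) a (fun i => b (t i)) * c (fun i => b (t i)) =
  \sum_(t : {ffun 'I_k -> 'I_n}) a (fun i => e (t i)) * c (fun i => e (t i)).
Proof.
elim: k a c => [|k IH] a c la lc.
  apply: eq_bigr => t _.
  by rewrite (_ : (fun i => b (t i)) = (fun i => e (t i)))//; apply/funext => -[].
rewrite !(sum_ffunS _ (fun v => a v * c v)).
under eq_bigr do rewrite (IH _ _ (multilinear_fcons _ la) (multilinear_fcons _ lc)).
rewrite exchange_big [RHS]exchange_big/=; apply: eq_bigr => t _.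
exact: (sum_basis_change (multilinear_lin0 (fun i => e (t i)) la)
                         (multilinear_lin0 (fun i => e (t i)) lc)).
Qed.

End TwoBases.

Lemma sum_ffun_inj n (F : {ffun 'I_n -> 'I_n} -> R) :
  (forall (t : {ffun 'I_n -> 'I_n}) i j, i != j -> t i = t j -> F t = 0) ->
  \sum_t F t = \sum_(s : 'S_n) F (pval s).
Proof.
move=> F0; rewrite (bigID (fun t : {ffun 'I_n -> 'I_n} => injectiveb t))/=.
rewrite [X in _ + X]big1 ?addr0; last first.
  by move=> t /injectivePn[i [j ij tij]]; apply: (F0 t i j).
rewrite (reindex (@pval _))/=; last first.
  pose in_Sn := insubd (1%g : 'S_n).
  by exists in_Sn => /= t Ut; first apply: val_inj; apply: insubdK.
by apply: eq_bigl => s; rewrite (valP s).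
Qed.

(** Only the tuples that are permutations contribute. *)
Lemma sum_top_form n (b : 'I_n -> V) (vol H : form V n) : is_form vol ->
  \sum_(t : {ffun 'I_n -> 'I_n}) vol (fun i => b (t i)) * H (fun i => b (t i)) =
  vol b * alternate H b.
Proof.
move=> fv; rewrite sum_ffun_inj => [|t i j ij tij]; last first.
  by rewrite (fv.2 _ i j)// ?mul0r// tij.
rewrite /alternate mulr_sumr; apply: eq_bigr => s _.
have -> : (fun i => b (pval s i)) = b \o s by apply/funext => i; rewrite /= pvalE.
by rewrite (is_form_skew fv) -mulrA mulrCA.
Qed.

(** A change of basis multiplies the value of a form of top degree by the
    determinant of an orthogonal matrix. *)
Lemma top_form_sqr n (b e : 'I_n -> V) (vol : form V n) : is_form vol ->
  orthonormal g b -> orthonormal g e -> spanning e ->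
  vol b ^+ 2 = vol e ^+ 2.
Proof.
move=> fv ob oe se; pose C := \matrix_(i, j) g (b i) (e j).
have CC : C *m C^T = 1%:M.
  apply/matrixP => i k; rewrite !mxE -ob (lin_expand oe se _ (inner_linl (b k))).
  by apply: eq_bigr => j _; rewrite !mxE [g (e j) _]inner_sym.
have dC : \det C ^+ 2 = 1.
  by have := congr1 determinant CC; rewrite det_mulmx det_tr det1 expr2.
suff -> : vol b = \det C * vol e by rewrite exprMn dC mul1r.
rewrite (multilinear_expand oe se b fv.1).
rewrite (sum_ffun_inj (F := fun t => _ * vol (fun i => e (t i)))); last first.
  by move=> t i j ij tij; rewrite (fv.2 _ i j)// ?mulr0// tij.
rewrite mulr_suml; apply: eq_bigr => s _.
have -> : (fun i => e (pval s i)) = e \o s by apply/funext => i; rewrite /= pvalE.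
rewrite (is_form_skew fv) mulrCA mulrA; congr (_ * _ * _).
by apply: eq_bigr => i _; rewrite mxE pvalE.
Qed.

End OrthonormalBasis.
(** * The Hodge star and the Lee form *)

Section HodgeStar.
Variables (R : realType) (V : lmodType R).

Lemma skew_fcons_lift n (K : form V n.+1) (v : 'I_n.+1 -> V) j : skew_form K ->
  K (fcons (v j) (v \o lift j)) = (-1) ^+ j * K v.
Proof.
move=> sK; have := sK v (lift_perm ord0 j 1%g).
rewrite odd_lift_perm/= odd_perm1 addbF signr_odd => <-; congr K.
apply/funext => i; case: (unliftP ord0 i) => [l ->|->] /=.
  by rewrite fconsS lift_perm_lift perm1.
by rewrite fcons0 lift_perm_id.
Qed.

Lemma fcons_lshift k m x (u : 'I_(m + k) -> V) :
  (fcons x u : 'I_(m.+1 + k) -> V) \o @lshift m.+1 k = fcons x (u \o @lshift m k).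
Proof.
apply/funext => i /=; case: (unliftP ord0 i) => [l ->|->].
  rewrite fconsS /=.
  have -> : @lshift m.+1 k (lift ord0 l) = (lift ord0 (@lshift m k l) : 'I_(m + k).+1).
    exact: val_inj.
  by rewrite fconsS.
have -> : @lshift m.+1 k ord0 = (ord0 : 'I_(m + k).+1) by exact: val_inj.
by rewrite !fcons0.
Qed.

Lemma fcons_rshift k m x (u : 'I_(m + k) -> V) :
  (fcons x u : 'I_(m.+1 + k) -> V) \o @rshift m.+1 k = u \o @rshift m k.
Proof.
apply/funext => i /=.
have -> : @rshift m.+1 k i = (lift ord0 (@rshift m k i) : 'I_(m + k).+1).
  exact: val_inj.
by rewrite fconsS.
Qed.

Lemma fcat_fcons k m x (a : 'I_m -> V) (w : 'I_k -> V) :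
  fcat (fcons x a) w = fcons x (fcat a w) :> ('I_(m.+1 + k) -> V).
Proof.
rewrite -(fcat_parts (fcons x (fcat a w) : 'I_(m.+1 + k) -> V)).
rewrite fcons_lshift fcons_rshift; congr (fcat (fcons _ _) _);
  by apply/funext => i /=; rewrite ?fcatl ?fcatr.
Qed.

(** If the last slots of [K] already hold the last [k] vectors, then the first
    slots can only be filled with the remaining ones: any other choice repeats
    an argument. *)
Lemma alternate_fill m k (K : form V (m + k)) (a : form V k)
    (v : 'I_(m + k) -> V) : is_form K -> skew_form a ->
  alternate (fun u : 'I_(m + k) -> V =>
    K (fcat (u \o @lshift m k) (v \o @rshift m k)) * a (u \o @rshift m k)) v =
  m`!%:R * k`!%:R * (K v * a (v \o @rshift m k)).
Proof.
elim: m K v => [|m IH] K v fK sa.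
  rewrite fact0 mul1r.
  have rE (u : 'I_(0 + k) -> V) : u \o @rshift 0 k = u.
    by apply/funext => i /=; congr u; exact: val_inj.
  have -> : (fun u : 'I_(0 + k) -> V =>
      K (fcat (u \o @lshift 0 k) (v \o @rshift 0 k)) * a (u \o @rshift 0 k)) =
      (fun u => K v * a u).
    apply/funext => u; rewrite !rE; congr (K _ * _).
    by rewrite -[RHS]fcat_parts rE; congr fcat; apply/funext => -[].
  rewrite rE mulrCA -(alternate_skew (v : 'I_k -> V) sa) /alternate mulr_sumr.
  by apply: eq_bigr => s _; rewrite mulrCA.
rewrite (@alternateS R V (m + k)) (@big_split_ord _ _ _ m.+1 k)/=.
rewrite [X in _ + X]big1 ?addr0 => [|l _]; last first.
  rewrite /alternate big1 ?mulr0// => s _.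
  rewrite (fK.2 _ (lshift k ord0) (rshift m.+1 l)) ?mul0r ?mulr0 ?eq_lrshift//.
  by rewrite fcatl fcatr fcons_lshift fcons0.
rewrite (eq_bigr (fun=> m`!%:R * k`!%:R * (K v * a (v \o @rshift m.+1 k)))).
  by rewrite sumr_const card_ord -[LHS]mulr_natl factS natrM !mulrA.
move=> j _; set x := v (lshift k j).
pose v' : 'I_(m + k) -> V := v \o (lift (lshift k j : 'I_(m + k).+1)).
have vr : v \o @rshift m.+1 k = v' \o @rshift m k.
  apply/funext => l /=; congr v; apply: val_inj => /=.
  by rewrite /bump (leq_trans _ (leq_addr l m))// -ltnS.
have -> : (fun u : 'I_(m + k) -> V =>
    K (fcat ((fcons x u : 'I_(m.+1 + k) -> V) \o @lshift m.+1 k)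
            (v \o @rshift m.+1 k)) *
    a ((fcons x u : 'I_(m.+1 + k) -> V) \o @rshift m.+1 k)) =
    (fun u => K (fcons x (fcat (u \o @lshift m k) (v' \o @rshift m k))) *
              a (u \o @rshift m k)).
  by apply/funext => u; rewrite fcons_lshift fcons_rshift fcat_fcons vr.
rewrite (IH (fun u => K (fcons x u)) v' (is_form_fcons x fK) sa).
rewrite (@skew_fcons_lift (m + k) K v (lshift k j) (is_form_skew fK)) -vr.
rewrite mulrCA; congr (_ * _).
by rewrite !mulrA -expr2 -exprM mulnC exprM sqrrN expr1n expr1n mul1r.
Qed.

Lemma alternate_perm n (F : form V n) (v : 'I_n -> V) (s : 'S_n) :
  alternate F (v \o s) = (-1) ^+ (s : bool) * alternate F v.
Proof.
rewrite /alternate mulr_sumr (reindex_inj (mulIg s^-1%g)); apply: eq_bigr => t _ /=.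
rewrite odd_permM odd_permV signr_addb [(-1) ^+ t * _]mulrC -mulrA.
by congr (_ * (_ * F _)); apply/funext => i /=; rewrite permM permKV.
Qed.

Lemma extend_inj_perm m k (t : 'I_k -> 'I_(m + k)) : injective t ->
  exists s : 'S_(m + k), forall i, s (rshift m i) = t i.
Proof.
move=> injt; pose C := ~: [set t i | i in 'I_k].
have cC : #|C| = m.
  by rewrite cardsCs finset.setCK card_imset// !card_ord addnK.
pose f i := match fintype.split i with
  | inl j => enum_val (cast_ord (esym cC) j) | inr j => t j end.
have fl j : f (lshift k j) \in C by rewrite /f (unsplitK (inl j)) enum_valP.
have fr j : f (rshift m j) = t j by rewrite /f (unsplitK (inr j)).
have tC j : t j \notin C by rewrite inE negbK imset_f.
have injf : injective f.
  move=> i i'; case: (split_ordP i) => j ->; case: (split_ordP i') => j' ->.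
  - rewrite /f !(unsplitK (inl _)) => /enum_val_inj/cast_ord_inj ->//.
  - by move=> E; have := tC j'; rewrite -fr -E fl.
  - by move=> E; have := tC j; rewrite -fr E fl.
  - by rewrite !fr => /injt ->.
by exists (perm injf) => i; rewrite permE fr.
Qed.

End HodgeStar.

Section LeeForm.
Variables (R : realType) (V : lmodType R) (g : V -> V -> R).
Hypothesis gP : is_inner_product g.

(** Both sides are multilinear in [w], so [w] may be taken among the basis
    vectors; if these are distinct they are the last [k] vectors of the basis
    permuted, which is the case of [alternate_fill]. *)
Lemma alternate_fill_basis m k (b : 'I_(m + k) -> V) (K : form V (m + k))
    (a : form V k) (w : 'I_k -> V) :
  orthonormal g b -> spanning b -> is_form K -> is_form a ->
  alternate (fun u : 'I_(m + k) -> V =>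
    K (fcat (u \o @lshift m k) w) * a (u \o @rshift m k)) b =
  m`!%:R * k`!%:R * (K b * a w).
Proof.
move=> ob sb fK fa.
pose F w := fun u : 'I_(m + k) -> V =>
  K (fcat (u \o @lshift m k) w) * a (u \o @rshift m k).
pose A (w : 'I_k -> V) := alternate (F w) b.
pose B (w : 'I_k -> V) := m`!%:R * k`!%:R * (K b * a w).
apply: (multilinear_eq gP ob sb w (a := A) (b := B)).
- move=> v i c x y; rewrite /A /alternate mulr_sumr -big_split/=.
  apply: eq_bigr => s _; rewrite /F (is_form_fcatr _ fK).1 mulrDl mulrDr.
  by rewrite -[c * _ * _]mulrA [_ * (c * _)]mulrCA.
- move=> v i c x y; rewrite /B fa.1 !mulrDr.
  by rewrite !mulrA ![_ * c]mulrC !mulrA.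
move=> t; rewrite /A /B; have [|noinj] := pselect (injective t).
  move=> /extend_inj_perm[s st].
  have bt : b \o t = (b \o s) \o @rshift m k by apply/funext => i; rewrite /= st.
  have := alternate_fill (b \o s) fK (is_form_skew fa).
  rewrite -bt -/(F _) alternate_perm (is_form_skew fK) => E.
  have := congr1 ( *%R ((-1) ^+ s)) E; rewrite mulrA -signr_addb addbb mul1r => ->.
  by rewrite mulrCA !mulrA -[_ * (-1) ^+ s * (-1) ^+ s]mulrA -signr_addb addbb mulr1.
have [i [j [ij tij]]] : exists i j, i != j /\ t i = t j.
  apply: contrapT => nex; apply: noinj => i j tij; apply: contrapT => /eqP ij.
  by apply: nex; exists i, j.
rewrite (fa.2 _ i j)//= ?tij// !mulr0 /alternate big1// => s _.
by rewrite /F ((is_form_fcatr _ fK).2 _ i j)//= ?tij// mul0r mulr0.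
Qed.

Let cycle8 : 'S_8 := lift_perm ord0 ord_max 1%g.

Let cycle8E (i : 'I_8) : val (cycle8 i) = ((i + 7) %% 8)%N.
Proof.
rewrite /cycle8; case: (unliftP ord0 i) => [l ->|->]; last by rewrite lift_perm_id.
rewrite lift_perm_lift perm1 /= /bump leqNgt; case: l => l /= ll.
by rewrite ll add0n add1n addSn -addnS modnDr modn_small// ltnW.
Qed.

(** Moving three vectors past five is the cube of a cyclic shift, and a cyclic
    shift of eight vectors is odd. *)
Lemma form8_swap53 (K : form V 8) (u : 'I_5 -> V) (v : 'I_3 -> V) : is_form K ->
  K (@fcat R V 5 3 u v) = - K (@fcat R V 3 5 v u).
Proof.
move=> fK; pose s := (cycle8 * cycle8 * cycle8)%g.
have s1 : s = true :> bool.
  by rewrite /s !odd_permM /cycle8 !odd_lift_perm odd_perm1.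
have := is_form_skew fK (@fcat R V 5 3 u v) s.
rewrite s1 expr1 mulN1r => sE; apply: oppr_inj; rewrite -sE opprK; congr K.
have sV (i : 'I_8) : val (s i) = ((i + 21) %% 8)%N.
  by rewrite /s !permM !cycle8E modnDml -addnA modnDml -addnA.
apply/funext => i; rewrite /comp; case: (@split_ordP 3 5 i) => j ij.
  have -> : s i = @rshift 5 3 j.
    apply: val_inj; rewrite sV ij /= (_ : j + 21 = 2 * 8 + (5 + j))%N.
      by rewrite modnMDl modn_small// -[8%N]/(5 + 3)%N ltn_add2l.
    by rewrite addnC addnA.
  by rewrite ij fcatr fcatl.
have -> : s i = @lshift 5 3 j.
  apply: val_inj; rewrite sV ij /= (_ : 3 + j + 21 = 3 * 8 + j)%N.
    by rewrite modnMDl modn_small// (leq_trans (ltn_ord j)).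
  by rewrite addnAC.
by rewrite ij fcatr fcatl.
Qed.

(** Writing both stars as sums over a basis [b], the wedge product with [Phi]
    loses its signs, the inner two sums run over all arrangements of [b], and
    what is left is a contraction of [dPhi] with [Phi]. *)
Lemma lee_of_contraction (sigma : R) (Phi : form V 4) (dPhi : form V 5)
    (e : 'I_8 -> V) (x : V) :
  orthonormal g e -> spanning e -> is_form Phi -> is_form dPhi ->
  spin7_vol sigma Phi e ^+ 2 = 1 ->
  lee_of sigma g Phi dPhi x = (7%:R * 24%:R)^-1 *
    \sum_(t : {ffun 'I_4 -> 'I_8})
      dPhi (fcons x (fun i => e (t i))) * Phi (fun i => e (t i)).
Proof.
move=> oe se fP fd vol1; set vol := spin7_vol sigma Phi in vol1.
have fvol : is_form vol.
  have fw : is_form (@wedge R V 4 4 Phi Phi).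
    by apply: skew_is_form (wedge_skew _ _); apply: wedge_multilinear; exact: fP.1.
  split=> [v i c y z|v i j ij vij]; rewrite /vol /spin7_vol.
    by rewrite fw.1 mulrDr mulrCA.
  by rewrite (fw.2 _ _ _ ij vij) mulr0.
have [ob sb] := onbP oe se; set b := onb g in ob sb.
have vb : vol b * vol b = 1 by rewrite -expr2 (top_form_sqr gP fvol ob oe se).
rewrite -(sum_ffun_basis_change gP ob sb oe se (multilinear_fcons x fd.1) fP.1).
have inner (w : 'I_5 -> V) :
  \sum_(a : {ffun 'I_3 -> 'I_8}) \sum_(s : {ffun 'I_5 -> 'I_8})
    dPhi (fun i => b (s i)) * vol (@fcat R V 5 3 (fun i => b (s i)) (fun i => b (a i))) *
    vol (@fcat R V 3 5 (fun i => b (a i)) w) = - (6%:R * 120%:R * dPhi w).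
  pose H (u : 'I_(3 + 5) -> V) :=
    vol (fcat (u \o @lshift 3 5) w) * dPhi (u \o @rshift 3 5).
  have HE : alternate H b = 3`!%:R * 5`!%:R * (vol b * dPhi w) :=
    @alternate_fill_basis 3 5 b vol dPhi w ob sb fvol fd.
  transitivity (- (vol b * alternate H b)); last first.
    by rewrite HE mulrCA [vol b * (_ * _)]mulrA vb mul1r.
  have <- := @sum_top_form R V 8 b vol H fvol.
  rewrite (@sum_ffun_cat R V _ b 3 5 (fun v => vol v * H v)) -sumrN.
  apply: eq_bigr => a _; rewrite -sumrN; apply: eq_bigr => s _.
  rewrite form8_swap53// /H mulrN mulNr; congr (- _).
  have -> : fcat (fun i => b (a i)) (fun i => b (s i)) \o @lshift 3 5 =
      (fun i => b (a i)) by apply/funext => i /=; rewrite fcatl.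
  have -> : fcat (fun i => b (a i)) (fun i => b (s i)) \o @rshift 3 5 =
      (fun i => b (s i)) by apply/funext => i /=; rewrite fcatr.
  by ring.
have fcons_last (d : 'I_4 -> V) :
    dPhi (@fcat R V 4 1 d (fun=> x)) = dPhi (fcons x d).
  have := is_form_skew fd (@fcat R V 4 1 d (fun=> x)) (lift_perm ord0 ord_max 1%g).
  rewrite odd_lift_perm odd_perm1 mul1r => <-; congr dPhi.
  apply/funext => i; case: (unliftP ord0 i) => [l ->|->] /=.
    rewrite fconsS lift_perm_lift perm1.
    have -> : lift ord_max l = @lshift 4 1 l by apply: val_inj; exact: lift_max.
    by rewrite fcatl.
  rewrite fcons0 lift_perm_id.
  have -> : ord_max = @rshift 4 1 ord0 by exact: val_inj.
  by rewrite fcatr.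
have fcat_assoc (a : 'I_3 -> V) (d : 'I_4 -> V) :
    @fcat R V 7 1 (@fcat R V 3 4 a d) (fun=> x) =
    @fcat R V 3 5 a (@fcat R V 4 1 d (fun=> x)).
  apply/funext => i; case: (@split_ordP 3 5 i) => j ->; last first.
    rewrite fcatr; case: (@split_ordP 4 1 j) => l ->.
      rewrite fcatl (_ : rshift 3 _ = @lshift 7 1 (@rshift 3 4 l)); last exact: val_inj.
      by rewrite fcatl fcatr.
    rewrite fcatr (_ : rshift 3 _ = @rshift 7 1 l); last exact: val_inj.
    exact: (@fcatr R V 7 1).
  rewrite (@fcatl R V 3 5).
  rewrite (_ : lshift 5 j = @lshift 7 1 (@lshift 3 4 j)); last exact: val_inj.
  by rewrite (@fcatl R V 7 1) (@fcatl R V 3 4).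
rewrite /lee_of {1}/star.
under eq_bigr do rewrite mulrC.
rewrite (@sum_skew_wedge R V _ b 3 4
  (fun u : 'I_7 -> V => vol (@fcat R V 7 1 u (fun=> x)))); last first.
  exact: (is_form_skew (@is_form_fcatl R V 7 1 vol (fun=> x) fvol)).
rewrite exchange_big/=.
rewrite (eq_bigr (fun d : {ffun 'I_4 -> 'I_8} => - 6%:R *
    (dPhi (fcons x (fun i => b (d i))) * Phi (fun i => b (d i))))); last first.
  move=> d _; under eq_bigr do rewrite fcat_assoc /star.
  have := inner (@fcat R V 4 1 (fun i => b (d i)) (fun=> x)).
  rewrite fcons_last -/b -/vol => inn.
  rewrite (eq_bigr (fun a : {ffun 'I_3 -> 'I_8} =>
    120%:R^-1 * Phi (fun i => b (d i)) * \sum_(s : {ffun 'I_5 -> 'I_8})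
      dPhi (fun i => b (s i)) * vol (@fcat R V 5 3 (fun i => b (s i)) (fun i => b (a i))) *
      vol (@fcat R V 3 5 (fun i => b (a i))
        (@fcat R V 4 1 (fun i => b (d i)) (fun=> x))))); last first.
    by move=> a _; rewrite -mulr_suml (_ : 5`! = 120)%N//; ring.
  by rewrite -mulr_sumr inn; field.
rewrite -mulr_sumr -[(3 + 4)`!]/(7`!) (_ : 3`! = 6)%N// (_ : 4`! = 24)%N//.
have : 7`!%:R != 0 :> R by rewrite pnatr_eq0 -lt0n fact_gt0.
by move: (7`!%:R) => N N0; field.
Qed.

End LeeForm.
(** * The components of the fundamental form *)

Section Vec4.
Variables (R : realType) (V : lmodType R).
Implicit Types (x y z w : V).

Lemma fcons_nth k x (u : 'I_k -> V) (s : seq V) :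
  (forall i, u i = nth 0 s i) -> forall i, fcons x u i = nth 0 (x :: s) i.
Proof.
move=> us i; case: (unliftP ord0 i) => [j ->|->]; last by rewrite fcons0.
by rewrite fconsS us.
Qed.

Lemma vec3E x y z i : vec3 x y z i = nth 0 [:: x; y; z] i.
Proof. by do 2 apply: fcons_nth => ?; rewrite ord1. Qed.

Lemma vec4E x y z w i : vec4 x y z w i = nth 0 [:: x; y; z; w] i.
Proof. by apply: fcons_nth => ?; exact: vec3E. Qed.

Lemma vec4_lift x y z w (j : 'I_4) :
  vec4 x y z w \o lift j =
  nth (vec3 y z w) [:: vec3 y z w; vec3 x z w; vec3 x y w; vec3 x y z] j.
Proof.
apply/funext => i; rewrite /= vec4E.
by case: j => -[|[|[|[|//]]]] ?; rewrite /= vec3E /=; case: i => -[|[|[|//]]].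
Qed.

Lemma vec3_lift x y z (j : 'I_3) :
  vec3 x y z \o lift j = fcons (nth 0 [:: y; x; x] j) (fun=> nth 0 [:: z; z; y] j).
Proof.
apply/funext => i; rewrite /= vec3E (@fcons_nth _ _ _ [:: nth 0 [:: z; z; y] j]).
  by case: j => -[|[|[|//]]] ?; case: i => -[|[|//]].
by move=> l; rewrite ord1.
Qed.

Lemma vec4_of (v : 'I_4 -> V) :
  v = vec4 (v ord0) (v (inord 1)) (v (inord 2)) (v (inord 3)).
Proof.
apply/funext => i; rewrite vec4E.
by case: i => -[|[|[|[|//]]]] ? /=; congr v; apply: val_inj; rewrite /= ?inordK.
Qed.

Lemma vec4_update1 x y y' z w :
  [eta vec4 x y z w with inord 1 |-> y'] = vec4 x y' z w :> ('I_4 -> V).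
Proof.
apply/funext => i; rewrite /= !vec4E -val_eqE /= inordK//.
by case: i => -[|[|[|[|//]]]].
Qed.

Lemma form1_skew (a : V -> R) : skew_form (form1 a).
Proof.
move=> v s; have -> : s = 1%g by apply/permP => i; rewrite perm1 !ord1.
by rewrite odd_perm1 mul1r; congr form1; apply/funext => i /=; rewrite perm1.
Qed.

Definition det2 (a b : V -> R) x y := a x * b y - a y * b x.
Definition det3 (a b c : V -> R) x y z :=
  a x * det2 b c y z - a y * det2 b c x z + a z * det2 b c x y.
Definition det4 (a b c d : V -> R) x y z w :=
  a x * det3 b c d y z w - a y * det3 b c d x z w
  + a z * det3 b c d x y w - a w * det3 b c d x y z.

Lemma wedge4_vec4 (a b c d : V -> R) x y z w :
  wedge4 a b c d (vec4 x y z w) = det4 a b c d x y z w.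
Proof.
have w2 (u v : V) : wedge (form1 c) (form1 d) (fcons u (fun=> v) : 'I_2 -> V) =
    det2 c d u v.
  rewrite (@wedge1 R V 1); last exact: form1_skew.
  have E (i : 'I_2) : fcons u (fun=> v) i = nth 0 [:: u; v] i.
    by apply: fcons_nth => ?; rewrite ord1.
  by rewrite !big_ord_recl big_ord0 /form1 /comp !E /= /det2; ring.
have w3 (u v w' : V) : wedge (form1 b) (wedge (form1 c) (form1 d)) (vec3 u v w') =
    det3 b c d u v w'.
  rewrite (@wedge1 R V 2); last exact: (@wedge_skew R V 1 1).
  rewrite !big_ord_recl big_ord0 !vec3_lift /= !w2 !vec3E /= /det3.
  by ring.
rewrite /wedge4 (@wedge1 R V 3); last exact: (@wedge_skew R V 1 2).
rewrite !big_ord_recl big_ord0 !vec4_lift /= !w3 !vec4E /= /det4.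
by ring.
Qed.

End Vec4.

Section IntegerComponents.

Definition sumz n (f : nat -> int) : int :=
  foldr (fun i x => intZmod.addz (f i) x) 0 (iota 0 n).

Lemma sumzE (R : pzRingType) n (f : nat -> int) :
  (sumz n f)%:~R = \sum_(i < n) (f i)%:~R :> R.
Proof.
rewrite -(big_mkord xpredT (fun i => (f i)%:~R)) /sumz /index_iota subn0.
elim: (iota 0 n) => [|i s IH]; first by rewrite big_nil.
by rewrite big_cons -IH /= -intrD.
Qed.

(** Multiplication by a Kronecker delta, written so that the other factor is
    evaluated only if the delta is 1. *)
Definition delta_mul (a i : nat) (x : int) : int := if eqn a i then x else 0.

Lemma delta_mulE (R : pzRingType) a i x :
  (delta_mul a i x)%:~R = (a == i)%:R * x%:~R :> R.
Proof.
by rewrite /delta_mul eqnE; case: eqP => _; rewrite ?mul1r ?mul0r.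
Qed.

Definition detz2 a b i j := delta_mul a i (delta_mul b j 1) - delta_mul a j (delta_mul b i 1).
Definition detz3 a b c i j k :=
  delta_mul a i (detz2 b c j k) - delta_mul a j (detz2 b c i k)
  + delta_mul a k (detz2 b c i j).
Definition detz4 a b c d i j k l :=
  delta_mul a i (detz3 b c d j k l) - delta_mul a j (detz3 b c d i k l)
  + delta_mul a k (detz3 b c d i j l) - delta_mul a l (detz3 b c d i j k).

Definition phi_component (s : int) (i j k l : nat) : int :=
  sumz 7 (fun q =>
    detz4 7 (q %% 7) ((q + 1) %% 7) ((q + 3) %% 7) i j k l
    - s * detz4 ((q + 2) %% 7) ((q + 4) %% 7) ((q + 5) %% 7) ((q + 6) %% 7)
        i j k l).

(** The components are stored in a table, so that the contraction identity can
    be evaluated by lookup. *)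
Definition phi_tabulate (s : int) :=
  [seq [seq [seq [seq phi_component s i j k l | l <- iota 0 8] | k <- iota 0 8]
    | j <- iota 0 8] | i <- iota 0 8].

Definition phi_table_pos := Eval vm_compute in phi_tabulate 1.
Definition phi_table_neg := Eval vm_compute in phi_tabulate (-1).

Lemma phi_table_posE : phi_table_pos = phi_tabulate 1.
Proof. by vm_cast_no_check (erefl phi_table_pos). Qed.

Lemma phi_table_negE : phi_table_neg = phi_tabulate (-1).
Proof. by vm_cast_no_check (erefl phi_table_neg). Qed.

Definition phi_row (b : bool) i j k : seq int :=
  nth [::] (nth [::] (nth [::] (if b then phi_table_neg else phi_table_pos) i) j) k.

Lemma phi_rowE b i j k : (i < 8)%N -> (j < 8)%N -> (k < 8)%N ->
  phi_row b i j k = [seq phi_component ((-1) ^+ b) i j k l | l <- iota 0 8].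
Proof.
move=> i8 j8 k8; rewrite /phi_row.
have -> : (if b then phi_table_neg else phi_table_pos) = phi_tabulate ((-1) ^+ b).
  by case: b; rewrite ?phi_table_negE ?phi_table_posE.
by do 3 (rewrite (nth_map 0%N) ?size_iota// nth_iota//).
Qed.

Fixpoint dotz (u v : seq int) : int :=
  if u is x :: u' then if v is y :: v' then
    intZmod.addz (if x is Posz 0 then 0 else intRing.mulz x y) (dotz u' v')
  else 0 else 0.

Lemma dotzE (R : pzRingType) (f h : nat -> int) (s : seq nat) :
  (dotz (map f s) (map h s))%:~R = \sum_(i <- s) (f i)%:~R * (h i)%:~R :> R.
Proof.
elim: s => [|i s IH]; first by rewrite big_nil.
rewrite big_cons -IH /= -intrM -intrD; congr (_%:~R).
by case: (f i) => [[|n]|n] //; rewrite mul0r.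
Qed.

Definition contraction2 b i j k l : int :=
  sumz 8 (fun p => dotz (phi_row b i j p) (phi_row b k l p)).

Definition check8 (P : nat -> bool) := all P (iota 0 8).

Lemma check8P (P : nat -> bool) : check8 P -> forall i : 'I_8, P i.
Proof. by move=> /allP + i; apply; rewrite mem_iota/=. Qed.

Definition contraction2_holds b :=
  check8 (fun i => check8 (fun j => check8 (fun k => check8 (fun l =>
    contraction2 b i j k l ==
    6 * (delta_mul i k (delta_mul j l 1) - delta_mul i l (delta_mul j k 1))
    - 4 * (-1) ^+ b * nth 0 (phi_row b i j k) l)))).

(** The contraction identity, evaluated for all index quadruples. *)
Lemma contraction2_check b : contraction2_holds b.
Proof.
case: b; first by vm_cast_no_check (erefl true).
by vm_cast_no_check (erefl true).
Qed.

(** The signed sum over the ordered choices [p] of [d] entries of [l], where [r]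
    are the entries left, in their order in [l]. *)
Fixpoint laplace_expand d (f : seq nat -> seq nat -> int) (l : seq nat) : int :=
  if d is d'.+1 then
    sumz (size l) (fun j =>
      (-1) ^+ j * laplace_expand d' (fun p r => f (nth 0%N l j :: p) r)
                  (take j l ++ drop j.+1 l))
  else f [::] l.

Definition phi_seq b (s : seq nat) : int :=
  nth 0 (phi_row b (nth 0 s 0) (nth 0 s 1) (nth 0 s 2)) (nth 0 s 3).

Definition wedge_square b : int :=
  laplace_expand 4 (fun p r =>
   let x := phi_seq b p in if x is Posz 0 then 0 else x * phi_seq b r) (iota 0 8).

(** The 14 blocks of [Phi] form 7 complementary pairs. Each pair contributes
    twice with the same sign, and each contribution is counted 24 times, once
    for every order of the first block: [336 = 14 * 24]. *)
Lemma wedge_squareE b : wedge_square b = - (-1) ^+ b * 336.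
Proof. by case: b; vm_compute. Qed.

End IntegerComponents.

Section CayleyFrame.
Variables (R : realType) (V : lmodType R) (e : 'I_8 -> V).

Definition frame_seq k (l : seq nat) : 'I_k -> V := fun i => e (inord (nth 0%N l i)).

(** The last [m] arguments need not be permuted when [B] is alternating, which
    leaves few enough terms to evaluate. *)
Lemma alternate_laplace d m (A : form V d) (B : form V m)
    (f : seq nat -> seq nat -> int) (l : seq nat) : skew_form B ->
  (forall p r, size p = d -> size r = m -> all (ltn^~ 8) (p ++ r) ->
    (f p r)%:~R = A (frame_seq p) * B (frame_seq r)) ->
  size l = (d + m)%N -> all (ltn^~ 8) l ->
  alternate (fun u : 'I_(d + m) -> V => A (u \o @lshift d m) * B (u \o @rshift d m))
    (frame_seq l) = m`!%:R * (laplace_expand d f l)%:~R.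
Proof.
move=> sB; elim: d A f l => [|d IH] A f l fE sl l8.
  rewrite /= fE// [RHS]mulrCA -(alternate_skew _ sB) /alternate mulr_sumr.
  apply: eq_bigr => s _; rewrite mulrCA; congr (_ * (_ * B _)).
    by congr A; apply/funext => -[].
  by apply/funext => i /=; congr (frame_seq _ (s _)); apply: val_inj.
rewrite (@alternateS R V (d + m)) /= sumzE sl mulr_sumr; apply: eq_bigr => j _.
rewrite intrM rmorphXn rmorphN1 [RHS]mulrCA; congr (_ * _).
set x := frame_seq l j; set l' := take j l ++ drop j.+1 l.
have jl : (j <= size l)%N by rewrite sl ltnW.
have l'E : frame_seq l \o lift j = frame_seq l' :> ('I_(d + m) -> V).
  apply/funext => i; rewrite /frame_seq /=; congr (e (inord _)).
  rewrite /l' nth_cat (size_takel jl) nth_drop /bump.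
  case: (leqP j i) => ji; last by rewrite nth_take.
  by rewrite addSn subnKC.
have := IH (fun u => A (fcons x u)) (fun p r => f (nth 0%N l j :: p) r) l'.
rewrite l'E => <-.
- by apply: eq_bigr => s _; rewrite fcons_lshift fcons_rshift.
- move=> p r sp sr pr8; rewrite fE/= ?sp ?pr8 ?andbT//; last first.
    by apply: (allP l8); rewrite mem_nth// sl; exact: ltn_ord.
   congr (A _ * _); apply/funext => i.
  by case: (unliftP ord0 i) => [i' ->|->]; rewrite ?fconsS ?fcons0.
- rewrite /l' size_cat (size_takel jl) size_drop sl.
  by rewrite addSn subSS subnKC//; exact: ltn_ord j.
- move: l8; rewrite -{1}(cat_take_drop j l) /l' !all_cat => /andP[-> /=].
  by rewrite -[j.+1]add1n -drop_drop; case: (drop j l) => //= y ys /andP[_]; rewrite drop0.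
Qed.

Variables (b : bool) (Phi : form V 4).
Hypothesis frame : cayley_frame ((-1) ^+ b) Phi e.

Lemma cayley_component (i j k l : 'I_8) :
  Phi (vec4 (e i) (e j) (e k) (e l)) = (nth 0 (phi_row b i j k) l)%:~R.
Proof.
have [eps [epsE _] ->] := frame; rewrite phi_rowE// (nth_map 0%N) ?size_iota//.
rewrite nth_iota// add0n /cayley_form /phi_component sumzE mulr_sumr -sumrB.
have detE (a c d f : 'I_8) :
    wedge4 (eps a) (eps c) (eps d) (eps f) (vec4 (e i) (e j) (e k) (e l)) =
    (detz4 a c d f i j k l)%:~R.
  rewrite wedge4_vec4 /det4 /det3 /det2 /detz4 /detz3 /detz2 !epsE.
  by rewrite !(rmorphB, rmorphD) /= !delta_mulE !(rmorphB, rmorphD) /= !delta_mulE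
    !(rmorphB, rmorphD) /= !delta_mulE !mulr1.
apply: eq_bigr => q _; rewrite !detE [RHS]rmorphB /= intrM rmorphXn rmorphN1 /z7.
by rewrite !inordK// ?(leq_trans (ltn_pmod _ _)).
Qed.

Lemma frame_seq_vec4 (i j k l : nat) (s := [:: i; j; k; l]) :
  frame_seq s = vec4 (e (inord i)) (e (inord j)) (e (inord k)) (e (inord l)).
Proof.
apply/funext => q; rewrite vec4E /frame_seq.
by case: q => -[|[|[|[|//]]]].
Qed.

(** The volume form is normalised to take the values 1 and -1 on Cayley frames.
    Its sign does not enter the Lee form, which involves two Hodge stars. *)
Lemma spin7_vol_sqr : is_form Phi -> spin7_vol ((-1) ^+ b) Phi e ^+ 2 = 1.
Proof.
move=> fP.
have wE : @wedge R V 4 4 Phi Phi e = (4`!%:R * 4`!%:R)^-1 *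
    (4`!%:R * (wedge_square b)%:~R).
  rewrite /wedge /wedge_square -(@alternate_laplace 4 4 Phi Phi _ _ (is_form_skew fP))//; last first.
    move=> [|i [|j [|k [|l [|]]]]]// [|i' [|j' [|k' [|l' [|]]]]]// _ _.
    move=> /= /and5P[i8 j8 k8 l8 /and5P[i8' j8' k8' l8' _]].
    rewrite !frame_seq_vec4 !cayley_component !inordK//.
    by rewrite /phi_seq/=; case: (nth 0 (phi_row b i j k) l) => [[|n]|n];
      rewrite ?mul0r// intrM.
  have -> // : frame_seq (iota 0 8) = e.
  by apply/funext => i; rewrite /frame_seq nth_iota// add0n inord_val.
rewrite /spin7_vol wE wedge_squareE rmorphM rmorphN rmorphXn rmorphN1 /=.
rewrite (_ : 4`! = 24)%N//.
have : ((-1) ^+ b : R) ^+ 2 = 1 by rewrite sqrr_sign.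
by move: ((-1) ^+ b : R) => c c2; field: c2.
Qed.

Lemma phi_contraction2_frame (i j k l : 'I_8) :
  \sum_p \sum_q Phi (vec4 (e i) (e j) (e p) (e q)) *
                Phi (vec4 (e k) (e l) (e p) (e q)) =
  6%:R * ((i == k)%:R * (j == l)%:R - (i == l)%:R * (j == k)%:R)
  - 4%:R * (-1) ^+ b * Phi (vec4 (e i) (e j) (e k) (e l)).
Proof.
have /eqP := check8P (check8P (check8P (check8P (contraction2_check b) i) j) k) l.
move=> /(congr1 (fun z : int => z%:~R : R)).
rewrite /contraction2 sumzE cayley_component => E.
transitivity (\sum_(p < 8) (dotz (phi_row b i j p) (phi_row b k l p))%:~R : R).
  apply: eq_bigr => p _; rewrite !phi_rowE// dotzE (_ : iota 0 8 = index_iota 0 8)// big_mkord.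
  apply: eq_bigr => q _; rewrite !cayley_component !phi_rowE//.
  by rewrite !(nth_map 0%N) ?size_iota// !nth_iota.
rewrite E rmorphB /= !intrM rmorphB /= rmorphXn rmorphN1 !delta_mulE.
by rewrite !mulr1.
Qed.

End CayleyFrame.
(** * Algebra of the fundamental form *)

Section CurriedForm.
Variables (R : realType) (V : lmodType R) (g : V -> V -> R) (e : 'I_8 -> V).
Hypotheses (gP : is_inner_product g) (oe : orthonormal g e) (se : spanning e).
Implicit Types (x y z w : V) (f h : V -> R).

Lemma lin_zero : lin (fun _ : V => 0 : R).
Proof. by move=> c x y; rewrite mulr0 addr0. Qed.

Lemma lin_add f h : lin f -> lin h -> lin (fun x => f x + h x).
Proof. by move=> lf lh c x y; rewrite lf lh mulrDr addrACA. Qed.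

Lemma lin_opp f : lin f -> lin (fun x => - f x).
Proof. by move=> lf c x y; rewrite lf opprD mulrN. Qed.

Lemma lin_mull f c : lin f -> lin (fun x => c * f x).
Proof. by move=> lf d x y; rewrite lf mulrDr mulrCA. Qed.

Lemma lin_mulr f c : lin f -> lin (fun x => f x * c).
Proof. by move=> lf d x y; rewrite lf mulrDl mulrA. Qed.

Lemma lin_bigsum (I : Type) (r : seq I) (f : I -> V -> R) :
  (forall i, lin (f i)) -> lin (fun x => \sum_(i <- r) f i x).
Proof.
move=> lf c x y; rewrite mulr_sumr -big_split/=.
by apply: eq_bigr => i _; exact: lf.
Qed.

Definition lin4 (f : V -> V -> V -> V -> R) : Prop :=
  [/\ forall y z w, lin (fun x => f x y z w), forall x z w, lin (fun y => f x y z w),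
      forall x y w, lin (fun z => f x y z w) & forall x y z, lin (f x y z)].

Lemma lin_eq f h : lin f -> lin h -> (forall i, f (e i) = h (e i)) -> f =1 h.
Proof.
move=> lf lh fh x; rewrite (lin_expand gP oe se x lf) (lin_expand gP oe se x lh).
by apply: eq_bigr => i _; rewrite fh.
Qed.

Lemma lin4_eq (f h : V -> V -> V -> V -> R) : lin4 f -> lin4 h ->
  (forall i j k l, f (e i) (e j) (e k) (e l) = h (e i) (e j) (e k) (e l)) ->
  forall x y z w, f x y z w = h x y z w.
Proof.
move=> [f1 f2 f3 f4] [h1 h2 h3 h4] fh x y z w.
apply: (lin_eq (f1 y z w) (h1 y z w)) => i.
apply: (lin_eq (f2 (e i) z w) (h2 (e i) z w)) => j.
apply: (lin_eq (f3 (e i) (e j) w) (h3 (e i) (e j) w)) => k.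
by apply: (lin_eq (f4 (e i) (e j) (e k)) (h4 (e i) (e j) (e k))) => l.
Qed.

Definition sum1 f := \sum_i f (e i).
Definition sum2 (f : V -> V -> R) := sum1 (fun x => sum1 (f x)).
Definition sum3 (f : V -> V -> V -> R) := sum1 (fun x => sum2 (f x)).
Definition sum4 (f : V -> V -> V -> V -> R) := sum1 (fun x => sum3 (f x)).

Lemma eq_sum1 f h : (forall x, f x = h x) -> sum1 f = sum1 h.
Proof. by move=> fh; apply: eq_bigr => i _. Qed.
Lemma eq_sum2 (f h : V -> V -> R) : (forall x y, f x y = h x y) -> sum2 f = sum2 h.
Proof. by move=> fh; apply: eq_sum1 => x; exact: eq_sum1. Qed.
Lemma eq_sum3 (f h : V -> V -> V -> R) : (forall x y z, f x y z = h x y z) -> sum3 f = sum3 h.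
Proof. by move=> fh; apply: eq_sum1 => x; exact: eq_sum2. Qed.
Lemma eq_sum4 (f h : V -> V -> V -> V -> R) : (forall x y z w, f x y z w = h x y z w) -> sum4 f = sum4 h.
Proof. by move=> fh; apply: eq_sum1 => x; exact: eq_sum3. Qed.

Lemma sum1D f h : sum1 (fun x => f x + h x) = sum1 f + sum1 h.
Proof. exact: big_split. Qed.
Lemma sum2D (f h : V -> V -> R) : sum2 (fun x y => f x y + h x y) = sum2 f + sum2 h.
Proof. by rewrite -sum1D; apply: eq_sum1 => x; rewrite -sum1D. Qed.
Lemma sum3D (f h : V -> V -> V -> R) : sum3 (fun x y z => f x y z + h x y z) = sum3 f + sum3 h.
Proof. by rewrite -sum1D; apply: eq_sum1 => x; rewrite -sum2D. Qed.
Lemma sum4D (f h : V -> V -> V -> V -> R) : sum4 (fun x y z w => f x y z w + h x y z w) = sum4 f + sum4 h.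
Proof. by rewrite -sum1D; apply: eq_sum1 => x; rewrite -sum3D. Qed.

Lemma sum1Z c f : sum1 (fun x => c * f x) = c * sum1 f.
Proof. by rewrite /sum1 mulr_sumr. Qed.
Lemma sum2Z c (f : V -> V -> R) : sum2 (fun x y => c * f x y) = c * sum2 f.
Proof. by rewrite -sum1Z; apply: eq_sum1 => x; rewrite -sum1Z. Qed.
Lemma sum3Z c (f : V -> V -> V -> R) : sum3 (fun x y z => c * f x y z) = c * sum3 f.
Proof. by rewrite -sum1Z; apply: eq_sum1 => x; rewrite -sum2Z. Qed.
Lemma sum4Z c (f : V -> V -> V -> V -> R) : sum4 (fun x y z w => c * f x y z w) = c * sum4 f.
Proof. by rewrite -sum1Z; apply: eq_sum1 => x; rewrite -sum3Z. Qed.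

Lemma sum2C (f : V -> V -> R) : sum2 f = sum2 (fun x y => f y x).
Proof. exact: exchange_big. Qed.
Lemma sum3C12 (f : V -> V -> V -> R) : sum3 f = sum3 (fun x y z => f y x z).
Proof. exact: (sum2C (fun x y => sum1 (f x y))). Qed.
Lemma sum3C23 (f : V -> V -> V -> R) : sum3 f = sum3 (fun x y z => f x z y).
Proof. by apply: eq_sum1 => x; rewrite sum2C. Qed.
Lemma sum4C12 (f : V -> V -> V -> V -> R) : sum4 f = sum4 (fun x y z w => f y x z w).
Proof. exact: (sum2C (fun x y => sum2 (f x y))). Qed.
Lemma sum4C23 (f : V -> V -> V -> V -> R) : sum4 f = sum4 (fun x y z w => f x z y w).
Proof. by apply: eq_sum1 => x; rewrite sum3C12. Qed.
Lemma sum4C34 (f : V -> V -> V -> V -> R) : sum4 f = sum4 (fun x y z w => f x y w z).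
Proof. by apply: eq_sum1 => x; rewrite sum3C23. Qed.

Lemma sum1_eq0 f : (forall x, 0 <= f x) -> sum1 f = 0 -> forall i, f (e i) = 0.
Proof. by move=> f0 /psumr_eq0P s0 i; apply: s0. Qed.

Lemma sum1_ge0 f : (forall x, 0 <= f x) -> 0 <= sum1 f.
Proof. by move=> f0; apply: sumr_ge0. Qed.

Lemma sum4_sqr_eq0 (f : V -> V -> V -> V -> R) : lin4 f -> sum4 (fun x y z w => f x y z w ^+ 2) = 0 ->
  forall x y z w, f x y z w = 0.
Proof.
move=> lf s0; apply: (lin4_eq (h := fun _ _ _ _ => 0)) => //.
  by split=> *; exact: lin_zero.
move=> i j k l; apply/eqP; rewrite -sqrf_eq0; apply/eqP.
have p1 x y z := sum1_ge0 (fun w => sqr_ge0 (f x y z w)).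
have p2 x y := sum1_ge0 (p1 x y).
have p3 x := sum1_ge0 (p2 x).
have s1 := sum1_eq0 p3 s0 i.
have s2 := sum1_eq0 (p2 (e i)) s1 j.
have s3 := sum1_eq0 (p1 (e i) (e j)) s2 k.
exact: (sum1_eq0 (fun w => sqr_ge0 (f (e i) (e j) (e k) w)) s3 l).
Qed.

Lemma sum1_gl x f : lin f -> sum1 (fun p => g x p * f p) = f x.
Proof. by move=> lf; rewrite (lin_expand gP oe se x lf). Qed.
Lemma sum1_gr x f : lin f -> sum1 (fun p => g p x * f p) = f x.
Proof. by move=> lf; rewrite (lin_expandC gP oe se x lf). Qed.
Lemma sum1_gg : sum1 (fun p => g p p) = 8%:R.
Proof.
by rewrite /sum1 (eq_bigr (fun=> 1)) ?sumr_const ?card_ord// => i _; rewrite oe eqxx.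
Qed.

Definition linmap (A : V -> V) : Prop :=
  forall (c : R) x y, A (c *: x + y) = c *: A x + A y.

Lemma lin_comp f A : lin f -> linmap A -> lin (fun x => f (A x)).
Proof. by move=> lf lA c x y; rewrite lA lf. Qed.

End CurriedForm.

Section Spin7Projection.
Variables (R : realType) (V : lmodType R) (g : V -> V -> R) (e : 'I_8 -> V).
Hypotheses (gP : is_inner_product g) (oe : orthonormal g e) (se : spanning e).
Variables (sigma : R) (F : V -> V -> V -> V -> R).
Hypotheses (sigma2 : sigma * sigma = 1)
  (F_lin1 : forall y z w, lin (fun x => F x y z w))
  (F12 : forall x y z w, F y x z w = - F x y z w)
  (F23 : forall x y z w, F x z y w = - F x y z w)
  (F34 : forall x y z w, F x y w z = - F x y z w)
  (F_contract : forall i j k l,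
     sum2 e (fun p q => F (e i) (e j) p q * F (e k) (e l) p q) =
     6%:R * (g (e i) (e k) * g (e j) (e l) - g (e i) (e l) * g (e j) (e k))
     - 4%:R * sigma * F (e i) (e j) (e k) (e l)).
Implicit Types (x y z w : V) (A B : V -> V).

Local Notation S1 := (sum1 e).
Local Notation S2 := (sum2 e).
Local Notation S3 := (sum3 e).
Local Notation S4 := (sum4 e).

Lemma F_lin2 x z w : lin (fun y => F x y z w).
Proof. by move=> c a b; rewrite ![F x _ _ _]F12 F_lin1 opprD mulrN. Qed.
Lemma F_lin3 x y w : lin (fun z => F x y z w).
Proof. by move=> c a b; rewrite ![F x y _ _]F23 F_lin2 opprD mulrN. Qed.
Lemma F_lin4 x y z : lin (F x y z).
Proof. by move=> c a b; rewrite ![F x y z _]F34 F_lin3 opprD mulrN. Qed.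

Lemma F_1342 x y z w : F x z w y = F x y z w.
Proof. by rewrite F34 F23 opprK. Qed.
Lemma F_2314 x y z w : F y z x w = F x y z w.
Proof. by rewrite F23 F12 opprK. Qed.
Lemma F_2341 x y z w : F y z w x = - F x y z w.
Proof. by rewrite F34 F_2314. Qed.
Lemma F_3412 x y z w : F z w x y = F x y z w.
Proof. by rewrite F_2341 F_2341 opprK. Qed.
Lemma F_14 x y z w : F w y z x = - F x y z w.
Proof. by rewrite -F_2341 -[LHS]F_2314. Qed.

Lemma F_eq0 x y z : F x x y z = 0.
Proof. by have /eqP := F12 x x y z; rewrite -addr_eq0 -mulr2n mulrn_eq0 => /eqP. Qed.
Lemma F_eq0_14 x y z : F x y z x = 0.
Proof. by rewrite -F_1342 F23 F12 F_eq0 !oppr0. Qed.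

Lemma F_eq0_24 x y z : F x y z y = 0.
Proof. by rewrite F12 F_eq0_14 oppr0. Qed.

Lemma lin_g1 y : lin (g^~ y). Proof. exact: inner_linl. Qed.
Lemma lin_g2 x : lin (g x). Proof. exact: inner_linr. Qed.

Ltac lin_tac := repeat first
  [ assumption
  | exact: lin_zero
  | exact: F_lin1 | exact: F_lin2 | exact: F_lin3 | exact: F_lin4
  | exact: lin_g1 | exact: lin_g2
  | match goal with
    | |- lin (fun x => _ + _) => apply: lin_add
    | |- lin (fun x => - _) => apply: lin_opp
    | |- lin (fun x => sum1 _ _) => apply: lin_bigsum => ?
    | |- lin (fun x => sum2 _ _) => apply: lin_bigsum => ?
    | |- lin (fun x => sum3 _ _) => apply: lin_bigsum => ?
    | |- lin (fun x => _ * _) => first [apply: lin_mull | apply: lin_mulr]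
    end
  | match goal with
    | L : linmap ?A |- lin (fun x => F (?A x) _ _ _) =>
        exact: (lin_comp (F_lin1 _ _ _) L)
    | L : linmap ?A |- lin (fun x => F _ (?A x) _ _) =>
        exact: (lin_comp (F_lin2 _ _ _) L)
    | L : linmap ?A |- lin (fun x => F _ _ (?A x) _) =>
        exact: (lin_comp (F_lin3 _ _ _) L)
    | L : linmap ?A |- lin (fun x => F _ _ _ (?A x)) =>
        exact: (lin_comp (F_lin4 _ _ _) L)
    | L : linmap ?A |- lin (fun x => g (?A x) _) => exact: (lin_comp (lin_g1 _) L)
    | L : linmap ?A |- lin (fun x => g _ (?A x)) => exact: (lin_comp (lin_g2 _) L)
    end ].

Lemma contract2 x y z w :
  S2 (fun p q => F x y p q * F z w p q) =
  6%:R * (g x z * g y w - g x w * g y z) - 4%:R * sigma * F x y z w.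
Proof.
pose f x y z w := S2 (fun p q => F x y p q * F z w p q).
pose h x y z w :=
  6%:R * (g x z * g y w - g x w * g y z) - 4%:R * sigma * F x y z w.
rewrite -/(f x y z w) -/(h x y z w).
apply: (lin4_eq gP oe se (f := f) (h := h)) => [||i j k l].
- by split=> *; rewrite /f; lin_tac.
- by split=> *; rewrite /h; lin_tac.
exact: F_contract.
Qed.

Lemma contract3 x y :
  S3 (fun p q r => F x p q r * F y p q r) = 42%:R * g x y.
Proof.
rewrite /sum3 (@eq_sum1 _ _ e _ (fun p => 6%:R * g x y * g p p + -6%:R * (g x p * g p y))).
  rewrite sum1D !sum1Z (sum1_gg oe) (sum1_gl gP oe se x (lin_g1 y)); ring.
move=> p; by rewrite contract2 F_eq0_24; ring.
Qed.

Section SkewOperators.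

Definition skew_op A := linmap A /\ forall x y, g (A x) y = - g x (A y).

Lemma skew_op_diag A x : skew_op A -> g (A x) x = 0.
Proof.
move=> [_ sk]; have /eqP := sk x x; rewrite [g x _](inner_sym gP).
by rewrite -addr_eq0 -mulr2n mulrn_eq0 => /eqP.
Qed.

Definition act A x y z w :=
  F (A x) y z w + F x (A y) z w + F x y (A z) w + F x y z (A w).

Definition phi_map A x y := S1 (fun p => F p (A p) x y).

(** The polynomial in [phi_map] that is 1 on its eigenspace for [-6 sigma] and 0
    on the one for [2 sigma], by [phi_map_phi_map]. *)
Definition proj7 A x y :=
  4%:R^-1 * g (A x) y - sigma / 8%:R * phi_map A x y.

Definition proj7_op A x := \sum_i proj7 A x (e i) *: e i.

(** The complement of spin(7) in so(8), as an eigenspace. *)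
Definition is7 A := forall x y, phi_map A x y = - (6%:R * sigma) * g (A x) y.
End SkewOperators.

Lemma act12 A x y z w : act A y x z w = - act A x y z w.
Proof.
rewrite /act (F12 x (A y) z w) (F12 (A x) y z w) (F12 x y (A z) w).
by rewrite (F12 x y z (A w)); ring.
Qed.
Lemma act23 A x y z w : act A x z y w = - act A x y z w.
Proof.
rewrite /act (F23 (A x) y z w) (F23 x y (A z) w) (F23 x (A y) z w).
by rewrite (F23 x y z (A w)); ring.
Qed.
Lemma act34 A x y z w : act A x y w z = - act A x y z w.
Proof.
rewrite /act (F34 (A x) y z w) (F34 x (A y) z w) (F34 x y z (A w)).
by rewrite (F34 x y (A z) w); ring.
Qed.

Lemma act_lin4 A : linmap A -> lin4 (act A).
Proof. by move=> lA; split=> *; rewrite /act; lin_tac. Qed.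

(** The four terms of [act] reduce to [contract3] and three times the same
    contraction over two indices. *)
Lemma act_contract3 A x y : skew_op A ->
  S3 (fun p q r => act A x p q r * F y p q r) = 96%:R * proj7 A x y.
Proof.
move=> sA; have [lA sk] := sA.
have t2E : S3 (fun p q r => F x (A p) q r * F y p q r) =
    - 6%:R * g (A x) y - 4%:R * sigma * phi_map A x y.
  rewrite /sum3 (@eq_sum1 _ _ e _ (fun p => - 6%:R * (g x p * g (A p) y)
    + - (4%:R * sigma) * F p (A p) x y)) => [|p].
    by rewrite sum1D !sum1Z (sum1_gl gP oe se x (f := fun p => g (A p) y)) /phi_map; [ring|lin_tac].
  have FE : F x (A p) y p = F p (A p) x y by rewrite -[LHS]opprK -F_14 F34 opprK.
  by rewrite contract2 (skew_op_diag p sA) FE; ring.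
have t3E : S3 (fun p q r => F x p (A q) r * F y p q r) =
           S3 (fun p q r => F x (A p) q r * F y p q r).
  by rewrite sum3C12; apply: eq_sum3 => p q r; rewrite F23 [F y _ _ _]F23; ring.
have t4E : S3 (fun p q r => F x p q (A r) * F y p q r) =
           S3 (fun p q r => F x p (A q) r * F y p q r).
  by rewrite sum3C23; apply: eq_sum3 => p q r; rewrite F34 [F y _ _ _]F34; ring.
rewrite (@eq_sum3 _ _ e _ (fun p q r => F (A x) p q r * F y p q r +
   F x (A p) q r * F y p q r + F x p (A q) r * F y p q r
   + F x p q (A r) * F y p q r)) => [|p q r]; last by rewrite /act; ring.
rewrite !sum3D contract3 t4E t3E t2E /proj7.
by field.
Qed.

Lemma phi_map_expand A x y : linmap A ->
  phi_map A x y = S2 (fun p q => g (A p) q * F p q x y).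
Proof.
move=> lA; apply: eq_sum1 => p.
by rewrite (sum1_gl gP oe se _ (f := fun q => F p q x y))//; exact: F_lin2.
Qed.

Lemma phi_map_lin1 A y : lin (fun x => phi_map A x y).
Proof. by apply: (@lin_bigsum _ _ _ _ (fun i x => F (e i) (A (e i)) x y)) => i; exact: F_lin3. Qed.

Lemma phi_map_lin2 A x : lin (phi_map A x).
Proof. by apply: (@lin_bigsum _ _ _ _ (fun i y => F (e i) (A (e i)) x y)) => i; exact: F_lin4. Qed.

Lemma phi_map_skew A x y : phi_map A y x = - phi_map A x y.
Proof. by rewrite -mulN1r -sum1Z; apply: eq_sum1 => p; rewrite F34 mulN1r. Qed.

(** Identifying endomorphisms with two-forms, this is the quadratic equation
    [M ^ 2 = 12 - 4 sigma M] for [M = phi_map], with roots [-6 sigma] and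
    [2 sigma]. *)
Lemma phi_map_phi_map A x y : skew_op A ->
  S2 (fun p q => phi_map A p q * F p q x y) =
  12%:R * g (A x) y - 4%:R * sigma * phi_map A x y.
Proof.
move=> [lA sk].
transitivity (S3 (fun r p q => F r (A r) p q * F x y p q)).
  rewrite sum3C12 sum3C23; apply: eq_sum1 => p; apply: eq_sum1 => q.
  rewrite /phi_map mulrC -sum1Z; apply: eq_sum1 => r.
  by rewrite mulrC (F_3412 x y p q).
rewrite /sum3 (@eq_sum1 _ _ e _ (fun r => 6%:R * (g r x * g (A r) y) +
  - 6%:R * (g r y * g (A r) x) + - (4%:R * sigma) * F r (A r) x y)) => [|r]; last first.
  by rewrite contract2; ring.
rewrite !sum1D !sum1Z (sum1_gr gP oe se x (f := fun r => g (A r) y)); last by lin_tac.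
rewrite (sum1_gr gP oe se y (f := fun r => g (A r) x)); last by lin_tac.
have -> : g (A y) x = - g (A x) y by rewrite sk (inner_sym gP).
by rewrite /phi_map; ring.
Qed.

Lemma proj7_lin2 A x : lin (proj7 A x).
Proof.
by apply: lin_add; [apply: lin_mull; exact: lin_g2|
  apply: lin_opp; apply: lin_mull; exact: phi_map_lin2].
Qed.

Lemma proj7_skew A x y : skew_op A -> proj7 A y x = - proj7 A x y.
Proof.
by move=> [_ sk]; rewrite /proj7 sk (inner_sym gP) phi_map_skew; ring.
Qed.

Lemma proj7_opE A x y : g (proj7_op A x) y = proj7 A x y.
Proof.
rewrite /proj7_op (lin_sum _ _ _ (lin_g1 y)).
rewrite [RHS](lin_expandC gP oe se y (proj7_lin2 A x)).
by apply: eq_bigr => i _; rewrite mulrC.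
Qed.

Lemma proj7_op_skew A : skew_op A -> skew_op (proj7_op A).
Proof.
move=> sA; split=> [c x y|x y].
  apply: (inner_inj gP) => z; rewrite lin_g1 !proj7_opE /proj7 sA.1 lin_g1.
  by rewrite phi_map_lin1; ring.
by rewrite [g x _](inner_sym gP) !proj7_opE proj7_skew.
Qed.

Lemma proj7_op_is7 A : skew_op A -> is7 (proj7_op A).
Proof.
move=> sA x y; rewrite phi_map_expand; last exact: (proj7_op_skew sA).1.
transitivity (4%:R^-1 * phi_map A x y + - (sigma / 8%:R) *
    S2 (fun p q => phi_map A p q * F p q x y)).
  rewrite (phi_map_expand _ _ sA.1) -!sum2Z -sum2D; apply: eq_sum2 => p q.
  by rewrite proj7_opE /proj7; ring.
rewrite phi_map_phi_map// proj7_opE /proj7.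
by field: sigma2.
Qed.

Lemma is7_proj7 A x y : is7 A -> proj7 A x y = g (A x) y.
Proof. by move=> A7; rewrite /proj7 A7; field: sigma2. Qed.

(** As both [act A] and [act B] are alternating, [B] may be moved to the first
    argument in each of the four terms of [act B]. *)
Lemma sum_act2 A B : skew_op A -> skew_op B ->
  S4 (fun x y z w => act A x y z w * act B x y z w) =
  384%:R * S1 (fun x => proj7 A x (B x)).
Proof.
move=> sA sB; pose t x y z w := act A x y z w * F (B x) y z w.
have t1 : S4 t = 96%:R * S1 (fun x => proj7 A x (B x)).
  by rewrite -sum1Z; apply: eq_sum1 => x; rewrite -act_contract3.
have t2 : S4 (fun x y z w => act A x y z w * F x (B y) z w) = S4 t.
  by rewrite sum4C12; apply: eq_sum4 => x y z w; rewrite act12 F12 mulrNN.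
have t3 : S4 (fun x y z w => act A x y z w * F x y (B z) w) = S4 t.
  by rewrite -t2 sum4C23; apply: eq_sum4 => x y z w; rewrite act23 F23 mulrNN.
have t4 : S4 (fun x y z w => act A x y z w * F x y z (B w)) = S4 t.
  by rewrite -t3 sum4C34; apply: eq_sum4 => x y z w; rewrite act34 F34 mulrNN.
rewrite (@eq_sum4 _ _ e _ (fun x y z w => t x y z w
   + act A x y z w * F x (B y) z w + act A x y z w * F x y (B z) w
   + act A x y z w * F x y z (B w))) => [|x y z w]; last by rewrite /act /t /act; ring.
by rewrite !sum4D t2 t3 t4 t1; ring.
Qed.

(** The norm of [act A] is zero by [sum_act2]. *)
Lemma act_eq0 A : skew_op A -> (forall x y, proj7 A x y = 0) ->
  forall x y z w, act A x y z w = 0.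
Proof.
move=> sA p0; apply: (sum4_sqr_eq0 gP oe se (act_lin4 sA.1)).
rewrite (@eq_sum4 _ _ e _ (fun x y z w => act A x y z w * act A x y z w)) => [|*];
  last exact: expr2.
rewrite sum_act2//; rewrite /sum1 big1 ?mulr0// => i _; exact: p0.
Qed.

Lemma subopE A B (f : V -> R) x : lin f -> f (A x - B x) = f (A x) - f (B x).
Proof. by move=> lf; rewrite -scaleN1r addrC lf; ring. Qed.

Lemma skew_op_sub A B : skew_op A -> skew_op B -> skew_op (fun x => A x - B x).
Proof.
move=> sA sB; split=> [c u v|u v].
  apply: (inner_inj gP) => a; rewrite lin_g1 !(subopE _ _ _ (lin_g1 a)).
  by rewrite sA.1 sB.1 !lin_g1; ring.
rewrite (subopE _ _ _ (lin_g1 v)) (subopE _ _ _ (lin_g2 u)) sA.2 sB.2; ring.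
Qed.

Lemma act_sub A B x y z w :
  act (fun x => A x - B x) x y z w = act A x y z w - act B x y z w.
Proof.
rewrite /act (subopE _ _ _ (F_lin1 y z w)) (subopE _ _ _ (F_lin2 x z w)).
by rewrite (subopE _ _ _ (F_lin3 x y w)) (subopE _ _ _ (F_lin4 x y z)); ring.
Qed.

Lemma proj7_sub A B x y :
  proj7 (fun x => A x - B x) x y = proj7 A x y - proj7 B x y.
Proof.
rewrite /proj7 (subopE _ _ _ (lin_g1 y)) /phi_map.
rewrite (@eq_sum1 _ _ e _ (fun p => F p (A p) x y + - 1 * F p (B p) x y)).
  by rewrite sum1D sum1Z; ring.
by move=> p; rewrite (subopE _ _ _ (F_lin2 p x y)); ring.
Qed.

(** [act] kills the difference, whose projection is zero. *)
Lemma act_proj7 A x y z w : skew_op A -> act (proj7_op A) x y z w = act A x y z w.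
Proof.
move=> sA; have sP := proj7_op_skew sA.
have := act_eq0 (skew_op_sub sA sP) _ x y z w; rewrite act_sub => H.
apply/esym/subr0_eq/H => u v.
by rewrite proj7_sub (is7_proj7 _ _ (proj7_op_is7 sA)) proj7_opE subrr.
Qed.

(** ** The eigenspace [is7] *)

Lemma sum4_cycle3 (f : V -> V -> V -> V -> R) :
  S4 f = S4 (fun x y z w => f y z x w).
Proof. by rewrite sum4C23 sum4C12. Qed.

Lemma sum4_cycle4 (f : V -> V -> V -> V -> R) :
  S4 f = S4 (fun w x y z => f x y z w).
Proof. by rewrite sum4C34 sum4C23 sum4C12. Qed.

Lemma act_2314 A x y z w : act A y z x w = act A x y z w.
Proof. by rewrite act23 act12 opprK. Qed.

Lemma act_2341 A x y z w : act A y z w x = - act A x y z w.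
Proof. by rewrite act34 act_2314. Qed.

Lemma act_eq0_14 A x y z : act A x y z x = 0.
Proof.
by have := act_2341 A x x y z; have := act12 A x x y z; lra.
Qed.

(** The norm of the difference of both sides is zero: by [contract3],
    [act_contract3] and the eigenvalue equation, all inner products of the three
    terms are multiples of the squared norm [N] of [A]. *)
Lemma act_is7 A x y z w : skew_op A -> is7 A ->
  act A x y z w = 4%:R * F x y z (A w) +
    4%:R * sigma * (g w x * g (A y) z + g w y * g (A z) x + g w z * g (A x) y).
Proof.
move=> sA A7; have [lA sk] := sA.
pose N := S1 (fun x => g (A x) (A x)).
pose G x y z w := F x y z (A w).
pose d x y z w := g w x * g (A y) z.
pose D x y z w := d x y z w + d y z x w + d z x y w.
have SD (X : V -> V -> V -> V -> R) : lin4 X ->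
    (forall x y z w, X y z x w = X x y z w) ->
    S4 (fun x y z w => X x y z w * D x y z w) =
    3%:R * S3 (fun x y z => X x y z x * g (A y) z).
  move=> lX Xc; pose X1 x y z w := X x y z w * d x y z w.
  have -> : S4 (fun x y z w => X x y z w * D x y z w) = 3%:R * S4 X1.
    rewrite (@eq_sum4 _ _ e _ (fun x y z w => X1 x y z w + X1 y z x w + X1 z x y w)).
      have c1 : S4 (fun x y z w => X1 y z x w) = S4 X1.
        by rewrite [RHS]sum4_cycle3.
      have c2 : S4 (fun x y z w => X1 z x y w) = S4 X1.
        by rewrite -c1 [RHS]sum4_cycle3.
      by rewrite !sum4D c1 c2; move: (S4 X1) => c; ring.
    move=> a b c v; rewrite /X1 /D (Xc b c a v) (Xc a b c v); ring.
  congr (_ * _); apply: eq_sum1 => a; apply: eq_sum1 => b; apply: eq_sum1 => c.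
  rewrite -(sum1_gr gP oe se a (f := fun w => X a b c w * g (A b) c)).
    by apply: eq_sum1 => v; rewrite /X1 /d; ring.
  by apply: lin_mulr; case: lX.
have Saa : S4 (fun x y z w => act A x y z w * act A x y z w) = 384%:R * N.
  by rewrite sum_act2//; congr (_ * _); apply: eq_sum1 => v; rewrite is7_proj7.
have SGG : S4 (fun x y z w => G x y z w * G x y z w) = 42%:R * N.
  rewrite sum4_cycle4 -sum1Z; apply: eq_sum1 => v; rewrite -contract3.
  by apply: eq_sum3 => a b c; rewrite /G F_2341 mulrNN.
have SaG : S4 (fun x y z w => act A x y z w * G x y z w) = 96%:R * N.
  rewrite sum4_cycle4 -sum1Z; apply: eq_sum1 => v.
  rewrite -(is7_proj7 _ _ A7) -act_contract3//.
  by apply: eq_sum3 => a b c; rewrite /G F_2341 act_2341 mulrNN.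
have SaD : S4 (fun x y z w => act A x y z w * D x y z w) = 0.
  rewrite SD; [|exact: act_lin4|by move=> *; rewrite act_2314].
  rewrite (@eq_sum3 _ _ e _ (fun x y z => 0 * 0)) ?sum3Z ?mul0r ?mulr0// => *.
  by rewrite act_eq0_14 !mul0r.
have SGD : S4 (fun x y z w => G x y z w * D x y z w) = - 18%:R * sigma * N.
  rewrite SD; last 2 first.
  - by split=> *; rewrite /G; lin_tac.
  - by move=> *; rewrite /G F_2314.
  transitivity (3%:R * S1 (fun x => phi_map A x (A x))); last first.
    rewrite (@eq_sum1 _ _ e _ (fun x => - (6%:R * sigma) * g (A x) (A x))) => [|*].
      by rewrite sum1Z /N; ring.
    by rewrite A7.
  congr (_ * _); apply: eq_sum1 => a; apply: eq_sum1 => b.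
  rewrite [RHS]F_2314 -(sum1_gl gP oe se (A b) (f := fun c => F a b c (A a))).
    by apply: eq_sum1 => c; rewrite /G mulrC.
  by lin_tac.
have SDD : S4 (fun x y z w => D x y z w * D x y z w) = 18%:R * N.
  rewrite SD; last 2 first.
  - by split=> *; rewrite /D /d; lin_tac.
  - by move=> *; rewrite /D; ring.
  have AA a b : g (A a) b * g (A b) a = - (g (A a) b * g (A a) b).
    by rewrite [g (A b) a]sk [g b _](inner_sym gP); ring.
  have NE : S2 (fun x y => g (A x) y * g (A x) y) = N.
    by apply: eq_sum1 => a; rewrite (sum1_gl gP oe se _ (lin_g2 (A a))).
  rewrite (@eq_sum3 _ _ e _ (fun x y z => g x x * (g (A y) z * g (A y) z)
     + g x y * (g (A z) x * g (A y) z) + g x z * (g (A x) y * g (A y) z))) => [|a b c];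
    last by rewrite /D /d; ring.
  rewrite !sum3D.
  have -> : S3 (fun x y z => g x x * (g (A y) z * g (A y) z)) = 8%:R * N.
    rewrite -(sum1_gg oe) mulrC -sum1Z; apply: eq_sum1 => a.
    by rewrite sum2Z NE mulrC.
  have -> : S3 (fun x y z => g x y * (g (A z) x * g (A y) z)) = - N.
    rewrite sum3C23 -NE -mulN1r -sum2Z; apply: eq_sum1 => a; apply: eq_sum1 => b.
    rewrite (sum1_gl gP oe se a (f := fun y => g (A b) a * g (A y) b)); last by lin_tac.
    by rewrite mulrC AA mulN1r.
  have -> : S3 (fun x y z => g x z * (g (A x) y * g (A y) z)) = - N.
    rewrite -NE -mulN1r -sum2Z; apply: eq_sum1 => a; apply: eq_sum1 => b.
    rewrite (sum1_gl gP oe se a (f := fun y => g (A a) b * g (A b) y)); last by lin_tac.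
    by rewrite AA mulN1r.
  by ring.
pose U x y z w := act A x y z w - 4%:R * G x y z w - 4%:R * sigma * D x y z w.
suff : U x y z w = 0 by rewrite /U /G /D /d; lra.
apply: (sum4_sqr_eq0 gP oe se).
  by split=> *; rewrite /U /act /G /D /d; lin_tac.
rewrite (@eq_sum4 _ _ e _ (fun x y z w => act A x y z w * act A x y z w
   + 16%:R * (G x y z w * G x y z w) + 16%:R * (D x y z w * D x y z w)
   + - 8%:R * (act A x y z w * G x y z w)
   + - (8%:R * sigma) * (act A x y z w * D x y z w)
   + 32%:R * sigma * (G x y z w * D x y z w))) => [|a b c v].
  by rewrite !sum4D !sum4Z Saa SGG SDD SaG SaD SGD; ring: sigma2.
by rewrite /U; ring: sigma2.
Qed.

(** ** The complement of the stabiliser *)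

(** By [sum_act2] the inner product of [act A] and [act B] is a multiple of the
    left-hand side. *)
Lemma is7_orthogonal A B : skew_op A -> is7 A -> skew_op B ->
  (forall x y z w, act B x y z w = 0) -> S1 (fun x => g (A x) (B x)) = 0.
Proof.
move=> sA A7 sB B0; have := sum_act2 sA sB.
rewrite (@eq_sum4 _ _ e _ (fun _ _ _ _ => 0 * 0)) => [|*]; last by rewrite B0 !mulr0.
rewrite sum4Z mul0r (@eq_sum1 _ _ e _ (fun x => g (A x) (B x))) => [/eqP|*].
  by rewrite eq_sym mulf_eq0 pnatr_eq0 => /orP[//|/eqP].
exact: is7_proj7.
Qed.

(** [B = A - proj7_op A] acts trivially on [F], so it is orthogonal to [A] by
    hypothesis and to [proj7_op A] by [is7_orthogonal]; hence [B = 0]. *)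
Lemma orthogonal_is7 A : skew_op A ->
  (forall B, skew_op B -> (forall x y z w, act B x y z w = 0) ->
     S1 (fun x => g (A x) (B x)) = 0) -> is7 A.
Proof.
move=> sA perp; have sP := proj7_op_skew sA; have P7 := proj7_op_is7 sA.
pose B x := A x - proj7_op A x.
have sB : skew_op B := skew_op_sub sA sP.
have B0 x y z w : act B x y z w = 0 by rewrite /B act_sub act_proj7// subrr.
have BB : S1 (fun x => g (B x) (B x)) = 0.
  rewrite (@eq_sum1 _ _ e _ (fun x => g (A x) (B x) + - 1 * g (proj7_op A x) (B x))).
    by rewrite sum1D sum1Z perp// is7_orthogonal// mulr0 addr0.
  by move=> x; rewrite {1}/B (subopE _ _ _ (lin_g1 (B x))); ring.
have g0 x : 0 <= g (B x) (B x).
  have [->|/eqP Bx] := pselect (B x = 0); first by rewrite (lin0 (lin_g1 0)).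
  by case: gP => _ _ /(_ _ Bx)/ltW.
have Be i : B (e i) = 0.
  by apply: (inner_eq0 gP); exact: (sum1_eq0 g0 BB i).
suff -> : A = proj7_op A by [].
apply/funext => x; apply: (inner_inj gP) => y.
apply: (lin_eq gP oe se (f := fun x => g (A x) y) (h := fun x => g (proj7_op A x) y)).
- by have [lA _] := sA; lin_tac.
- by have [lP _] := sP; lin_tac.
by move=> i; congr (g _ y); apply/subr0_eq; exact: Be.
Qed.

(** ** The exterior derivative *)

Section TorsionFamily.
Variable A : V -> V -> V.
Hypotheses (A_lin : forall y, linmap (A^~ y)) (A_skew : forall x, skew_op (A x))
  (A_is7 : forall x, is7 (A x)).

Definition alt_act x y z w v :=
  act (A x) y z w v - act (A y) x z w v + act (A z) x y w v
  - act (A w) x y z v + act (A v) x y z w.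

Definition trace_act x := S1 (fun p => g (A p x) p).

Definition phi_trace x y z := S1 (fun p => F (A p x) y z p).

Definition div_act x y z := S1 (fun p => act (A p) x y z p).

(** By [act_is7], applied with [x] as the last argument, the two summation
    indices are never separated by [B]. *)
Lemma act_contract2 B x y z w : skew_op B -> is7 B ->
  S2 (fun q r => act B x y q r * F z w q r) =
  - 24%:R * (g y z * g (B x) w - g y w * g (B x) z)
  + 16%:R * sigma * F y (B x) z w + 24%:R * (g x y * g (B z) w)
  + 8%:R * sigma * F z w x (B y).
Proof.
move=> sB B7; have [lB skB] := sB.
pose f1 q r := F y (B x) q r * F z w q r.
pose f2 q r := g (B q) r * F q r z w.
pose f3 q r := g x q * (g (B r) y * F z w q r).
pose f4 q r := g (B y) q * (g x r * F z w q r).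
have f1E : S2 f1 = 6%:R * (g y z * g (B x) w - g y w * g (B x) z)
    - 4%:R * sigma * F y (B x) z w by exact: contract2.
have f2E : S2 f2 = - (6%:R * sigma) * g (B z) w by rewrite -B7 phi_map_expand.
have f3E : S2 f3 = - F z w x (B y).
  rewrite sum2C /sum2 (@eq_sum1 _ _ e _ (fun r => - 1 * (g r (B y) * F z w x r))).
    by rewrite sum1Z (sum1_gr gP oe se (B y) (F_lin4 z w x)); ring.
  move=> r; rewrite (sum1_gl gP oe se x (f := fun q => g (B r) y * F z w q r)); last by lin_tac.
  by rewrite skB; ring.
have f4E : S2 f4 = - F z w x (B y).
  rewrite -F34 -(sum1_gl gP oe se (B y) (F_lin3 z w x)); apply: eq_sum1 => q.
  by rewrite sum1Z (sum1_gl gP oe se x (F_lin4 z w q)).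
rewrite (@eq_sum2 _ _ e _ (fun q r => - 4%:R * f1 q r
   + - (4%:R * sigma * g x y) * f2 q r + - (4%:R * sigma) * f3 q r
   + - (4%:R * sigma) * f4 q r)) => [|q r].
  by rewrite !sum2D !sum2Z f1E f2E f3E f4E; ring: sigma2.
have -> : act B x y q r = - act B y q r x by rewrite (act_2341 B x) opprK.
rewrite act_is7// /f1 /f2 /f3 /f4 -(F_3412 q r z w) F_1342; ring.
Qed.

Lemma alt_act_contract3 x y z :
  S3 (fun p q r => alt_act x y p q r * F z p q r) =
  96%:R * g (A x y) z - 96%:R * g (A y x) z +
  3%:R * S3 (fun p q r => act (A p) x y q r * F z p q r).
Proof.
pose t p q r := act (A p) x y q r * F z p q r.
have tq : S3 (fun p q r => act (A q) x y p r * F z p q r) = - S3 t.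
  rewrite sum3C12 -mulN1r -sum3Z; apply: eq_sum3 => p q r.
  by rewrite /t F23; ring.
have tr : S3 (fun p q r => act (A r) x y p q * F z p q r) = S3 t.
  rewrite sum3C12 sum3C23 sum3C12; apply: eq_sum3 => p q r.
  by rewrite /t act34 F23 F34 F23; ring.
rewrite (@eq_sum3 _ _ e _ (fun p q r => act (A x) y p q r * F z p q r
  + - 1 * (act (A y) x p q r * F z p q r) + t p q r
  + - 1 * (act (A q) x y p r * F z p q r) + act (A r) x y p q * F z p q r)).
  rewrite !sum3D !sum3Z tq tr !act_contract3// !is7_proj7//.
  by move: (S3 t) => c; ring.
by move=> p q r; rewrite /alt_act /t; ring.
Qed.

Lemma act_contract3_family x y z :
  S3 (fun p q r => act (A p) x y q r * F z p q r) =
  - 24%:R * (g y z * trace_act x) + 24%:R * g (A y x) z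
  - 16%:R * sigma * phi_trace x y z + 24%:R * (g x y * trace_act z)
  + 8%:R * sigma * phi_trace y z x.
Proof.
transitivity (S1 (fun p => - (24%:R * g y z) * g (A p x) p
  + 24%:R * (g y p * g (A p x) z)
  + - (16%:R * sigma) * F (A p x) y z p + 24%:R * g x y * g (A p z) p
  + 8%:R * sigma * F (A p y) z x p)).
  apply: eq_sum1 => p; rewrite act_contract2// (F12 (A p x) y z p).
  have -> : F z p x (A p y) = F (A p y) z x p.
    by rewrite F23 F_2341 opprK.
  by ring.
rewrite !sum1D !sum1Z (sum1_gl gP oe se y (f := fun p => g (A p x) z)).
  by rewrite /trace_act /phi_trace; ring.
by move=> c u v; rewrite (A_lin x) lin_g1.
Qed.

(** This is [act_is7] with last argument [x], traced over another one; tracing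
    over the last argument instead gives [div_actE]. *)
Lemma phi_traceE x y z :
  4%:R * phi_trace x y z = div_act x y z +
    4%:R * sigma * (g x y * trace_act z - g x z * trace_act y + g (A x y) z).
Proof.
have -> : div_act x y z = S1 (fun p => 4%:R * F (A p x) y z p
   + - (4%:R * sigma * g x y) * g (A p z) p
   + 4%:R * sigma * g x z * g (A p y) p
   + - (4%:R * sigma) * (g x p * g (A p y) z)).
  apply: eq_sum1 => p.
  have -> : act (A p) x y z p = - act (A p) y z p x.
    by rewrite (act_2341 (A p) x) opprK.
  rewrite act_is7// F_2341.
  have -> : g (A p p) y = - g (A p y) p.
    by case: (A_skew p) => _ ->; rewrite (inner_sym gP).
  by ring.
rewrite !sum1D !sum1Z (sum1_gl gP oe se x (f := fun p => g (A p y) z)).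
  by rewrite /trace_act /phi_trace; ring.
by move=> c u v; rewrite (A_lin y) lin_g1.
Qed.

Lemma div_actE x y z :
  div_act x y z = - 4%:R * S1 (fun q => trace_act q * F x y z q)
  + 4%:R * sigma * (g (A x y) z + g (A y z) x + g (A z x) y).
Proof.
have glin a b : lin (fun p => g (A p a) b).
  by move=> c u v; rewrite (A_lin a) lin_g1.
transitivity (S1 (fun p => 4%:R * F x y z (A p p)
  + 4%:R * sigma * (g p x * g (A p y) z) + 4%:R * sigma * (g p y * g (A p z) x)
  + 4%:R * sigma * (g p z * g (A p x) y))).
  by apply: eq_sum1 => p; rewrite act_is7//; ring.
rewrite !sum1D !sum1Z !(sum1_gr gP oe se _ (glin _ _)).
have -> : S1 (fun p => F x y z (A p p)) = - S1 (fun q => trace_act q * F x y z q).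
  transitivity (S2 (fun q p => g (A p p) q * F x y z q)).
    rewrite sum2C; apply: eq_sum1 => p.
    by rewrite (sum1_gl gP oe se (A p p) (F_lin4 x y z)).
  rewrite -mulN1r -sum1Z; apply: eq_sum1 => q.
  rewrite mulrC mulrAC -mulrN1 -mulrA mulrC -sum1Z; apply: eq_sum1 => p.
  case: (A_skew p) => _ ->; rewrite (inner_sym gP); ring.
by ring.
Qed.

(** The contractions [phi_trace], which are not determined by [A] and
    [trace_act] term by term, are eliminated by [phi_traceE] in favour of the
    alternating tensor [div_act], and that one by [div_actE]. *)
Lemma alt_act_projection x y z :
  6%:R^-1 * (S3 (fun p q r => alt_act x y p q r * F z p q r)
    - S3 (fun p q r => alt_act x z p q r * F y p q r)) =
  8%:R * g (A x y) z - 8%:R * (g x y * trace_act z - g x z * trace_act y)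
  + 8%:R * sigma * S1 (fun q => trace_act q * F x y z q).
Proof.
rewrite !alt_act_contract3 !act_contract3_family.
have U a b c : phi_trace a b c = 4%:R^-1 * div_act a b c +
    sigma * (g a b * trace_act c - g a c * trace_act b + g (A a b) c).
  by apply: (mulfI (x := 4%:R)); rewrite ?pnatr_eq0// phi_traceE; field.
have D12 a b c : div_act b a c = - div_act a b c.
  by rewrite -mulN1r -sum1Z; apply: eq_sum1 => p; rewrite act12; ring.
have D23 a b c : div_act a c b = - div_act a b c.
  by rewrite -mulN1r -sum1Z; apply: eq_sum1 => p; rewrite act23; ring.
have Ag a b c : g (A a c) b = - g (A a b) c.
  by case: (A_skew a) => _ ->; rewrite (inner_sym gP).
rewrite !U (D23 z x y) (D12 x z y) (D23 y x z) (D12 x y z) (D23 x y z).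
rewrite div_actE (Ag x y z) (Ag y z x) (Ag z x y).
rewrite (inner_sym gP z y) (inner_sym gP z x) (inner_sym gP y x).
by field: sigma2.
Qed.

Lemma alt_act_trace x :
  S4 (fun p q r s => alt_act x p q r s * F p q r s) = - 384%:R * trace_act x.
Proof.
pose t p q r s := act (A p) x q r s * F p q r s.
have tE : S4 t = 96%:R * trace_act x.
  rewrite -sum1Z; apply: eq_sum1 => p.
  by rewrite act_contract3// is7_proj7.
have t0 : S4 (fun p q r s => act (A x) p q r s * F p q r s) = 0.
  rewrite /sum4 (@eq_sum1 _ _ e _ (fun p => 0 * 0)) ?sum1Z ?mul0r// => p.
  by rewrite act_contract3// is7_proj7// skew_op_diag// !mulr0.
have t2 : S4 (fun p q r s => act (A q) x p r s * F p q r s) = - S4 t.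
  rewrite sum4C12 -mulN1r -sum4Z; apply: eq_sum4 => p q r s.
  by rewrite /t F12; ring.
have t3 : S4 (fun p q r s => act (A r) x p q s * F p q r s) = S4 t.
  rewrite sum4_cycle3; apply: eq_sum4 => p q r s.
  by rewrite /t F_2314.
have t4 : S4 (fun p q r s => act (A s) x p q r * F p q r s) = - S4 t.
  rewrite sum4_cycle4 -mulN1r -sum4Z; apply: eq_sum4 => p q r s.
  by rewrite /t F_2341; ring.
rewrite (@eq_sum4 _ _ e _ (fun p q r s => act (A x) p q r s * F p q r s
  + - 1 * t p q r s + act (A q) x p r s * F p q r s
  + - 1 * (act (A r) x p q s * F p q r s) + act (A s) x p q r * F p q r s)).
  rewrite !sum4D !sum4Z t0 t2 t3 t4 tE; move: (trace_act x) => c; ring.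
by move=> p q r s; rewrite /alt_act /t; ring.
Qed.

End TorsionFamily.
End Spin7Projection.

(** * The algebra at a point in terms of forms *)

Section Derivation.
Variables (R : realType) (V : lmodType R) (k : nat) (a : form V k).

Definition derivation_act (A : V -> V) : form V k :=
  fun v => \sum_(i < k) a [eta v with i |-> A (v i)].

Lemma derivation_act_form (A : V -> V) :
  linmap A -> is_form a -> is_form (derivation_act A).
Proof.
move=> lA fa; apply: skew_is_form => [v j c x y|v s]; rewrite /derivation_act.
  rewrite mulr_sumr -big_split/=; apply: eq_bigr => i _.
  have [->|ij] := eqVneq i j.
    have E z : [eta [eta v with j |-> z] with j |-> A z] =
        [eta v with j |-> A z] :> ('I_k -> V).
      by apply/funext => l /=; case: eqP.
    by rewrite !E lA fa.1.
  have E z : [eta [eta v with j |-> z] with i |-> A (v i)] =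
      [eta [eta v with i |-> A (v i)] with j |-> z] :> ('I_k -> V).
    by rewrite updateC// eq_sym.
  by rewrite !E fa.1.
rewrite mulr_sumr (reindex_inj (@perm_inj _ s^-1%g)); apply: eq_bigr => i _.
rewrite -(is_form_skew fa).
have -> : [eta v with i |-> A (v i)] \o s =
    [eta v \o s with (s^-1)%g i |-> A (v i)] by rewrite -update_comp permKV.
by rewrite /= permKV.
Qed.

Lemma derivation_act_lin (A : V -> V -> V) (v : 'I_k -> V) :
  (forall y, linmap (A^~ y)) -> multilinear a ->
  lin (fun x => derivation_act (A x) v).
Proof.
move=> lA ml c x y; rewrite /derivation_act mulr_sumr -big_split/=.
by apply: eq_bigr => i _; rewrite lA ml.
Qed.

End Derivation.

Section FrameSums.
Variables (R : realType) (V : lmodType R) (g : V -> V -> R) (e : 'I_8 -> V).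
Hypotheses (gP : is_inner_product g) (oe : orthonormal g e) (se : spanning e).

Lemma sum_ffun1 (F : form V 1) :
  \sum_(t : {ffun 'I_1 -> 'I_8}) F (fun i => e (t i)) = sum1 e (fun x => F (fun=> x)).
Proof.
rewrite (sum_ffunS e F); apply: eq_bigr => i _.
rewrite (eq_bigr (fun=> F (fun=> e i))) => [|t _]; last first.
  by congr F; apply/funext => j; rewrite ord1 fcons0.
by rewrite sumr_const card_ffun !card_ord expn0.
Qed.

Lemma sum_ffun3 (F : form V 3) :
  \sum_(t : {ffun 'I_3 -> 'I_8}) F (fun i => e (t i)) =
  sum3 e (fun x y z => F (vec3 x y z)).
Proof.
rewrite (sum_ffunS e F); apply: eq_bigr => i _.
rewrite (sum_ffunS e (fun v => F (fcons (e i) v))); apply: eq_bigr => j _.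
exact: (sum_ffun1 (fun v => F (fcons (e i) (fcons (e j) v)))).
Qed.

Lemma sum_ffun4 (F : form V 4) :
  \sum_(t : {ffun 'I_4 -> 'I_8}) F (fun i => e (t i)) =
  sum4 e (fun x y z w => F (vec4 x y z w)).
Proof.
rewrite (sum_ffunS e F); apply: eq_bigr => i _.
exact: (sum_ffun3 (fun v => F (fcons (e i) v))).
Qed.

Lemma inner_form_frame k (a c : form V k) : multilinear a -> multilinear c ->
  inner_form g a c = k`!%:R^-1 *
  \sum_(t : {ffun 'I_k -> 'I_8}) a (fun i => e (t i)) * c (fun i => e (t i)).
Proof.
by move=> la lc; have [ob sb] := onbP oe se;
  rewrite /inner_form (sum_ffun_basis_change gP ob sb oe se la lc).
Qed.

Lemma form_of_skew_multilinear (A : V -> V) : linmap A ->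
  multilinear (form_of_skew g A).
Proof.
move=> lA v i c x y; rewrite /form_of_skew.
case: (unliftP ord0 i) => [j ->|->] /=.
  by rewrite ord1 /= (inner_linr gP).
by rewrite lA (inner_linl gP).
Qed.

Lemma inner_form_of_skew (A B : V -> V) : linmap A -> linmap B ->
  inner_form g (form_of_skew g A) (form_of_skew g B) =
  2%:R^-1 * sum1 e (fun x => g (A x) (B x)).
Proof.
move=> lA lB; rewrite inner_form_frame; [|exact: form_of_skew_multilinear..].
congr (_ * _); pose P (v : 'I_2 -> V) := form_of_skew g A v * form_of_skew g B v.
rewrite (sum_ffunS e P); apply: eq_bigr => i _.
rewrite (sum_ffun1 (fun v => P (fcons (e i) v))).
rewrite -(sum1_gl gP oe se (A (e i)) (f := fun y => g y (B (e i)))); last exact: inner_linl.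
apply: eq_sum1 => y; rewrite /P /form_of_skew.
have -> : (ord_max : 'I_2) = lift ord0 ord0 by apply: val_inj.
by rewrite !fcons0 !fconsS (inner_sym gP y).
Qed.

Lemma fcat1 k (x : V) (u : 'I_k -> V) :
  fcat (fun=> x : V) u = fcons x u :> ('I_(1 + k) -> V).
Proof.
apply/funext => i; case: (@split_ordP 1 k i) => j ->.
  rewrite fcatl ord1 (_ : @lshift 1 k ord0 = (ord0 : 'I_k.+1)) ?fcons0//.
  exact: val_inj.
rewrite fcatr (_ : @rshift 1 k j = (lift ord0 j : 'I_k.+1)) ?fconsS//.
exact: val_inj.
Qed.

(** Wedging with [y] is adjoint to the interior product with [y]. *)
Lemma inner_test_form (Phi a : form V 4) (y z : V) : is_form Phi -> is_form a ->
  inner_form g a (test_form g Phi y z) = 6%:R^-1 *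
  (sum3 e (fun p q r => a (vec4 y p q r) * Phi (vec4 z p q r))
   - sum3 e (fun p q r => a (vec4 z p q r) * Phi (vec4 y p q r))).
Proof.
move=> fP fa.
have lw u v : multilinear (wedge_interior g Phi u v).
  apply: (@wedge_multilinear R V 1 3); last exact: multilinear_fcons fP.1.
  move=> w i c p q; by rewrite /form1 /= !ord1 /= (inner_linr gP).
have half u v : \sum_(t : {ffun 'I_4 -> 'I_8})
    a (fun i => e (t i)) * wedge_interior g Phi u v (fun i => e (t i)) =
    4%:R * sum3 e (fun p q r => a (vec4 u p q r) * Phi (vec4 v p q r)).
  rewrite (@sum_skew_wedge R V _ e 1 3 a _ _ (is_form_skew fa)).
  rewrite (_ : (1 + 3)`! = 24)%N// (_ : 3`! = 6)%N// mul1r.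
  congr (_ * _); first by field.
  pose H (x : 'I_1 -> V) (w : 'I_3 -> V) :=
    a (fcat x w) * (form1 (g u) x * int_prod v Phi w).
  rewrite (eq_bigr (fun x : {ffun 'I_1 -> 'I_8} =>
    sum3 e (fun p q r => H (fun i => e (x i)) (vec3 p q r)))) => [|x _]; last first.
    exact: (sum_ffun3 (H (fun i => e (x i)))).
  rewrite (sum_ffun1 (fun x => sum3 e (fun p q r => H x (vec3 p q r)))).
  transitivity (sum3 e (fun p q r => sum1 e (fun x => H (fun=> x) (vec3 p q r)))).
    rewrite /sum1 exchange_big/=; apply: eq_bigr => i _.
    rewrite exchange_big/=; apply: eq_bigr => j _.
    by rewrite exchange_big.
  apply: eq_sum3 => p q r.
  rewrite -(sum1_gl gP oe se u (f := fun x => a (vec4 x p q r) * Phi (vec4 v p q r))).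
    by apply: eq_sum1 => x; rewrite /H fcat1 /form1 /int_prod mulrCA.
  by apply: lin_mulr; exact: multilinear_lin0 fa.1.
rewrite inner_form_frame; [|exact: fa.1|]; last first.
  by move=> v i c p q; rewrite /test_form !lw; ring.
rewrite /test_form.
under eq_bigr do rewrite mulrBr.
by rewrite sumrB !half (_ : 4`! = 24)%N//; field.
Qed.

End FrameSums.

Section PointwiseSpin7.
Variables (R : realType) (V : lmodType R) (g : V -> V -> R) (e : 'I_8 -> V).
Variables (b : bool) (Phi : form V 4).
Hypotheses (gP : is_inner_product g) (oe : orthonormal g e) (fP : is_form Phi).
Hypothesis frame : cayley_frame ((-1) ^+ b) Phi e.
Implicit Types (x y z w : V) (A B : V -> V).

Let sigma : R := (-1) ^+ b.
Let F x y z w := Phi (vec4 x y z w).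

Lemma cayley_spanning : spanning e.
Proof. by have [eps [_ xE] _] := frame; move=> x; exists (eps^~ x); exact: xE. Qed.

Let se := cayley_spanning.

Let sigma2 : sigma * sigma = 1.
Proof. by rewrite /sigma -expr2 sqrr_sign. Qed.

Let F_lin1 y z w : lin (fun x => F x y z w).
Proof. exact: multilinear_lin0 fP.1. Qed.

Let F_tperm x y z w i j : i != j ->
  Phi (vec4 x y z w \o tperm i j) = - F x y z w.
Proof. exact: is_form_tperm. Qed.

Let F12 x y z w : F y x z w = - F x y z w.
Proof.
rewrite -(@F_tperm x y z w ord0 (inord 1)); last by rewrite -val_eqE /= inordK.
congr Phi; apply/funext => i; rewrite /= vec4E.
case: tpermP => [->|->|]; rewrite ?vec4E ?inordK//.
by case: i => -[|[|[|[|//]]]] ? // i0 i1; [case: i0|case: i1]; apply: val_inj;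
  rewrite /= ?inordK.
Qed.

Let F23 x y z w : F x z y w = - F x y z w.
Proof.
rewrite -(@F_tperm x y z w (inord 1) (inord 2)); last by rewrite -val_eqE /= !inordK.
congr Phi; apply/funext => i; rewrite /= vec4E.
case: tpermP => [->|->|]; rewrite ?vec4E ?inordK//.
by case: i => -[|[|[|[|//]]]] ? // i0 i1; [case: i0|case: i1]; apply: val_inj;
  rewrite /= ?inordK.
Qed.

Let F34 x y z w : F x y w z = - F x y z w.
Proof.
rewrite -(@F_tperm x y z w (inord 2) (inord 3)); last by rewrite -val_eqE /= !inordK.
congr Phi; apply/funext => i; rewrite /= vec4E.
case: tpermP => [->|->|]; rewrite ?vec4E ?inordK//.
by case: i => -[|[|[|[|//]]]] ? // i0 i1; [case: i0|case: i1]; apply: val_inj;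
  rewrite /= ?inordK.
Qed.

Let F_contract i j k l :
  sum2 e (fun p q => F (e i) (e j) p q * F (e k) (e l) p q) =
  6%:R * (g (e i) (e k) * g (e j) (e l) - g (e i) (e l) * g (e j) (e k))
  - 4%:R * sigma * F (e i) (e j) (e k) (e l).
Proof. by rewrite !oe; exact: (phi_contraction2_frame frame). Qed.

Lemma derivation_act_vec4 A x y z w :
  derivation_act Phi A (vec4 x y z w) = act F A x y z w.
Proof.
rewrite /derivation_act !big_ord_recl big_ord0 addr0 /act !addrA.
by congr (Phi _ + Phi _ + Phi _ + Phi _); apply/funext => i; rewrite /= !vec4E;
  case: i => -[|[|[|[|//]]]] ?.
Qed.

Let contract3_ := act_contract3 gP oe se F_lin1 F12 F23 F34 F_contract.

Lemma inner_derivation_test A y z : skew_op g A ->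
  8%:R^-1 * inner_form g (derivation_act Phi A) (test_form g Phi y z) =
  4%:R * proj7 g e sigma F A y z.
Proof.
move=> sA; rewrite (inner_test_form gP oe se _ _ fP); last first.
  by apply: derivation_act_form => //; case: sA.
have E u v : sum3 e (fun p q r =>
    derivation_act Phi A (vec4 u p q r) * Phi (vec4 v p q r)) =
    96%:R * proj7 g e sigma F A u v.
  rewrite -contract3_//; apply: eq_sum3 => p q r.
  by rewrite derivation_act_vec4.
by rewrite !E (proj7_skew e gP sigma F34 y z sA); field.
Qed.

Lemma spin7_act0 B : skew_op g B ->
  spin7 g Phi B <-> forall x y z w, act F B x y z w = 0.
Proof.
move=> sB; split=> [[_ B0] x y z w|B0]; first by rewrite -derivation_act_vec4; exact: B0.
split=> // v; have := B0 (v ord0) (v (inord 1)) (v (inord 2)) (v (inord 3)).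
by rewrite -derivation_act_vec4 -vec4_of.
Qed.

(** The algebra of the stabiliser is the kernel of [act]. *)
Lemma spin7_perp_is7 A : spin7_perp g Phi A <-> skew_op g A /\ is7 g e sigma F A.
Proof.
split=> [[sA perp]|[sA A7]].
  split; first exact: sA.
  apply: (orthogonal_is7 gP oe se sigma2 F_lin1 F12 F23 F34 F_contract sA) => B sB B0.
  have := perp B ((spin7_act0 sB).2 B0).
  rewrite (inner_form_of_skew gP oe se sA.1 sB.1) => /eqP.
  by rewrite mulf_eq0 invr_eq0 pnatr_eq0 => /orP[//|/eqP].
split; first exact: sA.
move=> B sB; have skB : skew_op g B by case: sB.
rewrite (inner_form_of_skew gP oe se sA.1 skB.1).
rewrite (is7_orthogonal gP oe se sigma2 F_lin1 F12 F23 F34 F_contract sA A7 skB) ?mulr0//.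
exact: (spin7_act0 skB).1.
Qed.

Lemma proj7_op_derivation A : skew_op g A ->
  [/\ skew_op g (proj7_op g e sigma F A), is7 g e sigma F (proj7_op g e sigma F A) &
      forall v, derivation_act Phi (proj7_op g e sigma F A) v = derivation_act Phi A v].
Proof.
move=> sA; split.
- exact: (proj7_op_skew gP oe se sigma F_lin1 F12 F23 F34 sA).
- exact: (proj7_op_is7 gP oe se sigma2 F_lin1 F12 F23 F34 F_contract sA).
move=> v; rewrite (vec4_of v) !derivation_act_vec4.
exact: (act_proj7 gP oe se sigma2 F_lin1 F12 F23 F34 F_contract _ _ _ _ sA).
Qed.

Lemma proj7_op_inner A x y :
  g (proj7_op g e sigma F A x) y = proj7 g e sigma F A x y.
Proof. exact: (proj7_opE gP oe se sigma F_lin1 F12 F23 F34). Qed.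

Lemma is7_proj7_op A : is7 g e sigma F A -> proj7_op g e sigma F A = A.
Proof.
move=> A7; apply/funext => x; apply: (inner_inj gP) => y.
by rewrite proj7_op_inner (is7_proj7 sigma2).
Qed.

(** The double sum is the contraction of [A] with [Phi], to which the eigenvalue
    equation applies. *)
Lemma is7_cross3 A (r : 'I_8 -> 'I_8 -> R) y : skew_op g A -> is7 g e sigma F A ->
  (forall i j, r i j = 4%:R * g (A (e i)) (e j)) ->
  A y = - (sigma / 24%:R) *: \sum_i \sum_j r i j *: cross3 g Phi (e i) (e j) y.
Proof.
move=> sA A7 rE; apply: (inner_inj gP) => z.
rewrite (linZ _ _ (inner_linl gP z)).
have -> : g (\sum_i \sum_j r i j *: cross3 g Phi (e i) (e j) y) z =
    4%:R * phi_map e F A y z.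
  rewrite (phi_map_expand gP oe se F_lin1 F12 _ _ sA.1) -sum2Z.
  under eq_bigr do rewrite -[\sum_j _]scale1r.
  rewrite (lin_sum _ _ _ (inner_linl gP z)); apply: eq_bigr => i _.
  rewrite mul1r (lin_sum _ _ _ (inner_linl gP z)); apply: eq_bigr => j _.
  rewrite rE mulrA; congr (_ * _).
  rewrite /cross3 (sharp_lin gP oe se)//.
  exact: (F_lin4 F_lin1 F12 F23 F34).
by rewrite A7; field: sigma2.
Qed.

Section Alternation.
Variable A : V -> V -> V.
Hypotheses (A_lin : forall y, linmap (A^~ y)) (A_skew : forall x, skew_op g (A x))
  (A_is7 : forall x, is7 g e sigma F (A x)).

Definition alt_derivation : form V 5 := fun v =>
  \sum_(i < 5) (-1) ^+ i * derivation_act Phi (A (v i)) (v \o lift i).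

Let derivation_form x : is_form (derivation_act Phi (A x)).
Proof. by apply: derivation_act_form => //; case: (A_skew x). Qed.

(** The alternation is the sum of the products [e_j] wedge [A (e_j)] acting on
    [Phi], hence a form. *)
Lemma alt_derivation_form : is_form alt_derivation.
Proof.
pose W j := @wedge R V 1 4 (form1 (g (e j))) (derivation_act Phi (A (e j))).
have WE : alt_derivation = fun v => \sum_j W j v.
  apply/funext => v; rewrite /W.
  under eq_bigr do rewrite (@wedge1 R V 4 _ _ _ (is_form_skew (derivation_form _))).
  rewrite exchange_big/=; apply: eq_bigr => i _; rewrite -mulr_sumr; congr (_ * _).
  rewrite (lin_expandC gP oe se (v i) (f := fun x => derivation_act Phi (A x) (v \o lift i)))//.
  by apply: derivation_act_lin => //; exact: fP.1.
apply: skew_is_form => [v i c x y|v s]; rewrite WE.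
  rewrite mulr_sumr -big_split/=; apply: eq_bigr => j _.
  rewrite /W; apply: (@wedge_multilinear R V 1 4); last exact: (derivation_form _).1.
  by move=> w l d p q; rewrite /form1 /= !ord1 /= (inner_linr gP).
by rewrite mulr_sumr; apply: eq_bigr => j _; rewrite /W (@wedge_skew R V 1 4).
Qed.

Lemma fcons_comp_lift k x (u : 'I_k.+1 -> V) (j : 'I_k.+1) :
  fcons x u \o lift (lift ord0 j) = fcons x (u \o lift j).
Proof.
apply/funext => i; case: (unliftP ord0 i) => [l ->|->] /=.
  have -> : lift (lift ord0 j) (lift ord0 l) = lift ord0 (lift j l).
    by apply: val_inj; rewrite /= /bump /= !add1n ltnS addnS.
  by rewrite !fconsS.
have -> : lift (lift ord0 j) ord0 = ord0 by exact: val_inj.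
by rewrite !fcons0.
Qed.

Lemma alt_derivation_vec4 x y z w v :
  alt_derivation (fcons x (vec4 y z w v)) = alt_act F A x y z w v.
Proof.
rewrite /alt_derivation big_ord_recl fcons0 mul1r.
have -> : fcons x (vec4 y z w v) \o lift ord0 = vec4 y z w v.
  by apply/funext => i; rewrite /= fconsS.
under eq_bigr do rewrite fconsS fcons_comp_lift vec4_lift vec4E.
rewrite !big_ord_recl big_ord0 /= derivation_act_vec4 -!/(vec4 _ _ _ _).
by rewrite !derivation_act_vec4 /alt_act; ring.
Qed.

Lemma inner_alt_derivation_test x y z :
  inner_form g (int_prod x alt_derivation) (test_form g Phi y z) =
  8%:R * g (A x y) z
  - 8%:R * (g x y * trace_act g e A z - g x z * trace_act g e A y)
  + 8%:R * sigma * sum1 e (fun q => trace_act g e A q * F x y z q).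
Proof.
rewrite (inner_test_form gP oe se _ _ fP); last exact: is_form_fcons alt_derivation_form.
rewrite -(alt_act_projection gP oe se sigma2 F_lin1 F12 F23 F34 F_contract A_lin A_skew A_is7).
by congr (_ * (_ - _)); apply: eq_sum3 => p q r; rewrite /int_prod alt_derivation_vec4.
Qed.

Lemma lee_alt_derivation x :
  lee_of sigma g Phi alt_derivation x = - (16%:R / 7%:R) * trace_act g e A x.
Proof.
rewrite (lee_of_contraction gP x oe se fP alt_derivation_form); last first.
  exact: (spin7_vol_sqr frame).
rewrite (sum_ffun4 e (fun v => alt_derivation (fcons x v) * Phi v)).
rewrite (@eq_sum4 _ _ e _ (fun p q r s => alt_act F A x p q r s * F p q r s)).
  rewrite (alt_act_trace gP oe se sigma2 F_lin1 F12 F23 F34 F_contract A_skew A_is7).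
  by field.
by move=> p q r s; rewrite alt_derivation_vec4.
Qed.

Lemma alt_derivation_formula x y z :
  let theta := lee_of sigma g Phi alt_derivation in
  16%:R * g (A x y) z =
  2%:R * inner_form g (int_prod x alt_derivation) (test_form g Phi y z)
  - 7%:R * (g x y * theta z - g x z * theta y)
  + 7%:R * sigma * Phi (vec4 x (sharp g theta) y z).
Proof.
move=> theta; have thetaE u : theta u = - (16%:R / 7%:R) * trace_act g e A u.
  exact: lee_alt_derivation.
have theta_lin : lin theta.
  move=> c u v; rewrite !thetaE /trace_act mulrCA -mulrDr; congr (_ * _).
  rewrite -sum1Z -sum1D; apply: eq_sum1 => p.
  by case: (A_skew p) => lA _; rewrite lA (inner_linl gP).
have -> : Phi (vec4 x (sharp g theta) y z) = - (16%:R / 7%:R) *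
    sum1 e (fun q => trace_act g e A q * F x y z q).
  rewrite -[LHS](F_1342 F23 F34 x (sharp g theta) y z) -sum1Z.
  rewrite -(sum1_gl gP oe se _ (F_lin4 F_lin1 F12 F23 F34 x y z)).
  by apply: eq_sum1 => q; rewrite (sharp_lin gP oe se)// thetaE mulrA.
by rewrite inner_alt_derivation_test !thetaE; field.
Qed.

End Alternation.

End PointwiseSpin7.

(** * Covariant derivatives in a local Cayley frame *)

Section Connections.
Variables (R : realType) (M : smooth_manifold R 8).
Unset Implicit Arguments.
Variable g : metric_field M.
Set Implicit Arguments.
Hypothesis gR : riemannian_metric g.
Implicit Types (p q : M) (U : set M).

Let gP p : is_inner_product (g p). Proof. by case: gR. Qed.

Section ConnectionSums.
Unset Implicit Arguments.
Variable D : connection_data M.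
Set Implicit Arguments.
Hypothesis DC : is_connection D.

Lemma connection0 p (x : tangent p) : D p x (fun=> 0) = 0.
Proof.
have := conn_add DC x (smooth_field_near0 p) (smooth_field_near0 p).
have -> : (fun q : M => 0 + 0 : tangent q) = (fun=> 0).
  by apply/functional_extensionality_dep => q; rewrite addr0.
by move=> /eqP; rewrite -subr_eq0 opprD addrA subrr sub0r oppr_eq0 => /eqP.
Qed.

Lemma connection_sum p (x : tangent p) (I : Type) (r : seq I) (Y : I -> vfield M) :
  (forall i, smooth_field_near p (Y i)) ->
  D p x (fun q => \sum_(i <- r) Y i q) = \sum_(i <- r) D p x (Y i).
Proof.
move=> sY; elim: r => [|i r IH].
  rewrite big_nil -[RHS](connection0 x); congr (D p x _).
  by apply/functional_extensionality_dep => q; rewrite big_nil.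
rewrite big_cons -IH -conn_add//; last exact: smooth_field_near_sum.
congr (D p x _).
by apply/functional_extensionality_dep => q; rewrite big_cons.
Qed.

End ConnectionSums.

Section LocalFrame.
Unset Implicit Arguments.
Variables (U : set M) (e : 'I_8 -> vfield M).
Set Implicit Arguments.
Hypotheses (oU : open U) (se : forall a, smooth_field_on U (e a))
  (oe : forall q, U q -> orthonormal (g q) (fun a => e a q))
  (spe : forall q, U q -> spanning (fun a => e a q)).

Lemma frame_smooth_near p a : U p -> smooth_field_near p (e a).
Proof. by move=> Up; exists U. Qed.

Lemma inner_smooth_near p (X Y : vfield M) : smooth_field_near p X ->
  smooth_field_near p Y -> smooth_near p (fun q => g q (X q) (Y q)).
Proof.
move=> [W [oW Wp sX]] [W' [oW' W'p sY]]; exists (W `&` W'); split=> //.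
  exact: openI.
apply: gR.2; first exact: openI.
  by apply: smooth_field_on_sub sX => q [].
by apply: smooth_field_on_sub sY => q [].
Qed.

Definition coframe (Y : vfield M) a : M -> R := fun q => g q (Y q) (e a q).

Lemma coframe_smooth_near p (Y : vfield M) a : U p -> smooth_field_near p Y ->
  smooth_near p (coframe Y a).
Proof. by move=> Up sY; apply: inner_smooth_near => //; exact: frame_smooth_near. Qed.

Lemma field_expand q (Y : vfield M) : U q ->
  Y q = \sum_a coframe Y a q *: e a q.
Proof. by move=> Uq; exact: (orthonormal_expand (gP q) (oe Uq) (spe Uq)). Qed.

(** The part of a covariant derivative that is tensorial in the differentiated
    field; the rest differentiates its components in the frame. *)
Definition connection_form (D : connection_data M) p (x y : tangent p) : tangent p :=
  \sum_a g p y (e a p) *: D p x (e a).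

Lemma connection_frame (D : connection_data M) p (x : tangent p) (Y : vfield M) :
  is_connection D -> U p -> smooth_field_near p Y ->
  D p x Y = \sum_a x (coframe Y a) *: e a p + connection_form D x (Y p).
Proof.
move=> DC Up sY.
have sc a := coframe_smooth_near a Up sY.
have sZ a : smooth_field_near p (fun q => coframe Y a q *: e a q).
  by apply: smooth_field_nearZ => //; exact: frame_smooth_near.
rewrite (conn_local DC x sY (smooth_field_near_sum (index_enum _) sZ)); last first.
  by apply: filterS (open_nbhs_nbhs (conj oU Up)) => q Uq; exact: field_expand.
rewrite connection_sum// -big_split/=; apply: eq_bigr => a _.
by rewrite conn_leibniz//; exact: frame_smooth_near.
Qed.

Lemma connection_form_linl (D : connection_data M) p (y : tangent p) :
  is_connection D -> U p -> linmap (fun x => connection_form D x y).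
Proof.
move=> DC Up c x z; rewrite /connection_form scaler_sumr -big_split/=.
apply: eq_bigr => a _; rewrite conn_linear//; last exact: frame_smooth_near.
by rewrite scalerDr !scalerA mulrC.
Qed.

Lemma connection_form_linr (D : connection_data M) p (x : tangent p) :
  linmap (connection_form D x).
Proof.
move=> c y z; rewrite /connection_form scaler_sumr -big_split/=.
by apply: eq_bigr => a _; rewrite (inner_linl (gP p)) scalerDl scalerA.
Qed.

Lemma connection_form_frame (D : connection_data M) p (x : tangent p) b :
  U p -> connection_form D x (e b p) = D p x (e b).
Proof.
move=> Up; rewrite /connection_form (bigD1 b)//= (oe Up) eqxx scale1r.
by rewrite big1 ?addr0// => a ab; rewrite (oe Up) eq_sym (negPf ab) scale0r.
Qed.

(** The frame has constant inner products, so a metric connection acts on it by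
    a skew-symmetric operator. *)
Lemma connection_form_skew (D : connection_data M) p (x : tangent p) :
  metric_connection g D -> U p -> skew_op (g p) (connection_form D x).
Proof.
move=> [DC Dg] Up; split=> [|y z]; first exact: connection_form_linr.
have ee a b : g p (D p x (e a)) (e b p) + g p (e a p) (D p x (e b)) = 0.
  rewrite -Dg; try exact: frame_smooth_near.
  rewrite -(tangent_cst x (a == b)%:R); apply: tangent_eq.
  - by apply: inner_smooth_near; exact: frame_smooth_near.
  - exact: smooth_near_cst.
  by apply: filterS (open_nbhs_nbhs (conj oU Up)) => q Uq; exact: oe.
apply/eqP; rewrite -addr_eq0; apply/eqP.
pose f y z := g p (connection_form D x y) z + g p y (connection_form D x z).
rewrite -/(f y z).
have lw := @connection_form_linr D p x.
have l1 w : lin (fun y => f y w).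
  apply: lin_add; last exact: (inner_linl (gP p)).
  exact: (lin_comp (inner_linl (gP p) w) lw).
have l2 w : lin (f w).
  apply: lin_add; first exact: (inner_linr (gP p)).
  exact: (lin_comp (inner_linr (gP p) w) lw).
apply: (lin_eq (gP p) (oe Up) (spe Up) (l1 z) (@lin_zero R _)) => a.
apply: (lin_eq (gP p) (oe Up) (spe Up) (l2 (e a p)) (@lin_zero R _)) => b.
by rewrite /f !connection_form_frame.
Qed.

(** The field with constant components in the frame extends [v]. *)
Lemma extendP p (v : tangent p) : U p ->
  smooth_field_near p (extend v) /\ extend v p = v.
Proof.
move=> Up; rewrite /extend; case: xgetP => [X -> //|noX].
case: (noX (fun q => \sum_a g p v (e a p) *: e a q)); split.
  apply: smooth_field_near_sum => a; apply: smooth_field_nearZ.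
    exact: smooth_near_cst.
  exact: frame_smooth_near.
by rewrite -(orthonormal_expand (gP p) (oe Up) (spe Up)).
Qed.

(** The derivatives of the components of [Y] are common to both connections. *)
Lemma conn_diff_tensorial (D D' : connection_data M) p (x : tangent p) (Y : vfield M) :
  is_connection D -> is_connection D' -> U p -> smooth_field_near p Y ->
  D' p x Y = D p x Y + conn_diff D' D x (Y p).
Proof.
move=> DC DC' Up sY; have [sE EY] := extendP (Y p) Up.
rewrite /conn_diff !(connection_frame _ DC Up) ?(connection_frame _ DC' Up)// EY.
by rewrite opprD [X in _ = _ + X]addrACA subrr add0r -[RHS]addrA
  [X in _ = _ + X]addrCA subrr addr0.
Qed.

End LocalFrame.

End Connections.

(** * Covariant and exterior derivatives of a form *)

Section Tensoriality.
Variables (R : realType) (n : nat) (M : smooth_manifold R n).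

Lemma tangent_prod m (p : M) (x : tangent p) (f : 'I_m -> M -> R) :
  (forall i, smooth_near p (f i)) ->
  smooth_near p (fun q => \prod_i f i q) /\
  x (fun q => \prod_i f i q) =
  \sum_i x (f i) * \prod_j (if j == i then 1 else f j p).
Proof.
elim: m f => [|m IH] f sf.
  rewrite big_ord0 (_ : (fun q => _) = fun=> 1).
    by split; [exact: smooth_near_cst|exact: tangent_cst].
  by apply/funext => q; rewrite big_ord0.
have [sP xP] := IH (fun i => f (lift ord0 i)) (fun i => sf _).
rewrite (_ : (fun q => _) = fun q => f ord0 q * \prod_i f (lift ord0 i) q); last first.
  by apply/funext => q; rewrite big_ord_recl.
split; first exact: smooth_nearM.
rewrite tangentM// xP big_ord_recl big_ord_recl eqxx mul1r; congr (_ * _ + _).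
rewrite mulr_sumr; apply: eq_bigr => i _; rewrite big_ord_recl /= mulrCA.
by congr (_ * (_ * _)); apply: eq_bigr => j _; rewrite (inj_eq lift_inj).
Qed.

Lemma smooth_fields_near m p (V : 'I_m -> vfield M) :
  (forall i, smooth_field_near p (V i)) ->
  exists W, [/\ open W, W p & forall i, smooth_field_on W (V i)].
Proof.
elim: m V => [|m IH] V sV.
  by exists setT; split=> // [|[]//]; exact: openT.
have [W [oW Wp sW]] := IH (fun i => V (lift ord0 i)) (fun i => sV _).
have [W' [oW' W'p sW']] := sV ord0.
exists (W `&` W'); split=> // [|i]; first exact: openI.
case: (unliftP ord0 i) => [j ->|->].
  by apply: smooth_field_on_sub (sW j) => q [].
by apply: smooth_field_on_sub sW' => q [].
Qed.

Lemma form_smooth_near k (a : form_field M k) p (V : 'I_k -> vfield M) :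
  differential_form a -> (forall i, smooth_field_near p (V i)) ->
  smooth_near p (fun q => a q (fun i => V i q)).
Proof.
move=> [_ da] /smooth_fields_near[W [oW Wp sV]].
by exists W; split=> //; exact: da.
Qed.

Lemma skew_update (V : lmodType R) k (a : form V k.+1) (u : 'I_k.+1 -> V) j w :
  skew_form a -> a [eta u with j |-> w] = (-1) ^+ j * a (fcons w (u \o lift j)).
Proof.
move=> sa; have := skew_fcons_lift [eta u with j |-> w] j sa.
rewrite /= eqxx.
have -> : [eta u with j |-> w] \o lift j = u \o lift j.
  by apply/funext => i /=; rewrite eq_sym (negPf (neq_lift _ _)).
by move=> ->; rewrite mulrA -expr2 sqrr_sign mul1r.
Qed.

(** A pair of omitted arguments is determined by the smaller one and by the
    position of the other one among those left. *)
Lemma sum_lower_pairs m (G : 'I_m.+2 -> 'I_m.+1 -> R) :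
  \sum_(i : 'I_m.+2) \sum_(j : 'I_m.+1 | (j < i)%N) G i j =
  \sum_(i : 'I_m.+2) \sum_(j : 'I_m.+1 | (i <= j)%N) G (lift i j) (inord i).
Proof.
rewrite [RHS]big_ord_recr /= [X in _ = _ + X]big1 ?addr0; last first.
  by move=> j; rewrite leqNgt ltn_ord.
rewrite (exchange_big_dep xpredT)//=; apply: eq_bigr => j _.
rewrite big_mkcond (bigD1_ord (widen_ord (leqnSn _) j))//= ltnn add0r -big_mkcond.
apply: eq_big => l.
  rewrite /bump; case: (leqP j l) => jl; first by rewrite ltnS jl.
  by apply/negbTE; rewrite -leqNgt ltnW.
by move=> _; congr (G _ _); apply: val_inj; rewrite /= inordK.
Qed.

(** Torsion-freeness turns the brackets of the invariant formula into the
    terms in which a covariant derivative differentiates the arguments. *)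
Lemma ext_d_cov_deriv k (a : form_field M k.+1) (D : connection_data M) p
    (v : 'I_k.+2 -> tangent p) :
  is_form (a p) ->
  (forall X Y, smooth_field_near p X -> smooth_field_near p Y ->
     D p (X p) Y - D p (Y p) X = lie_bracket X Y p) ->
  (forall w : tangent p, smooth_field_near p (extend w) /\ extend w p = w) ->
  ext_d a p v = \sum_(i < k.+2) (-1) ^+ i * cov_deriv D a (v i) (v \o lift i).
Proof.
move=> fa tf ext; rewrite /ext_d /cov_deriv.
pose T (i : 'I_k.+2) (j : 'I_k.+1) : R := (-1) ^+ i * ((-1) ^+ j *
  a p (fcons (D p (v i) (extend (v (lift i j)))) ((v \o lift i) \o lift j))).
under [RHS]eq_bigr do rewrite mulrBr.
rewrite [RHS]sumrB; congr (_ + _).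
transitivity (- \sum_i \sum_j T i j); last first.
  congr (- _); apply: eq_bigr => i _; rewrite mulr_sumr; apply: eq_bigr => j _.
  by rewrite (skew_update _ _ _ (is_form_skew fa)).
have -> : \sum_i \sum_j T i j =
    \sum_(i : 'I_k.+2) \sum_(j : 'I_k.+1 | (i <= j)%N) T i j +
    \sum_(i : 'I_k.+2) \sum_(j : 'I_k.+1 | (i <= j)%N) T (lift i j) (inord i).
  rewrite -sum_lower_pairs -big_split/=; apply: eq_bigr => i _.
  rewrite (bigID (fun j : 'I_k.+1 => (i <= j)%N)) /=; congr (_ + _).
  by apply: eq_bigl => j; rewrite ltnNge.
rewrite -big_split -sumrN /=; apply: eq_bigr => i _.
rewrite -big_split -sumrN /=; apply: eq_bigr => j ij.
have ji : (inord i : 'I_k.+1) = i :> nat by rewrite inordK// (leq_ltn_trans ij).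
have li : lift (lift i j) (inord i : 'I_k.+1) = i.
  by apply: val_inj; rewrite /= ji /bump; lia.
have lE : (v \o lift (lift i j)) \o lift (inord i : 'I_k.+1) = (v \o lift i) \o lift j.
  apply/funext => l /=; congr v; apply: val_inj; rewrite /= ji /bump; lia.
rewrite /T lE li ji /= -tf; [|exact: (ext _).1..].
rewrite !(ext _).2 (_ : bump i j = j.+1); last by rewrite /bump ij.
have la := multilinear_lin0 ((v \o lift i) \o lift j) fa.1.
set X := D p (v i) _; set Y := D p (v (lift i j)) _.
have -> : a p (fcons (X - Y) (fun l => v (lift i (lift j l)))) =
    a p (fcons X ((v \o lift i) \o lift j)) - a p (fcons Y ((v \o lift i) \o lift j)).
  by have := la (-1) Y X; rewrite scaleN1r mulN1r [- Y + X]addrC [RHS]addrC.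
by rewrite !exprD !exprS; ring.
Qed.

End Tensoriality.

Section CovariantDerivativeFrame.
Variables (R : realType) (M : smooth_manifold R 8).
Unset Implicit Arguments.
Variables (g : metric_field M) (Phi : form_field M 4).
Set Implicit Arguments.
Hypotheses (gR : riemannian_metric g) (PhiD : differential_form Phi).
Unset Implicit Arguments.
Variables (b : bool) (U : set M) (e : 'I_8 -> vfield M).
Set Implicit Arguments.
Hypotheses (oU : open U) (se : forall a, smooth_field_on U (e a))
  (oe : forall q, U q -> orthonormal (g q) (fun a => e a q))
  (cay : forall q, U q -> cayley_frame ((-1) ^+ b) (Phi q) (fun a => e a q)).

Let gP p : is_inner_product (g p). Proof. by case: gR. Qed.
Let spe q (Uq : U q) : spanning (fun a => e a q) := cayley_spanning (cay Uq).

Lemma frame_component_cst p q (t : 'I_4 -> 'I_8) : U p -> U q ->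
  Phi q (fun i => e (t i) q) = Phi p (fun i => e (t i) p).
Proof.
move=> Up Uq; rewrite (vec4_of (fun i => e (t i) q)) (vec4_of (fun i => e (t i) p)).
by rewrite !(cayley_component (cay _)).
Qed.

(** In a Cayley frame the components of the fundamental form are constant, so
    only the connection form contributes to its covariant derivative. *)
Lemma cov_deriv_frame (D : connection_data M) p (x : tangent p)
    (V : 'I_4 -> vfield M) : is_connection D -> U p ->
  (forall i, smooth_field_near p (V i)) ->
  x (fun q => Phi q (fun i => V i q))
  - \sum_(i < 4) Phi p [eta (fun i => V i p) with i |-> D p x (V i)] =
  - derivation_act (Phi p) (connection_form g e D x) (fun i => V i p).
Proof.
move=> DC Up sV; pose f i a := coframe g e (V i) a.
have fs i a : smooth_near p (f i a) by exact: (coframe_smooth_near gR oU se).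
pose c (t : {ffun 'I_4 -> 'I_8}) := Phi p (fun i => e (t i) p).
have sprod (t : {ffun 'I_4 -> 'I_8}) := tangent_prod x (fun i => fs i (t i)).
have xPhi : x (fun q => Phi q (fun i => V i q)) =
    \sum_(t : {ffun 'I_4 -> 'I_8}) c t *
      \sum_i x (f i (t i)) * \prod_j (if j == i then 1 else f j (t j) p).
  transitivity (x (fun q => \sum_(t : {ffun 'I_4 -> 'I_8})
      c t * \prod_i f i (t i) q)).
    apply: tangent_eq.
    - exact: form_smooth_near.
    - apply: smooth_near_sum => t; apply: smooth_nearM; first exact: smooth_near_cst.
      exact: (sprod t).1.
    apply: filterS (open_nbhs_nbhs (conj oU Up)) => q Uq.
    rewrite (multilinear_expand (gP q) (oe Uq) (spe Uq) _ (PhiD.1 q).1).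
    by apply: eq_bigr => t _; rewrite mulrC /c (frame_component_cst t Up Uq).
  rewrite tangent_sum => [|t]; last first.
    by apply: smooth_nearM; [exact: smooth_near_cst|exact: (sprod t).1].
  apply: eq_bigr => t _; rewrite tangentZ ?(sprod t).2//.
  exact: (sprod t).1.
rewrite xPhi /derivation_act -!sumrN.
under eq_bigr do rewrite mulr_sumr.
rewrite exchange_big -big_split/=; apply: eq_bigr => i _.
rewrite (connection_frame gR oU se oe spe x DC Up (sV i)).
rewrite (multilinearD _ _ _ _ (PhiD.1 p).1) opprD addrA.
rewrite [X in X + _ = _](_ : _ = 0) ?add0r//; apply/eqP; rewrite subr_eq0; apply/eqP.
rewrite (multilinear_expand (gP p) (oe Up) (spe Up) _ (PhiD.1 p).1).
apply: eq_bigr => t _; rewrite mulrC; congr (_ * _).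
rewrite [RHS](bigD1 i)//= eqxx (lin_sum _ _ _ (inner_linl (gP p) _)); congr (_ * _).
  rewrite (bigD1 (t i))//= (oe Up) eqxx mulr1 big1 ?addr0// => a ai.
  by rewrite (oe Up) (negPf ai) mulr0.
rewrite (bigD1 i)//= eqxx mul1r; apply: eq_bigr => j ji.
by rewrite (negPf ji).
Qed.

Lemma cov_deriv_Phi (D : connection_data M) p (x : tangent p) v :
  is_connection D -> U p ->
  cov_deriv D Phi x v = - derivation_act (Phi p) (connection_form g e D x) v.
Proof.
move=> DC Up; have ext w := extendP gR oU se oe spe w Up.
have vE : v = fun i => extend (v i) p by apply/funext => i; rewrite (ext _).2.
rewrite {2}vE -(cov_deriv_frame x DC Up (fun i => (ext (v i)).1)) /cov_deriv.
by rewrite -vE.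
Qed.

End CovariantDerivativeFrame.

(** * The minimal connection *)

Section MinimalConnection.
Variables (R : realType) (M : smooth_manifold R 8) (b : bool).
Unset Implicit Arguments.
Variables (Phi : form_field M 4) (g : metric_field M) (nabla : connection_data M).
Set Implicit Arguments.
Implicit Types p q : M.
Let sigma : R := (-1) ^+ b.
Hypotheses (PhiS : spin7_structure sigma Phi g) (nablaL : levi_civita g nabla).

Let gR : riemannian_metric g := spin7_metric PhiS.
Let gP p : is_inner_product (g p). Proof. by case: gR. Qed.
Let PhiD : differential_form Phi := spin7_form PhiS.
Let fP p : is_form (Phi p) := PhiD.1 p.
Let nablaM : metric_connection g nabla := nablaL.1.
Let nablaC : is_connection nabla := nablaM.1.
Let F p x y z w := Phi p (vec4 x y z w).

Lemma local_frame p : exists U (e : 'I_8 -> vfield M),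
  [/\ open U, U p, forall a, smooth_field_on U (e a),
      forall q, U q -> orthonormal (g q) (fun a => e a q) &
      forall q, U q -> cayley_frame sigma (Phi q) (fun a => e a q)].
Proof.
have [U [e [oU Up se cay]]] := spin7_local_frame PhiS p.
by exists U, e; split=> // q Uq; apply: (spin7_orthonormal PhiS); exact: cay.
Qed.

Lemma smooth_extension p (v : tangent p) :
  smooth_field_near p (extend v) /\ extend v p = v.
Proof.
have [U [e [oU Up se oe cay]]] := local_frame p.
exact: (extendP gR oU se oe (fun q Uq => cayley_spanning (cay q Uq)) v Up).
Qed.

Lemma sharp_inner p (f : tangent p -> R) y : lin f -> g p (sharp (g p) f) y = f y.
Proof.
have [U [e [oU Up se oe cay]]] := local_frame p.
exact: (sharp_lin (gP p) (oe p Up) (cayley_spanning (cay p Up))).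
Qed.

Definition torsion p (x y : tangent p) : tangent p :=
  sharp (g p) (fun z => 4%:R^-1 * rbar Phi g nabla x y z).

Section InFrame.
Unset Implicit Arguments.
Variables (U : set M) (e : 'I_8 -> vfield M).
Set Implicit Arguments.
Hypotheses (oU : open U) (se : forall a, smooth_field_on U (e a))
  (oe : forall q, U q -> orthonormal (g q) (fun a => e a q))
  (cay : forall q, U q -> cayley_frame sigma (Phi q) (fun a => e a q)).
Let spe q (Uq : U q) : spanning (fun a => e a q) := cayley_spanning (cay Uq).

Definition frame_action p (x y : tangent p) : tangent p :=
  - connection_form g e nabla x y.

Lemma frame_action_skew p (x : tangent p) : U p -> skew_op (g p) (frame_action x).
Proof.
move=> Up; have [lc sc] := connection_form_skew gR oU se oe spe x nablaM Up.
split=> [c y z|y z]; rewrite /frame_action; first by rewrite lc opprD scalerN.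
have gN u v : g p (- u) v = - g p u v.
  by rewrite -scaleN1r (linZ _ _ (inner_linl (gP p) v)) mulN1r.
by rewrite gN (inner_sym (gP p) y) gN (inner_sym (gP p) _ y) sc.
Qed.

Lemma frame_action_lin p (y : tangent p) : U p -> linmap (fun x => frame_action x y).
Proof.
move=> Up c x z; rewrite /frame_action.
by rewrite (connection_form_linl g oU se y nablaC Up) opprD scalerN.
Qed.

Lemma nabla_Phi_frame p (x : tangent p) : U p ->
  cov_deriv nabla Phi x = derivation_act (Phi p) (frame_action x).
Proof.
move=> Up; apply/funext => v.
rewrite (cov_deriv_Phi gR PhiD oU se oe cay x v nablaC Up) /derivation_act -sumrN.
by apply: eq_bigr => i _; rewrite (multilinearN _ _ _ (fP p).1).
Qed.

Lemma rbar_frame p (x y z : tangent p) : U p -> rbar Phi g nabla x y z =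
  4%:R * proj7 (g p) (fun a => e a p) sigma (@F p) (frame_action x) y z.
Proof.
move=> Up; rewrite /rbar nabla_Phi_frame//.
apply: (inner_derivation_test (gP p) (oe Up) (fP p) (cay Up)).
exact: frame_action_skew.
Qed.

Lemma torsion_frame p (x : tangent p) : U p -> torsion x =
  proj7_op (g p) (fun a => e a p) sigma (@F p) (frame_action x).
Proof.
move=> Up; apply/funext => y; apply: (inner_inj (gP p)) => z.
have E u : 4%:R^-1 * rbar Phi g nabla x y u =
    g p (proj7_op (g p) (fun a => e a p) sigma (@F p) (frame_action x) y) u.
  rewrite rbar_frame// (proj7_op_inner (gP p) (oe Up) (fP p) (cay Up)).
  by rewrite mulKf// pnatr_eq0.
by rewrite sharp_inner ?E// => c u v; rewrite !E (inner_linr (gP p)).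
Qed.

Lemma torsion_is7 p (x : tangent p) : U p ->
  is7 (g p) (fun a => e a p) sigma (@F p) (torsion x).
Proof.
move=> Up; rewrite torsion_frame//.
by case: (proj7_op_derivation (gP p) (oe Up) (fP p) (cay Up) (frame_action_skew x Up)).
Qed.

End InFrame.

Lemma torsion_skew p (x : tangent p) : skew_op (g p) (torsion x).
Proof.
have [U [e [oU Up se oe cay]]] := local_frame p.
rewrite (torsion_frame oU se oe cay x Up).
by case: (proj7_op_derivation (gP p) (oe p Up) (fP p) (cay p Up)
  (frame_action_skew oU se oe cay x Up)).
Qed.

Lemma torsion_perp p (x : tangent p) : spin7_perp (g p) (Phi p) (torsion x).
Proof.
have [U [e [oU Up se oe cay]]] := local_frame p.
apply/(spin7_perp_is7 (gP p) (oe p Up) (fP p) (cay p Up)); split.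
  exact: torsion_skew.
exact: (torsion_is7 oU se oe cay x Up).
Qed.

(** The action on [Phi] does not distinguish the frame action from its
    projection. *)
Lemma nabla_Phi p (x : tangent p) v :
  cov_deriv nabla Phi x v = derivation_act (Phi p) (torsion x) v.
Proof.
have [U [e [oU Up se oe cay]]] := local_frame p.
rewrite (nabla_Phi_frame oU se oe cay x Up) (torsion_frame oU se oe cay x Up).
by case: (proj7_op_derivation (gP p) (oe p Up) (fP p) (cay p Up)
  (frame_action_skew oU se oe cay x Up)) => _ _ ->.
Qed.

Lemma rbar_linl p (y z : tangent p) : lin (fun x => rbar Phi g nabla x y z).
Proof.
have [U [e [oU Up se oe cay]]] := local_frame p.
move=> c x u; rewrite /rbar /inner_form [c * _]mulrCA -mulrDr; congr (_ * _).
rewrite [c * _]mulrCA -mulrDr; congr (_ * _); rewrite mulr_sumr -big_split/=.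
apply: eq_bigr => t _; rewrite !(nabla_Phi_frame oU se oe cay _ Up).
rewrite (derivation_act_lin (A := @frame_action e p) _ _ (fP p).1).
  by rewrite mulrDl mulrA.
by move=> v; exact: (frame_action_lin oU se v Up).
Qed.

Lemma torsion_inner p (x y z : tangent p) :
  g p (torsion x y) z = 4%:R^-1 * rbar Phi g nabla x y z.
Proof.
have [U [e [oU Up se oe cay]]] := local_frame p.
rewrite (torsion_frame oU se oe cay x Up) (rbar_frame oU se oe cay x y z Up).
rewrite (proj7_op_inner (gP p) (oe p Up) (fP p) (cay p Up)).
by rewrite mulKf// pnatr_eq0.
Qed.

Lemma torsion_linl p (y : tangent p) : linmap (fun x => torsion x y).
Proof.
move=> c x u; apply: (inner_inj (gP p)) => z.
by rewrite (inner_linl (gP p)) !torsion_inner rbar_linl mulrDr mulrCA.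
Qed.

Lemma cov_deriv_conn_diff (D : connection_data M) p (x : tangent p) v :
  cov_deriv D Phi x v =
  cov_deriv nabla Phi x v - derivation_act (Phi p) (conn_diff D nabla x) v.
Proof.
rewrite /cov_deriv /derivation_act -addrA -opprD -big_split/=.
congr (_ - _); apply: eq_bigr => i _.
rewrite -(multilinearD _ _ _ _ (fP p).1); congr (Phi p _).
by rewrite /conn_diff addrC subrK.
Qed.

(** ** Smoothness of the torsion *)

(** In a Cayley frame the components of the torsion are polynomials in
    components of smooth fields and values of [Phi] and of [g] on them. *)
Lemma torsion_smooth U (X Y : vfield M) : open U ->
  smooth_field_on U X -> smooth_field_on U Y ->
  smooth_field_on U (fun q => torsion (X q) (Y q)).
Proof.
move=> oU sX sY; apply: smooth_field_on_local => p Up.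
have [W [e [oW Wp sWe oe cay]]] := local_frame p; exists W; split=> //.
have oUW : open (U `&` W) by exact: openI.
have se a : smooth_field_on (U `&` W) (e a).
  by apply: smooth_field_on_sub (sWe a) => q [].
have sX' : smooth_field_on (U `&` W) X by apply: smooth_field_on_sub sX => q [].
have sY' : smooth_field_on (U `&` W) Y by apply: smooth_field_on_sub sY => q [].
have sg (Z Z' : vfield M) : smooth_field_on (U `&` W) Z ->
    smooth_field_on (U `&` W) Z' ->
    smooth_on (U `&` W) (fun q => g q (Z q) (Z' q)).
  by move=> sZ sZ'; apply: gR.2.
have sN a : smooth_field_on (U `&` W) (fun q => nabla q (X q) (e a)).
  exact: (conn_smooth nablaC).
(* The components of [frame_action]. *)
pose w a c q := - 1 * g q (nabla q (X q) (e a)) (e c q).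
have sw a c : smooth_on (U `&` W) (w a c).
  by apply: smooth_onM => //; [exact: smooth_on_cst|exact: sg].
have sF a c (Z Z' : vfield M) : smooth_field_on (U `&` W) Z ->
    smooth_field_on (U `&` W) Z' ->
    smooth_on (U `&` W) (fun q => F (e a q) (e c q) (Z q) (Z' q)).
  move=> sZ sZ'; pose V (i : 'I_4) : vfield M :=
    fun q => vec4 (e a q) (e c q) (Z q) (Z' q) i.
  apply: (PhiD.2 _ V oUW) => i; case: i => -[|[|[|[|//]]]] i4.
  - by apply: eq_smooth_field_on (se a) => q _; rewrite /V vec4E.
  - by apply: eq_smooth_field_on (se c) => q _; rewrite /V vec4E.
  - by apply: eq_smooth_field_on sZ => q _; rewrite /V vec4E.
  - by apply: eq_smooth_field_on sZ' => q _; rewrite /V vec4E.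
pose coef c q := 4%:R^-1 * \sum_a g q (Y q) (e a q) * w a c q +
  - (sigma / 8%:R) * \sum_a \sum_d w a d q * F (e a q) (e d q) (Y q) (e c q).
have scoef c : smooth_on (U `&` W) (coef c).
  apply: smooth_onD => //; apply: smooth_onM => //; try exact: smooth_on_cst.
    by apply: smooth_on_sum => // a; apply: smooth_onM => //; exact: sg.
  apply: smooth_on_sum => // a; apply: smooth_on_sum => // d.
  by apply: smooth_onM => //; exact: sF.
have sfield : smooth_field_on (U `&` W) (fun q => \sum_c coef c q *: e c q).
  by apply: smooth_field_on_sum => c; apply: smooth_field_onZ.
apply: eq_smooth_field_on sfield => q [Uq Wq].
have spq : spanning (fun a => e a q) := cayley_spanning (cay q Wq).
rewrite [RHS](orthonormal_expand (gP q) (oe q Wq) spq); apply: eq_bigr => c _.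
congr (_ *: _); have [lA _] := frame_action_skew oW sWe oe cay (X q) Wq.
rewrite (torsion_frame oW sWe oe cay (X q) Wq).
rewrite (proj7_op_inner (gP q) (oe q Wq) (fP q) (cay q Wq)) /proj7 /coef.
have wE a d : w a d q = g q (frame_action e (X q) (e a q)) (e d q).
  rewrite /w /frame_action (connection_form_frame oe _ _ _ Wq) -[in RHS]scaleN1r.
  by rewrite (linZ _ _ (inner_linl (gP q) _)).
congr (_ * _ + _); last rewrite mulNr; last congr (- (_ * _)).
  rewrite (lin_expand (gP q) (oe q Wq) spq (Y q)
    (lin_comp (inner_linl (gP q) (e c q)) lA)).
  by apply: eq_bigr => a _; rewrite wE.
rewrite /phi_map /sum1 /=; apply: eq_bigr => a _.
rewrite (lin_expand (gP q) (oe q Wq) spq (frame_action e (X q) (e a q))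
  (f := fun u => Phi q (vec4 (e a q) u (Y q) (e c q)))).
  by apply: eq_bigr => d _; rewrite wE.
by move=> k u v; have := (fP q).1 (vec4 (e a q) 0 (Y q) (e c q)) (inord 1) k u v;
  rewrite !vec4_update1.
Qed.

(** ** Existence, uniqueness and the formula for the exterior derivative *)

Lemma torsion_minimal : exists D, minimal_spin7_connection Phi g nabla D.
Proof.
pose D : connection_data M := fun p x Y => nabla p x Y + torsion x (Y p).
have DE p (x y : tangent p) : conn_diff D nabla x y = torsion x y.
  rewrite /conn_diff /D (smooth_extension y).2.
  by rewrite addrC addKr.
exists D; split.
- split=> [|p v X Y sX sY]; last first.
    rewrite (nablaM.2 p v X Y sX sY) /D.
    have [_ sk] := torsion_skew v.
    rewrite (linD _ _ (inner_linl (gP p) (Y p))) (linD _ _ (inner_linr (gP p) (X p))).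
    by rewrite sk; ring.
  split=> [p c v w Y sY|p v Y Z sY sZ|p v f Y sf sY|p v Y Z sY sZ YZ|U X Y oU sX sY].
  + by rewrite /D (conn_linear nablaC)// torsion_linl scalerDr addrACA.
  + rewrite /D (conn_add nablaC)//.
    have [lt _] := torsion_skew v.
    by have := lt 1 (Y p) (Z p); rewrite !scale1r => ->; rewrite addrACA.
  + rewrite /D (conn_leibniz nablaC)// scalerDr addrA.
    have [lt _] := torsion_skew v; congr (_ + _).
    have t0 : torsion v 0 = 0.
      have := lt 1 0 0; rewrite scaler0 addr0 scale1r => /eqP.
      by rewrite -subr_eq0 opprD addrA subrr sub0r oppr_eq0 => /eqP.
    by have := lt (f p) (Y p) 0; rewrite addr0 t0 addr0.
  + by rewrite /D (conn_local nablaC v sY sZ YZ) (nbhs_singleton YZ).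
  + apply: smooth_field_onD; first exact: (conn_smooth nablaC).
    exact: torsion_smooth.
- move=> p x v; rewrite cov_deriv_conn_diff nabla_Phi.
  have -> : conn_diff D nabla x = torsion x by apply/funext => y; exact: DE.
  by rewrite subrr.
- move=> p x; have -> : conn_diff D nabla x = torsion x.
    by apply/funext => y; exact: DE.
  exact: torsion_perp.
Qed.

Lemma conn_diff_field (D : connection_data M) p (x : tangent p) (Y : vfield M) :
  is_connection D -> smooth_field_near p Y ->
  D p x Y = nabla p x Y + conn_diff D nabla x (Y p).
Proof.
move=> DC sY; have [U [e [oU Up se oe cay]]] := local_frame p.
exact: (conn_diff_tensorial gR oU se oe (fun q Uq => cayley_spanning (cay q Uq)) x
  nablaC DC Up sY).
Qed.

(** A minimal connection differs from the Levi-Civita connection by a tensor in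
    the eigenspace that acts on [Phi] as [nabla Phi] does, and the projection
    recovers such a tensor from its action. *)
Lemma minimal_conn_diff (D : connection_data M) p (x : tangent p) :
  minimal_spin7_connection Phi g nabla D -> conn_diff D nabla x = torsion x.
Proof.
move=> [_ DPhi perp]; have [U [e [oU Up se oe cay]]] := local_frame p.
have [sA A7] := (spin7_perp_is7 (gP p) (oe p Up) (fP p) (cay p Up) _).1 (perp p x).
apply/funext => y; apply: (inner_inj (gP p)) => z.
have NE : cov_deriv nabla Phi x = derivation_act (Phi p) (conn_diff D nabla x).
  by apply/funext => v; apply/eqP; rewrite -subr_eq0 -cov_deriv_conn_diff DPhi.
rewrite torsion_inner /rbar NE.
rewrite (inner_derivation_test (gP p) (oe p Up) (fP p) (cay p Up) _ _ sA).
rewrite mulKf ?pnatr_eq0// -(proj7_op_inner (gP p) (oe p Up) (fP p) (cay p Up)).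
by rewrite (is7_proj7_op (gP p) (oe p Up) (fP p) (cay p Up) A7).
Qed.

Lemma ext_d_Phi p : ext_d Phi p = alt_derivation (Phi p) (@torsion p).
Proof.
apply/funext => v.
rewrite (ext_d_cov_deriv v (fP p) (nablaL.2 p) (@smooth_extension p)).
by apply: eq_bigr => i _; rewrite nabla_Phi.
Qed.

Lemma rbar_ext_d p (x y z : tangent p) :
  4%:R * rbar Phi g nabla x y z =
  2%:R * inner_form (g p) (int_prod x (ext_d Phi p)) (test_form (g p) (Phi p) y z)
  - 7%:R * wedge_lee sigma Phi g x y z
  + 7%:R * sigma * Phi p (vec4 x (lee_vector sigma Phi g p) y z).
Proof.
have [U [e [oU Up se oe cay]]] := local_frame p.
have := alt_derivation_formula (gP p) (oe p Up) (fP p) (cay p Up)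
  (@torsion_linl p) (@torsion_skew p)
  (fun x => torsion_is7 oU se oe cay x Up) x y z.
rewrite -ext_d_Phi torsion_inner /wedge_lee /lee_vector /lee_form => <-.
by field.
Qed.

End MinimalConnection.

(* The last summand of the last formula is absent from the printed statement,
   which is false without it: as functions of (Y, Z) the left-hand side and the
   first summand on the right are orthogonal to spin(7), and the wedge product
   of X with the Lee form is not. *)
Theorem theorem3p2 (R : realType) (M : smooth_manifold R 8) (sigma : R)
    (hsigma : sigma = 1 \/ sigma = -1)
    (Phi : form_field M 4) (g : metric_field M)
    (hPhi : spin7_structure sigma Phi g)
    (nabla : connection_data M) (hnabla : levi_civita g nabla) :
  [/\ exists D, minimal_spin7_connection Phi g nabla D,
      forall D, minimal_spin7_connection Phi g nabla D ->
        [/\ forall (p : M) (X : tangent p) (Y : vfield M),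
              smooth_field_near p Y ->
              D p X Y = nabla p X Y + conn_diff D nabla X (Y p),
            forall (p : M) (X Y Z : tangent p),
              g p (conn_diff D nabla X Y) Z =
              4%:R^-1 * rbar Phi g nabla X Y Z &
            forall (p : M) (e : 'I_8 -> tangent p),
              cayley_frame sigma (Phi p) e ->
              forall X Y : tangent p,
              conn_diff D nabla X Y =
              - (sigma / 24%:R) *: \sum_(i < 8) \sum_(j < 8)
                 rbar Phi g nabla X (e i) (e j)
                   *: cross3 (g p) (Phi p) (e i) (e j) Y] &
      forall (p : M) (X Y Z : tangent p),
        4%:R * rbar Phi g nabla X Y Z =
        2%:R * inner_form (g p) (int_prod X (ext_d Phi p))
                 (test_form (g p) (Phi p) Y Z)
        - 7%:R * wedge_lee sigma Phi g X Y Z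
        + 7%:R * sigma * Phi p (vec4 X (lee_vector sigma Phi g p) Y Z)].
Proof.
have [b sb] : exists b : bool, sigma = (-1) ^+ b.
  by case: hsigma => ->; [exists false|exists true].
rewrite {}sb in hPhi *.
have gP p : is_inner_product (g p) by case: (spin7_metric hPhi).
split; first exact: (torsion_minimal hPhi hnabla); last exact: (rbar_ext_d hPhi hnabla).
move=> D Dm; have DE p (x : tangent p) := minimal_conn_diff hPhi hnabla x Dm.
split=> [p X Y sY|p X Y Z|p e fe X Y].
- by apply: (conn_diff_field hPhi hnabla) => //; case: Dm => -[].
- by rewrite DE; exact: (torsion_inner hPhi hnabla).
have oe := spin7_orthonormal hPhi fe; have fP := (spin7_form hPhi).1 p.
have [_ _ perp] := Dm.
have [sA A7] := (spin7_perp_is7 (gP p) oe fP fe _).1 (perp p X).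
apply: (is7_cross3 (gP p) oe fP fe Y sA A7) => i j.
by rewrite DE (torsion_inner hPhi hnabla) mulVKf ?pnatr_eq0.
Qed.
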